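(* Let $v=(v_k)_{k\in\mathbb{Z}}$, $v_k=v_k(t)$, be the Fourier coefficients of $e^{-it\partial_x^2}u(t)$, where $u$ solves the cubic nonlinear Schrödinger equation $i\partial_tu+\partial_x^2u=|u|^2u$ on the one-dimensional torus, so that $$\partial_t v_k=-i\sum_{\substack{k=-k_1+k_2+k_3\\ k_1\neq k_2,k_3}}e^{i\Phi(\bar k)t}\,\overline{v}_{k_1}v_{k_2}v_{k_3}-2i\sum_{k_1\in\mathbb{Z}}\overline{v}_{k_1}v_{k_1}v_k,\qquad \Phi(\bar k)=k^2+k_1^2-k_2^2-k_3^2 ,$$ and let $N$ be the fixed cut-off parameter. With the notation of the context, the main components of the normal form of this equation are given in Fourier space, for $n\ge1$ and $k\in\mathbb{Z}$, by $$\mathcal{N}_2^{(n)}(v)(k)=\partial_t\mathcal{N}_0^{(n)}(v)(k)+\mathcal{N}^{(n+1)}(v)(k)+\mathcal{R}^{(n+1)}(v)(k),$$ where $$\mathcal{N}_0^{(n)}(v)(k)=\sum_{T\in\hat{\mathcal{T}}^{n,k}_0}\frac{\Upsilon(T)(v)}{S(T)}\,\Psi(\mathfrak{a}(T))(t),$$ $$\mathcal{R}^{(n)}(v)(k)=\sum_{\hat T\in\hat{\mathcal{T}}^{n,k}_{\mathrm{res},0}}\frac{\Upsilon(\hat T)(v)}{S(\hat T)}\,i\,\mathscr{F}(\hat T)\,\hat\Psi(\mathfrak{a}(\hat T))(t),$$ $$\mathcal{N}^{(n)}(v)(k)=\sum_{T\in\hat{\mathcal{T}}^{n,k}_0}\frac{\Upsilon(T)(v)}{S(T)}\,i\,\mathscr{F}(T)\,\hat\Psi(\mathfrak{a}(T))(t),$$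 with $$\hat\Psi(T_m\cdots T_1)(t)=e^{i\mathscr{F}(T_m)t}\,\frac{\Psi(T_{m-1}\cdots T_1)(t)}{\sum_{j=1}^m\mathscr{F}(T_j)} .$$ Moreover, $$\mathcal{N}^{(n)}(v)(k)=\mathcal{N}_1^{(n)}(v)(k)+\mathcal{N}_2^{(n)}(v)(k),$$ where $$\mathcal{N}_2^{(n)}(v)(k)=\sum_{T\in\hat{\mathcal{T}}^{n,k}_0}\frac{\Upsilon(T)(v)}{S(T)}\,i\,\mathscr{F}(T)\,\Psi(\mathfrak{a}(T))(t)$$ and $\mathcal{N}_1^{(n)}$ denotes the remaining part of $\mathcal{N}^{(n)}$ (for $n=1$: the restriction of the sum to the trees $T_1$ for which $A(T_1)$ holds).
   Context: All sums and time derivatives are formal. **Trees.** Edges are decorated by pairs $(\mathfrak{t},p)$ with $\mathfrak{t}\in\{\mathfrak{t}_1,\mathfrak{t}_2\}$, $p\in\{0,1\}$ ($p=1$ encodes complex conjugation). Put $P_{\mathfrak{t}_1}(\ell)=-\ell^2$, $P_{\mathfrak{t}_2}(\ell)=\ell^2$, $P_{(\mathfrak{t},p)}(\ell)=(-1)^pP_{\mathfrak{t}}((-1)^p\ell)$. $\mathcal{I}_o(\lambda_\ell F)$ denotes the planted non-planar tree whose root edge has decoration $o$ and whose node above the root edge has frequency $\ell\in\mathbb{Z}$ and carries the forest $F$. A *branch of type $p$ with frequency $\ell$* is either a leaf branch $\mathcal{I}_{(\mathfrak{t}_1,p)}(\lambda_\ell)$ or $\mathcal{I}_{(\mathfrak{t}_1,p)}(\lambda_\ell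 T')$ with $T'$ a tree of type $p$ with frequency $\ell$. A *tree of type $p$ with frequency $k$* is $\mathcal{I}_{(\mathfrak{t}_2,p)}(\lambda_kB_1B_2B_3)$ with $B_1,B_2$ branches of type $p$ and $B_3$ a branch of type $1-p$; if $p_i,\ell_i$ are the type and frequency of $B_i$, one requires $(-1)^pk=\sum_{i=1}^3(-1)^{p_i}\ell_i$. The node carrying $B_1,B_2,B_3$ is a ternary node; it is *non-resonant* if $P_{(\mathfrak{t}_2,p)}(k)+\sum_{i=1}^3P_{(\mathfrak{t}_1,p_i)}(\ell_i)\neq0$. The order of a tree is its number of $\mathfrak{t}_2$-edges. $\hat{\mathcal{T}}^{n,k}_0$ is the set of trees of type $0$, frequency $k$ and order $n$ all of whose ternary nodes are non-resonant. $\hat{\mathcal{T}}^{n,k}_{\mathrm{res},0}$ is defined in the same way except that exactly one ternary node, connected to three leaves, violates the non-resonance condition. **Functionals of trees.** $S(T)$ is the number of automorphisms of the rooted non-planar tree $T$ preserving the edge decorations (frequencies are ignored). $\mathscr{F}(T)=\sum_eP_{(\mathfrak{t}(e),p(e))}(\ell_e)$, the sum over all edges $e$, with $\ell_e$ the frequency of the upper endpoint of $e$. $\Upsilon(T)(v)=2^n\prod_lv_{\ell_l,p_l}$, where $n$ is the order of $T$, $l$ runs over its leaves, $\ell_l$ is the frequency of $l$, $p_l$ the type of the edge leading to $l$, and $v_{\ell,0}=v_\ell$, $v_{\ell,1}=\overline{v}_\ell$. With these notations the two terms on the right-hand side of the equation for $\partial_tv_k$ are written, respectively, as $-\sum_{T_1\in\hat{\mathcal{T}}^{1,k}_0}i\,e^{it\mathscr{F}(T_1)}\frac{\Upsilon(T_1)(v)}{S(T_1)}$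 and $-\sum_{\hat T_1\in\hat{\mathcal{T}}^{1,k}_{\mathrm{res},0}}i\,\frac{\Upsilon(\hat T_1)(v)}{S(\hat T_1)}$; this fixes the convention for sums over sets of trees. **Words and arborification.** Letters are trees of order $1$; words are finite sequences of letters, $\varepsilon$ is the empty word, and the shuffle product $\mathbin{\sqcup\!\sqcup}$ is the bilinear product with $\varepsilon\mathbin{\sqcup\!\sqcup}w=w\mathbin{\sqcup\!\sqcup}\varepsilon=w$ and $(au)\mathbin{\sqcup\!\sqcup}(bw)=a(u\mathbin{\sqcup\!\sqcup}bw)+b(au\mathbin{\sqcup\!\sqcup}w)$ for letters $a,b$. The arborification $\mathfrak{a}$ sends a tree $T=\mathcal{I}_{(\mathfrak{t}_2,p)}(\lambda_kB_1B_2B_3)$ to $\mathfrak{a}(T)=\big(\mathfrak{a}(T'_{1})\mathbin{\sqcup\!\sqcup}\cdots\mathbin{\sqcup\!\sqcup}\mathfrak{a}(T'_{r})\big)T^{\bullet}$ (concatenation with a last letter), where $T'_1,\dots,T'_r$ are the trees carried by those $B_i$ that are not leaf branches (an empty shuffle is $\varepsilon$) and $T^\bullet=\mathcal{I}_{(\mathfrak{t}_2,p)}(\lambda_k\prod_i\mathcal{I}_{(\mathfrak{t}_1,p_i)}(\lambda_{\ell_i}))$ is the letter obtained by replacing each $B_i$ by a leaf branch of the same type and frequency. **The map $\Psi$.** For a word $w=T_m\cdots T_1$, $A(w)$ is the condition $|\sum_{j=1}^m\mathscr{F}(T_j)|\le N$, and $$\Psi(T_m\cdots T_1)(t)=\mathbf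 1_{\bigcap_{q=1}^mA(T_q\cdots T_1)^c}\,\frac{e^{i\sum_{j=1}^m\mathscr{F}(T_j)t}}{\prod_{q=1}^m\sum_{j=1}^q\mathscr{F}(T_j)},$$ with $\Psi(\varepsilon)=1$. $\Psi$ and $\hat\Psi$ are extended linearly to combinations of words.
   Formalization: Each tree sum has an extra factor (-1)^(number of type-1 ternary nodes); R^(n) keeps only words whose first letter is the resonant one and counts a resonant node with l1=l2=l3 twice; F(T) cancels the last denominator of hat-Psi when both vanish; N>=0 is assumed. *)

(* Defs.v *)
From HB Require Import structures.
From mathcomp Require Import all_boot all_order all_algebra all_fingroup.
From mathcomp Require Import finmap multiset.
From mathcomp Require Import all_classical all_reals all_analysis.
From mathcomp Require Import complex zify ring.

Set Implicit Arguments.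
Unset Strict Implicit.
Unset Printing Implicit Defensive.

Import Order.TTheory GRing.Theory Num.Theory.
Import numFieldNormedType.Exports.
Local Open Scope ring_scope.

(* p : bool is the second component of an edge decoration; [true] is p = 1. *)
Inductive etype := t1 | t2.
HB.instance Definition _ := gen_eqMixin etype.
HB.instance Definition _ := gen_choiceMixin etype.

Definition Ptype (e : etype) (l : int) : int :=
  match e with t1 => - l ^+ 2 | t2 => l ^+ 2 end.

Definition P (d : etype * bool) (l : int) : int :=
  (-1) ^+ d.2 * Ptype d.1 ((-1) ^+ d.2 * l).

(* [Tree p k B1 B2 B3] is I_(t2,p)(lambda_k B1 B2 B3), [Leaf p l] is
   I_(t1,p)(lambda_l) and [Carry p l T] is I_(t1,p)(lambda_l T).  These are
   plane trees: see [plane_rep] for the passage to non-planar ones. *)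
Inductive tree := Tree of bool & int & branch & branch & branch
with branch := Leaf of bool & int | Carry of bool & int & tree.
HB.instance Definition _ := gen_eqMixin tree.
HB.instance Definition _ := gen_choiceMixin tree.

Definition btype (B : branch) := match B with Leaf p _ | Carry p _ _ => p end.
Definition bfreq (B : branch) := match B with Leaf _ l | Carry _ l _ => l end.
Definition is_leaf (B : branch) := if B is Leaf _ _ then true else false.

Inductive is_tree : bool -> int -> tree -> Prop :=
| IsTree p k l1 l2 l3 B1 B2 B3 :
    is_branch p l1 B1 -> is_branch p l2 B2 -> is_branch (~~ p) l3 B3 ->
    (-1) ^+ p * k = (-1) ^+ p * l1 + (-1) ^+ p * l2 + (-1) ^+ (~~ p) * l3 ->
    is_tree p k (Tree p k B1 B2 B3)
with is_branch : bool -> int -> branch -> Prop :=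
| IsLeaf p l : is_branch p l (Leaf p l)
| IsCarry p l T : is_tree p l T -> is_branch p l (Carry p l T).

(* An edge is recorded with its address, its decoration and the frequency of
   its upper endpoint.  Addresses are read from the edge down to the root: the
   root edge has address [::] and the edges just above the one at [a] have
   addresses [j :: a]. *)
Definition edge : Type := seq nat * (etype * bool) * int.
Definition addr (e : edge) := e.1.1.
Definition edec (e : edge) := e.1.2.
Definition efreq (e : edge) := e.2.

Fixpoint edges_from (a : seq nat) (T : tree) : seq edge :=
  let: Tree p k B1 B2 B3 := T in
  (a, (t2, p), k) :: edges_above (0%N :: a) B1 ++ edges_above (1%N :: a) B2
                     ++ edges_above (2%N :: a) B3
with edges_above (a : seq nat) (B : branch) : seq edge :=
  match B with
  | Leaf p l => [:: (a, (t1, p), l)]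
  | Carry p l T => (a, (t1, p), l) :: edges_from (0%N :: a) T
  end.

Definition edges (T : tree) := edges_from [::] T.

Fixpoint leaves (T : tree) : seq (int * bool) :=
  let: Tree _ _ B1 B2 B3 := T in
  leaves_above B1 ++ leaves_above B2 ++ leaves_above B3
with leaves_above (B : branch) : seq (int * bool) :=
  match B with Leaf p l => [:: (l, p)] | Carry _ _ T => leaves T end.

(* A ternary node is represented by the subtree planted just below it. *)
Fixpoint nodes (T : tree) : seq tree :=
  let: Tree _ _ B1 B2 B3 := T in
  T :: nodes_above B1 ++ nodes_above B2 ++ nodes_above B3
with nodes_above (B : branch) : seq tree :=
  if B is Carry _ _ T then nodes T else [::].

Definition torder (T : tree) : nat := count (fun e => (edec e).1 == t2) (edges T).

Definition scF (T : tree) : int := \sum_(e <- edges T) P (edec e) (efreq e).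

Definition resonant (T : tree) : bool :=
  let: Tree p k B1 B2 B3 := T in
  P (t2, p) k + (P (t1, btype B1) (bfreq B1) + P (t1, btype B2) (bfreq B2)
                 + P (t1, btype B3) (bfreq B3)) == 0.

Definition three_leaves (T : tree) : bool :=
  let: Tree _ _ B1 B2 B3 := T in [&& is_leaf B1, is_leaf B2 & is_leaf B3].

Definition child (e f : edge) : bool := (addr f != [::]) && (behead (addr f) == addr e).

Definition nth_edge (T : tree) (i : 'I_(size (edges T))) : edge :=
  tnth (in_tuple (edges T)) i.

Definition automorphisms (T : tree) : {set 'S_(size (edges T))} :=
  finset (fun s : 'S_(size (edges T)) =>
    [forall i, edec (nth_edge (s i)) == edec (nth_edge i)] &&
    [forall i, forall j,
       child (nth_edge (s i)) (nth_edge (s j)) == child (nth_edge i) (nth_edge j)]).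

Definition Saut (T : tree) : nat := #|automorphisms T|.

(* Convention for sums: the frequencies are ignored when trees are identified,
   i.e. one sums over the non-planar shapes and, for each of them, over all
   assignments of frequencies to its nodes.  A shape is represented by its
   unique plane representative in which, at every ternary node, the shapes of
   the two branches B1, B2 of equal type are ordered by their codes (the codes
   do not see frequencies, and are injective on shapes). *)
Fixpoint code (T : tree) : nat :=
  let: Tree _ _ B1 B2 B3 := T in
  (choice.pickle (code_above B1, code_above B2, code_above B3)).+1
with code_above (B : branch) : nat :=
  if B is Carry _ _ T then code T else 0%N.

Definition plane_rep (T : tree) : bool :=
  all (fun T' : tree => let: Tree _ _ B1 B2 _ := T' in
         (code_above B1 <= code_above B2)%N) (nodes T).

Local Open Scope classical_set_scope.

Definition hatT (n : nat) (k : int) : set tree :=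
  [set T | [/\ is_tree false k T, plane_rep T, torder T = n
             & all (fun T' => ~~ resonant T') (nodes T)]].

Definition hatTres (n : nat) (k : int) : set tree :=
  [set T | [/\ is_tree false k T, plane_rep T, torder T = n,
               count resonant (nodes T) = 1%N
             & all (fun T' => resonant T' ==> three_leaves T') (nodes T)]].

(* A node is resonant iff l1 = l3 or l2 = l3.  The sums over [hatTres] run over
   both possibilities, as in 2 \sum_k1 |v_k1|^2 v_k; thus a resonant node with
   l1 = l2 = l3 occurs twice. *)
Definition pairings (T : tree) : nat :=
  let: Tree _ _ B1 B2 B3 := T in
  (bfreq B1 == bfreq B3) + (bfreq B2 == bfreq B3).

Definition res_mult (T : tree) : nat :=
  \prod_(T' <- nodes T | resonant T') pairings T'.

(* The equation for the conjugate of v_k carries +i where the one for v_k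
   carries -i: each ternary node of type 1 contributes a sign. *)
Definition conj_sign (T : tree) : int :=
  (-1) ^+ count (fun e => edec e == (t2, true)) (edges T).

Definition word : Type := seq tree. (* [:: T_m; ...; T_1] stands for T_m...T_1 *)

Fixpoint shuffle (u : word) : word -> seq word :=
  fix shuffle_u (w : word) : seq word :=
    match u, w with
    | [::], _ => [:: w]
    | _, [::] => [:: u]
    | a :: u', b :: w' => map (cons a) (shuffle u' w) ++ map (cons b) (shuffle_u w')
    end.

Definition letter (T : tree) : tree :=
  let: Tree p k B1 B2 B3 := T in
  Tree p k (Leaf (btype B1) (bfreq B1)) (Leaf (btype B2) (bfreq B2))
           (Leaf (btype B3) (bfreq B3)).

(* A combination of words is a list of words, with repetitions; the shuffle
   product is extended bilinearly. *)
Definition lshuffle (L M : seq word) : seq word :=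
  flatten [seq shuffle u w | u <- L, w <- M].

Fixpoint arb (T : tree) : seq word :=
  let: Tree _ _ B1 B2 B3 := T in
  [seq rcons w (letter T)
     | w <- lshuffle (arb_above B1) (lshuffle (arb_above B2) (arb_above B3))]
with arb_above (B : branch) : seq word :=
  if B is Carry _ _ T then arb T else [:: [::]].

Definition scFw (w : word) : int := \sum_(T <- w) scF T.

Definition suffix (q : nat) (w : word) : word := drop (size w - q) w. (* T_q...T_1 *)

(* The variable (l, p) is v_{l,p}.  A formal series assigns to each monomial a
   coefficient, which is a function of t.  The infinite sums below are finitely
   supported at each monomial. *)
Definition var : Type := int * bool.
Definition mono : Type := multiset var.

Section Series.
Variable R : realType.
Local Notation C := R[i].

Definition series : Type := mono -> R -> C.

Definition cexp (x : R) : C := (cos x +i* sin x)%C.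

Definition fexp (a : int) (t : R) : C := cexp (a%:~R * t).

Definition vmono (s : seq var) : series := fun m _ => (m == seq_mset s)%:R.

Definition scale (c : R -> C) (f : series) : series := fun m t => c t * f m t.

Definition ssum (I : choiceType) (A : set I) (f : I -> series) : series :=
  fun m t => \sum_(i \in A) f i m t.

Definition sadd (f g : series) : series := fun m t => f m t + g m t.

Definition smul (f g : series) : series := fun m t =>
  \sum_(q \in [set q : mono * mono | msetD q.1 q.2 = m]) f q.1 t * g q.2 t.

Definition sconj (f : series) : series := fun m t =>
  (f (seq_mset [seq (x.1, ~~ x.2) | x <- enum_mset m]) t)^*.

(* partial derivative with respect to the variable x *)
Definition pder (x : var) (f : series) : series := fun m t =>
  (m x).+1%:R * f (msetD (msetn 1 x) m) t.

Definition cderiv (c : R -> C) (t : R) : C :=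
  ((fun s => complex.Re (c s))^`() t +i* (fun s => complex.Im (c s))^`() t)%C.

Definition Phi (k k1 k2 k3 : int) : int := k ^+ 2 + k1 ^+ 2 - k2 ^+ 2 - k3 ^+ 2.

Definition nls (k : int) : series :=
  sadd
   (ssum [set q : int * int * int | let: (k1, k2, k3) := q in
             [/\ k = - k1 + k2 + k3, k1 <> k2 & k1 <> k3]]
      (fun q => let: (k1, k2, k3) := q in
         scale (fun t => - 'i * fexp (Phi k k1 k2 k3) t)
           (vmono [:: (k1, true); (k2, false); (k3, false)])))
   (ssum [set: int]
      (fun k1 => scale (fun=> - 2 * 'i)
         (vmono [:: (k1, true); (k1, false); (k, false)]))).

Definition dt_var (x : var) : series :=
  if x.2 then sconj (nls x.1) else nls x.1.

(* The time derivative along the equation, by the chain rule. *)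
Definition dt (f : series) : series := fun m t =>
  cderiv (f m) t + \sum_(x \in [set: var]) smul (pder x f) (dt_var x) m t.

Variable N : R.

Definition condA (w : word) : bool := `|(scFw w)%:~R| <= N.

Definition Psi (w : word) (t : R) : C :=
  if [forall q : 'I_(size w), ~~ condA (suffix q.+1 w)]
  then fexp (scFw w) t / \prod_(1 <= q < (size w).+1) (scFw (suffix q w))%:~R
  else 0.

Definition hatPsi_num (w : word) (t : R) : C :=
  if w is T :: w' then fexp (scF T) t * Psi w' t else 0.

Definition hatPsi (w : word) (t : R) : C := hatPsi_num w t / (scFw w)%:~R.

(* scF T * hatPsi w for a word w of arb T.  Here scF T = scFw w, so this factor
   cancels the denominator of hatPsi; the cancellation is also performed when
   both vanish. *)
Definition scF_hatPsi (T : tree) (w : word) (t : R) : C :=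
  if (scF T == 0) && (scFw w == 0) then hatPsi_num w t
  else (scF T)%:~R * hatPsi w t.

Definition res_first (w : word) : bool := if w is T :: _ then resonant T else false.

Definition Upsilon (T : tree) : series :=
  scale (fun=> 2 ^+ torder T) (vmono (leaves T)).

Definition tree_sum (A : set tree) (c : tree -> R -> C) : series :=
  ssum A (fun T =>
    scale (fun t => (conj_sign T)%:~R * c T t / (Saut T)%:R) (Upsilon T)).

Definition N0 (n : nat) (k : int) : series :=
  tree_sum (hatT n k) (fun T t => \sum_(w <- arb T) Psi w t).

(* Only the words whose first letter is the resonant one occur: the other words
   of [arb T] would require a resonant letter inside Psi. *)
Definition Rn (n : nat) (k : int) : series :=
  tree_sum (hatTres n k) (fun T t =>
    (res_mult T)%:R * \sum_(w <- arb T | res_first w) 'i * scF_hatPsi T w t).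

Definition Nn (n : nat) (k : int) : series :=
  tree_sum (hatT n k) (fun T t => \sum_(w <- arb T) 'i * scF_hatPsi T w t).

(* the terms of [Nn] on the words for which A holds *)
Definition N1 (n : nat) (k : int) : series :=
  tree_sum (hatT n k) (fun T t =>
    \sum_(w <- arb T | condA w) 'i * scF_hatPsi T w t).

Definition N2 (n : nat) (k : int) : series :=
  tree_sum (hatT n k) (fun T t =>
    'i * (scF T)%:~R * \sum_(w <- arb T) Psi w t).

End Series.

Definition letter_of (p : bool) (k l1 l2 l3 : int) : tree :=
  Tree p k (Leaf p l1) (Leaf p l2) (Leaf (~~ p) l3).

Lemma Saut_letter p k l1 l2 l3 : Saut (letter_of p k l1 l2 l3) = 2%N.
Proof.
rewrite /Saut /automorphisms.
set T := letter_of p k l1 l2 l3.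
have E : size (edges T) = 4%N by [].
set A := finset _.
pose o (i : nat) (h : (i < 4)%N) : 'I_(size (edges T)) := Ordinal h.
pose i0 := o 0%N isT; pose i1 := o 1%N isT; pose i2 := o 2%N isT; pose i3 := o 3%N isT.
have ordP : forall i : 'I_(size (edges T)), [\/ i = i0, i = i1, i = i2 | i = i3].
  case=> -[|[|[|[|m]]]] h //=.
  - by constructor 1; apply: val_inj.
  - by constructor 2; apply: val_inj.
  - by constructor 3; apply: val_inj.
  - by constructor 4; apply: val_inj.
have e0 : nth_edge i0 = ([::], (t2, p), k) by [].
have e1 : nth_edge i1 = ([:: 0%N], (t1, p), l1) by [].
have e2 : nth_edge i2 = ([:: 1%N], (t1, p), l2) by [].
have e3 : nth_edge i3 = ([:: 2%N], (t1, ~~ p), l3) by [].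
have t12 : (t1 == t2) = false by apply/eqP.
have t21 : (t2 == t1) = false by apply/eqP.
have pn : (p == ~~ p) = false by case: (p).
have np : (~~ p == p) = false by case: (p).
have dec : forall i j, (edec (nth_edge i) == edec (nth_edge j)) =
   (i == j) || ((i \in [:: i1; i2]) && (j \in [:: i1; i2])).
  move=> i j; case: (ordP i) => ->; case: (ordP j) => ->;
  by rewrite ?e0 ?e1 ?e2 ?e3 /edec /= !xpair_eqE ?t12 ?t21 ?pn ?np ?eqxx.
suff -> : A = [set 1%g; tperm i1 i2]%SET.
  rewrite cards2; case: eqP => // /(congr1 (fun s : 'S_(_) => s i1)).
  by rewrite perm1 tpermL.
apply/setP => s; rewrite !inE; apply/idP/idP.
  move=> /andP[/forallP H _].
  have s0 : s i0 = i0.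
    by move: (H i0); rewrite dec => /orP[/eqP//|/andP[_]]; rewrite !inE.
  have s3 : s i3 = i3.
    by move: (H i3); rewrite dec => /orP[/eqP//|/andP[_]]; rewrite !inE.
  have s1 : s i1 = i1 \/ s i1 = i2.
    move: (H i1); rewrite dec => /orP[/eqP|/andP[]]; first by left.
    by rewrite !inE => /orP[]/eqP ->; [left|right].
  have s2 : s i2 = i1 \/ s i2 = i2.
    move: (H i2); rewrite dec => /orP[/eqP|/andP[]]; first by right.
    by rewrite !inE => /orP[]/eqP ->; [left|right].
  have ne : s i1 <> s i2 by move=> /perm_inj.
  case: s1 s2 ne => s1 [] s2 ne; rewrite ?s1 ?s2 // in ne *.
    apply/orP; left; apply/eqP/permP => i; rewrite perm1.
    by case: (ordP i) => ->.
  apply/orP; right; apply/eqP/permP => i.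
  case: (ordP i) => ->; rewrite ?tpermL ?tpermR ?tpermD //.
have ch : forall i j, child (nth_edge i) (nth_edge j) = (i == i0) && (j != i0).
  move=> i j; case: (ordP i) => ->; case: (ordP j) => ->;
  by rewrite ?e0 ?e1 ?e2 ?e3 /child /addr.
move=> /orP[]/eqP ->.
  by apply/andP; split; apply/forallP => i; rewrite ?perm1 //;
   apply/forallP => j; rewrite !perm1.
apply/andP; split; apply/forallP => i.
  by case: (ordP i) => ->; rewrite ?tpermL ?tpermR ?tpermD // dec ?eqxx.
apply/forallP => j; rewrite !ch; case: (ordP i) => ->; case: (ordP j) => ->;
  by rewrite ?tpermL ?tpermR ?tpermD.
Qed.

HB.instance Definition _ := gen_eqMixin branch.
HB.instance Definition _ := gen_choiceMixin branch.

Definition mk_carry (q : branch * branch * branch) : branch :=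
  let: (B1, B2, B3) := q in
  let p := btype B1 in
  let k := (-1) ^+ p * ((-1) ^+ p * bfreq B1 + (-1) ^+ p * bfreq B2
                      + (-1) ^+ (~~ p) * bfreq B3) in
  Carry p k (Tree p k B1 B2 B3).

Lemma is_branchE p l B : is_branch p l B -> btype B = p /\ bfreq B = l.
Proof. by case=> //= *. Qed.

Lemma leaves_gt0 B : (0 < size (leaves_above B))%N.
Proof.
have [n] := ubnP (size (edges_above [::] B)).
elim: n B => // n IH [p l|p l [q k B1 B2 B3]] //= h.
rewrite !size_cat.
suff : (0 < size (leaves_above B1))%N by lia.
apply: IH.
have se : forall B a b, size (edges_above a B) = size (edges_above b B).
  clear; fix se 1; case=> [p l|p l [q k B1 B2 B3]] a b //=.
  by rewrite !size_cat (se B1 _ (0%N :: 0%N :: b)) (se B2 _ (1%N :: 0%N :: b)) (se B3 _ (2%N :: 0%N :: b)).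
rewrite (se B1 _ [:: 0%N; 0%N]).
move: h; rewrite !size_cat; lia.
Qed.

Lemma leq_add3 (a b c d : nat) : (0 < a -> 0 < b -> 0 < c -> a + (b + c) <= d.+1 ->
  a <= d /\ b <= d /\ c <= d)%N.
Proof. lia. Qed.

Lemma finite_branches (s : seq var) (b : nat) :
  finite_set [set B | exists p l, [/\ is_branch p l B,
     {subset leaves_above B <= s} & (size (leaves_above B) <= b)%N]].
Proof.
elim: b => [|b IH].
  rewrite (_ : mkset _ = set0); first exact: finite_set0.
  by apply/seteqP; split => // B [p [l [_ _]]]; have := leaves_gt0 B; lia.
set F := mkset _ in IH.
apply: (@sub_finite_set _ _ ([set Leaf x.2 x.1 | x in [set` s]] `|` mk_carry @` (F `*` F `*` F))).
  move=> B [p [l [wB sB zB]]]; case: wB sB zB => [{}p {}l|{}p {}l T wT] sB zB.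
    by left; exists (l, p) => //; apply: sB; rewrite /= mem_head.
  right; case: wT sB zB => {}p k l1 l2 l3 B1 B2 B3 w1 w2 w3 e /= sB zB.
  exists (B1, B2, B3); last first.
    rewrite /mk_carry; have [-> ->] := is_branchE w1; have [_ ->] := is_branchE w2.
    have [_ ->] := is_branchE w3.
    by rewrite -e mulrA -expr2 sqrr_sign mul1r.
  have g1 := leaves_gt0 B1; have g2 := leaves_gt0 B2; have g3 := leaves_gt0 B3.
  move: zB; rewrite !size_cat => zB.
  have [h1 [h2 h3]] := leq_add3 g1 g2 g3 zB.
  split; first split => /=.
  - by exists p, l1; split => // x hx; apply: sB; rewrite !mem_cat hx.
  - by exists p, l2; split => // x hx; apply: sB; rewrite !mem_cat hx orbT.
  - by exists (~~ p), l3; split => // x hx; apply: sB; rewrite !mem_cat hx !orbT.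
rewrite finite_setU; split; first by apply: finite_image; exact: finite_seq.
by apply: finite_image; apply: finite_setX => //; apply: finite_setX.
Qed.

(* Each monomial receives finitely many terms in the sums over trees. *)
Lemma finite_trees p k (m : mono) :
  finite_set [set T | is_tree p k T /\ seq_mset (leaves T) = m].
Proof.
have /(finite_image (fun B => if B is Carry _ _ T then T else
   Tree p k (Leaf p k) (Leaf p k) (Leaf p k)))
  := finite_branches (enum_mset m) (size (enum_mset m)).
apply: sub_finite_set => T [wT eT].
exists (Carry p k T) => //; exists p, k; split => /=; first by constructor.
  by move=> x; rewrite -eT (perm_mem (perm_eq_seq_mset _)).
by rewrite -eT (perm_size (perm_eq_seq_mset _)).
Qed.

Definition cherry (k : int) (q : int * int * int) : tree :=
  let: (k1, k2, k3) := q in letter_of false k k2 k3 k1.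

Lemma cherry_inj k : injective (cherry k).
Proof. by move=> [[a b] c] [[a' b'] c'] [-> -> ->]. Qed.

Lemma order_gt0 a T : (0 < count (fun e => (edec e).1 == t2) (edges_from a T))%N.
Proof. by case: T => p k B1 B2 B3 /=; rewrite eqxx. Qed.

Lemma order1 k T : is_tree false k T -> torder T = 1%N ->
  exists q : int * int * int, T = cherry k q /\ (let: (k1, k2, k3) := q in k = - k1 + k2 + k3).
Proof.
have t12 : (t1 == t2) = false by apply/eqP.
move=> wT; inversion wT as [p k' l1 l2 l3 B1 B2 B3 w1 w2 w3 e e1 e2]; subst.
rewrite /torder /= eqxx !count_cat.
inversion w1; inversion w2; inversion w3; subst; rewrite /= t12 /= => o;
  try (have := order_gt0 [:: 0; 0]%N T; lia);
  try (have := order_gt0 [:: 0; 1]%N T; lia);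
  try (have := order_gt0 [:: 0; 2]%N T; lia).
exists (l3, l1, l2); split => //.
move: e; rewrite /= !expr0 expr1 !mul1r mulN1r => ->; lia.
Qed.

Lemma is_tree_cherry k k1 k2 k3 : k = - k1 + k2 + k3 -> is_tree false k (cherry k (k1, k2, k3)).
Proof.
move=> e; apply: (@IsTree false k k2 k3 k1); try by constructor.
rewrite /= !expr0 expr1; lia.
Qed.

Lemma torder_cherry k q : torder (cherry k q) = 1%N.
Proof.
have t12 : (t1 == t2) = false by apply/eqP.
by case: q => [[a b] c]; rewrite /torder /= t12 eqxx.
Qed.

Lemma scF_cherry k k1 k2 k3 : scF (cherry k (k1, k2, k3)) = Phi k k1 k2 k3.
Proof.
rewrite /scF /edges /= !big_cons big_nil /P /= /Phi !expr0 expr1; lia.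
Qed.

Lemma resonant_cherry k k1 k2 k3 : k = - k1 + k2 + k3 ->
  resonant (cherry k (k1, k2, k3)) = (k1 == k2) || (k1 == k3).
Proof.
move=> e; rewrite /= /P /=.
transitivity ((k1 - k2) * (k1 - k3) == 0).
  by rewrite e !expr0 expr1; apply/eqP/eqP; nia.
by rewrite mulf_eq0 !subr_eq0.
Qed.

Lemma plane_rep_cherry k q : plane_rep (cherry k q).
Proof. by case: q => [[a b] c]. Qed.

Lemma hatT_bij k : set_bij
  [set q : int * int * int | let: (k1, k2, k3) := q in [/\ k = - k1 + k2 + k3, k1 <> k2 & k1 <> k3]]
  (hatT 1 k) (cherry k).
Proof.
split.
- move=> [[k1 k2] k3] [e n1 n2]; split; rewrite ?torder_cherry ?plane_rep_cherry //; first exact: is_tree_cherry.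
  rewrite [nodes _]/= /all resonant_cherry //.
  by apply/andP; split => //; apply/negP => /orP[]/eqP.
- by move=> x y _ _; apply: cherry_inj.
- move=> T [wT _ oT aT]; have [[[k1 k2] k3] [eT e]] := order1 wT oT.
  exists (k1, k2, k3) => //; move: aT; rewrite eT [nodes _]/= /all resonant_cherry // andbT => /norP[/eqP ? /eqP ?].
  by split.
Qed.

Lemma hatTres_bij k : set_bij
  [set q : int * int * int | let: (k1, k2, k3) := q in k = - k1 + k2 + k3 /\ (k1 == k2) || (k1 == k3)]
  (hatTres 1 k) (cherry k).
Proof.
split.
- move=> [[k1 k2] k3] [e r]; split; rewrite ?torder_cherry ?plane_rep_cherry //; first exact: is_tree_cherry.
  + by rewrite [nodes _]/= /count resonant_cherry // r.
  + by rewrite [nodes _]/= /all /= implybT.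
- by move=> x y _ _; apply: cherry_inj.
- move=> T [wT _ oT cT _]; have [[[k1 k2] k3] [eT e]] := order1 wT oT.
  exists (k1, k2, k3) => //; move: cT; rewrite eT [nodes _]/= /count resonant_cherry //.
  by case E : (_ || _) => // _; split.
Qed.

Lemma conj_sign_cherry k q : conj_sign (cherry k q) = 1.
Proof.
have t12 : (t1 == t2) = false by apply/eqP.
by case: q => [[a b] c]; rewrite /conj_sign /= /edec /= !xpair_eqE t12 /= !andbF.
Qed.

Lemma cherry_term (R : realType) k (q : int * int * int) (c : R[i]) (m : mono) :
  let: (k1, k2, k3) := q in
  1%:~R * c / (Saut (cherry k q))%:R * (2 ^+ torder (cherry k q) * (m == seq_mset (leaves (cherry k q)))%:R)
  = c * (m == seq_mset [:: (k1, true); (k2, false); (k3, false)])%:R :> R[i].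
Proof.
case: q => [[k1 k2] k3]; rewrite torder_cherry Saut_letter /=.
set b1 := (m == _); set b2 := (m == _); have -> : b1 = b2.
  rewrite /b1 /b2; congr (_ == _); apply/eq_seq_msetP.
  by rewrite -[_ :: _]/([:: _; _] ++ [:: _]) perm_catC.
by field.
Qed.

(* The equation in terms of trees, which fixes the convention for the sums. *)
Lemma nls_tree_form (R : realType) (k : int) :
  nls (R:=R) k = sadd (tree_sum (hatT 1 k) (fun T t => - 'i * fexp (scF T) t))
               (tree_sum (hatTres 1 k) (fun T _ => - 'i * (res_mult T)%:R)).
Proof.
apply/funext => m; apply/funext => t; rewrite /nls /sadd /tree_sum /ssum; congr (_ + _).
  rewrite (reindex_fsbig (cherry k) _ _ _ (hatT_bij k)); apply: eq_fsbigr => -[[k1 k2] k3] _.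
  by rewrite /Upsilon /scale /vmono conj_sign_cherry (cherry_term _ (k1, k2, k3)) scF_cherry.
rewrite (reindex_fsbig (cherry k) _ _ _ (hatTres_bij k)).
pose M := [set q : int * int * int | let: (k1, k2, k3) := q in
   m == seq_mset [:: (k1, true); (k2, false); (k3, false)]].
have [G GE] : exists G : int * int * int -> R[i], forall k1 k2 k3, G (k1, k2, k3) =
   - 'i * (m == seq_mset [:: (k1, true); (k2, false); (k3, false)])%:R.
  by exists (fun q : int * int * int => let: (k1, k2, k3) := q in
   - 'i * (m == seq_mset [:: (k1, true); (k2, false); (k3, false)])%:R).
set Q := mkset _.
transitivity (\sum_(q \in Q) (let: (k1, k2, k3) := q in
    (k1 == k2)%:R * G q + (k1 == k3)%:R * G q)); last first.
  apply: eq_fsbigr => -[[k1 k2] k3] /set_mem[e r].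
  rewrite /Upsilon /scale /vmono conj_sign_cherry (cherry_term _ (k1, k2, k3)) /res_mult.
  rewrite [nodes _]/= big_cons big_nil resonant_cherry // r muln1 /pairings /= !(eq_sym _ k1) natrD GE.
  by ring.
have G0 q : ~ M q -> G q = 0.
  by case: q => [[k1 k2] k3]; rewrite /M GE /=; case: (m == _) => // _; rewrite mulr0.
have finM : finite_set M.
  apply: (@sub_finite_set _ _ ([set` map fst (enum_mset m)] `*` [set` map fst (enum_mset m)] `*` [set` map fst (enum_mset m)])).
    have K (x : var) (l : seq var) : x \in l -> x.1 \in map fst (enum_mset (seq_mset l)).
      by move=> xl; apply: map_f; rewrite (perm_mem (perm_eq_seq_mset _)).
    move=> [[k1 k2] k3] /eqP ->; split; first split => /=.
    - by apply: (K (k1, true)); rewrite mem_head.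
    - by apply: (K (k2, false)); rewrite !inE eqxx !orbT.
    - by apply: (K (k3, false)); rewrite !inE eqxx !orbT.
  by apply: finite_setX; [apply: finite_setX|]; apply: finite_seq.
rewrite (eq_fsbigr (fun q => (q.1.1 == q.1.2)%:R * G q + (q.1.1 == q.2)%:R * G q)); last by move=> [[]].
rewrite -(@fsbig_widen _ _ _ _ (Q `&` M) Q); first last.
- move=> q [qQ nQ] /=; rewrite G0 ?mulr0 ?addr0 // => qM; exact: nQ.
- by move=> q [].
rewrite fsbig_split; last exact: sub_finite_set finM.
have side (f : int -> int * int * int) (sel : int * int * int -> bool) :
   (forall k1, Q (f k1)) -> (forall k1, sel (f k1)) -> injective f ->
   (forall q, Q q -> sel q -> exists k1, f k1 = q) ->
   \sum_(q \in Q `&` M) (sel q)%:R * G q = \sum_(k1 \in [set: int]) G (f k1).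
  move=> fQ fs fi surj.
  rewrite (@fsbig_widen _ _ _ _ (Q `&` M) Q); first last.
  - move=> q [qQ nQ] /=; rewrite G0 ?mulr0 // => qM; exact: nQ.
  - by move=> q [].
  rewrite -(@fsbig_widen _ _ _ _ (Q `&` [set q | sel q]) Q); first last.
  - by move=> q [qQ nQ] /=; case E : (sel q) nQ => nQ; [case: nQ; split | rewrite mul0r].
  - by move=> q [].
  rewrite (@reindex_fsbig _ _ _ _ _ f [set: int]).
    by apply: eq_fsbigr => k1 _; rewrite fs mul1r.
  split; [by move=> k1 _; split; [apply: fQ|apply: fs]|by move=> ? ? _ _; apply: fi|].
  by move=> q [qQ qs]; have [k1 e] := surj q qQ qs; exists k1.
rewrite (side (fun k1 => (k1, k1, k)) (fun q => q.1.1 == q.1.2)); first last.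
- move=> [[k1 k2] k3] [e _] /= /eqP e2; exists k1; rewrite -e2 in e *; congr (_, _, _); lia.
- by move=> ? ? [].
- by move=> k1 /=; rewrite eqxx.
- by move=> k1; rewrite /Q /= eqxx; split => //; lia.
rewrite (side (fun k1 => (k1, k, k1)) (fun q => q.1.1 == q.2)); first last.
- move=> [[k1 k2] k3] [e _] /= /eqP e2; exists k1; rewrite -e2 in e *; congr (_, _, _); lia.
- by move=> ? ? [].
- by move=> k1 /=; rewrite eqxx.
- by move=> k1; rewrite /Q /= eqxx orbT; split => //; lia.
have sw k1 : G (k1, k, k1) = G (k1, k1, k).
  have e : seq_mset [:: (k1, true); (k, false); (k1, false)] =
           seq_mset [:: (k1, true); (k1, false); (k, false)].
    apply/eq_seq_msetP; rewrite perm_cons.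
    by rewrite -[X in perm_eq X]/([:: (k, false)] ++ [:: (k1, false)]) perm_catC.
  by rewrite !GE e.
transitivity (\sum_(k1 \in [set: int]) G (k1, k1, k) + \sum_(k1 \in [set: int]) G (k1, k1, k));
  last by congr (_ + _); apply: eq_fsbigr => k1 _; rewrite sw.
have fin : finite_set ([set: int] `&` (fun k1 => G (k1, k1, k)) @^-1` [set~ 0]).
  have : finite_set ((fun q : int * int * int => q.1.1) @` M) by exact: finite_image.
  apply: sub_finite_set => k1 [_ /= n]; exists (k1, k1, k) => //.
  by apply: contrapT => /G0.
rewrite -mulr2n.
transitivity (\sum_(k1 \in [set: int]) (2%:R * G (k1, k1, k))).
  by apply: eq_fsbigr => k1 _; rewrite GE /scale /vmono; ring.
by rewrite -mulr_fsumr mulr_natl.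
Qed.

Lemma dt_vmono1 (R : realType) (x : var) : dt (vmono (R:=R) [:: x]) = dt_var x.
Proof.
apply/funext => m; apply/funext => t; rewrite /dt.
have -> : cderiv (vmono (R:=R) [:: x] m) t = 0.
  have E (c : R) : (fun _ : R => c)^`() t = 0 by exact: derive1_cst.
  rewrite /cderiv /vmono. by rewrite !E.
rewrite add0r.
have pd y m' t' : pder y (vmono (R:=R) [:: x]) m' t' = ((y == x) && (m' == mset0))%:R.
  rewrite /pder /vmono.
  have e : (msetD (msetn 1 y) m' == seq_mset [:: x]) = ((y == x) && (m' == mset0)).
    apply/eqP/andP.
      move=> /msetP H; have yx : y == x.
        have := H y; rewrite msetE2 msetnxx mset_seqE /=; case: (x =P y) => [->|]; rewrite ?eqxx //=; lia.
      split=> //; apply/eqP/msetP => z; have := H z.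
      rewrite (eqP yx) msetE2 msetnE mset_seqE mset0E /= (eq_sym x z); case: (z == x) => /= HH; [by case: HH | by rewrite add0n in HH].
    case=> /eqP -> /eqP ->; apply/msetP => z.
    by rewrite msetE2 msetnE mset_seqE mset0E /= (eq_sym x z); case: (z == x).
  rewrite e; case: andP => [[_ /eqP ->]|_]; first by rewrite mset0E mul1r.
  by rewrite mulr0.
rewrite -(@fsbig_widen _ _ _ _ [set x] [set: var]) //; last first.
  move=> y [_ /= n]; rewrite /smul fsbig1 // => -[a b] _ /=.
  by rewrite pd; case: eqP => [/n//|_]; rewrite mul0r.
rewrite fsbig_set1 /smul.
rewrite -(@fsbig_widen _ _ _ _ [set (mset0, m)] ([set q : mono * mono | msetD q.1 q.2 = m])).
- by rewrite fsbig_set1 pd !eqxx mul1r.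
- by move=> _ -> /=; rewrite mset0D.
- move=> [a b] [/= e n]; rewrite pd eqxx /=; case: eqP => [a0|_]; last by rewrite mul0r.
  by case: n; rewrite -e a0 mset0D.
Qed.

Lemma scF_hatPsiE (R : realType) (N : R) T w t : scFw w != 0 ->
  scF_hatPsi N T w t = (scF T)%:~R * hatPsi N w t.
Proof. by move=> /negbTE w0; rewrite /scF_hatPsi w0 andbF. Qed.

(* Main.v *)
(* Since [Saut T] is the number of ways of exchanging the branches [B1], [B2] at the
   nodes of [T] without changing its shape, a sum over non-planar trees weighted by
   [2^n / S(T)] is a sum over all plane trees with weight one.  On plane trees, the
   chain rule applied to the monomial of [T] grafts a tree [C] of order one on a leaf
   of [T], and every plane tree of order [n + 1] with a marked node carrying three
   leaves arises exactly once in this way.  On the side of words, the words of the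
   arborification of the grafted tree which start with the letter [C] are the words
   [C w] with [w] in the arborification of [T].  Hence the grafted terms, with the
   factor [-i] of the equation, cancel the trees of [Nn n.+1] ([C] non-resonant) and
   those of [Rn n.+1] ([C] resonant), while the explicit time derivative of
   [Psi w] is [i scFw w Psi w], where [scFw w] is [scF T]. *)
Require Import Defs.
From mathcomp Require Import all_boot all_order all_algebra all_fingroup.
From mathcomp Require Import finmap multiset.
From mathcomp Require Import all_classical all_reals all_analysis complex zify ring.

Set Implicit Arguments.
Unset Strict Implicit.
Unset Printing Implicit Defensive.

Import Order.TTheory GRing.Theory Num.Theory.
Import numFieldNormedType.Exports.
Local Open Scope ring_scope.

(* Pruning does not preserve [plane_rep], and a tree with repeated shapes can be reached by several
   graftings; this is why the weights are removed before the chain rule is applied. Multiplicities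
   are carried by lists with repetitions: [orb] lists the [2^n] exchanged versions of a tree,
   [grafts] has one entry per matching leaf and [prunes] one per removable node. Two such lists
   describing the same weighted relation can be interchanged in a double sum, and this replaces
   orbit and stabilizer arguments. The weight itself requires [Saut], defined by permutations of
   edges, to equal a recursive [sym_factor]; for that purpose the isomorphisms between two trees are
   enumerated by recursion. The letters of a word are plane trees, so an exchange of branches
   changes [arb]; the coefficients are therefore compared after a normalization of the letters. *)
Scheme tree_mut := Induction for tree Sort Prop
with branch_mut := Induction for branch Sort Prop.
Combined Scheme tree_branch_ind from tree_mut, branch_mut.

Lemma is_treeE p k q j B1 B2 B3 : is_tree p k (Tree q j B1 B2 B3) <->
  [/\ q = p, j = k, [/\ is_branch p (bfreq B1) B1, is_branch p (bfreq B2) B2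
    & is_branch (~~ p) (bfreq B3) B3] &
    (-1) ^+ p * k = (-1) ^+ p * bfreq B1 + (-1) ^+ p * bfreq B2 + (-1) ^+ (~~ p) * bfreq B3].
Proof.
split=> [wT|[-> -> [w1 w2 w3] e]]; last exact: IsTree w1 w2 w3 e.
inversion wT as [p' k' l1 l2 l3 B1' B2' B3' w1 w2 w3 e e1 e2 [e3 e4 e5 e6 e7]]; subst.
by have [_ ->] := is_branchE w1; have [_ ->] := is_branchE w2; have [_ ->] := is_branchE w3.
Qed.

Lemma is_branch_CarryE p l q j T :
  is_branch p l (Carry q j T) <-> [/\ q = p, j = l & is_tree p l T].
Proof. by split=> [w|[-> -> w]]; [inversion w | constructor]. Qed.

Lemma is_branch_LeafE p l q j : is_branch p l (Leaf q j) <-> q = p /\ j = l.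
Proof. by split=> [w|[-> ->]]; [inversion w | constructor]. Qed.

(** * Double counting for relations with multiplicities *)

Section DoubleCounting.
Variables (V : nmodType) (I J : eqType).

Lemma sum_count_mem (s B : seq I) (F : I -> V) : uniq B -> {subset s <= B} ->
  \sum_(x <- s) F x = \sum_(x <- B) F x *+ count_mem x s.
Proof.
move=> uB; elim: s => [|y s IH] sB; first by rewrite big_nil big1.
rewrite big_cons IH; last by move=> x xs; apply: sB; rewrite inE xs orbT.
under [RHS]eq_bigr => x _ do rewrite /= mulrnDr.
rewrite big_split /=; congr (_ + _).
rewrite (bigD1_seq y) ?sB ?mem_head //= eqxx big1 ?addr0 // => x.
by rewrite eq_sym => /negbTE ->.
Qed.

End DoubleCounting.

(** Both sides are the sum of [F a b] over all pairs, weighted by the common multiplicity of [b] in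
    [r a] and of [a] in [r' b]. It serves for exchanges of branches, where [r] and [r'] are both
    [orb], and for grafting against pruning. *)
Lemma double_count (V : nmodType) (I J : eqType) (A : seq I) (B : seq J)
    (r : I -> seq J) (r' : J -> seq I) (F : I -> J -> V) :
  uniq A -> uniq B ->
  {in A, forall a, {subset r a <= B}} -> {in B, forall b, {subset r' b <= A}} ->
  {in A & B, forall a b, count_mem b (r a) = count_mem a (r' b)} ->
  \sum_(a <- A) \sum_(b <- r a) F a b = \sum_(b <- B) \sum_(a <- r' b) F a b.
Proof.
move=> uA uB rB rA rr.
transitivity (\sum_(a <- A) \sum_(b <- B) F a b *+ count_mem b (r a)).
  by rewrite big_seq [RHS]big_seq; apply: eq_bigr => a aA; apply: sum_count_mem (rB _ aA).
rewrite exchange_big /= big_seq [RHS]big_seq; apply: eq_bigr => b bB.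
rewrite (sum_count_mem _ uA (rA _ bB)) big_seq [RHS]big_seq.
by apply: eq_bigr => a aA; rewrite rr.
Qed.

(** * Shuffles, and the first letters of the words of an arborification *)

Section Shuffle.
Variable V : nmodType.
Implicit Types (f : word -> V) (u v w : word).

(** The value [0] on the empty word makes the recursion on first letters uniform: an empty factor of
    a shuffle supplies no first letter. *)
Definition onhead u (h : tree -> word -> V) : V := if u is a :: u' then h a u' else 0.

Lemma shuffle_nilr u : shuffle u [::] = [:: u].
Proof. by case: u. Qed.

Lemma shuffle_nill u : shuffle [::] u = [:: u].
Proof. by case: u. Qed.

Lemma sum_shuffle f u v : \sum_(w <- shuffle u v) f w =
  (if nilp u && nilp v then f [::] else 0)
  + onhead u (fun a u' => \sum_(w <- shuffle u' v) f (a :: w))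
  + onhead v (fun b v' => \sum_(w <- shuffle u v') f (b :: w)).
Proof.
case: u v => [|a u] [|b v]; rewrite ?shuffle_nilr ?shuffle_nill /= ?big_seq1 ?addr0 ?add0r //.
- by case: v => [|c v] /=; rewrite big_seq1.
- by rewrite shuffle_nilr big_seq1.
- by rewrite big_cat /= !big_map.
Qed.

Definition shuffle3 f u1 u2 u3 : V :=
  \sum_(x <- shuffle u2 u3) \sum_(w <- shuffle u1 x) f w.

(** The first letter of a shuffle comes from exactly one of the three words, and the empty word
    arises only from three empty words. Unlike the nested definition, this form treats the three
    words alike. *)
Lemma shuffle3E f u1 u2 u3 : shuffle3 f u1 u2 u3 =
  (if [&& nilp u1, nilp u2 & nilp u3] then f [::] else 0)
  + onhead u1 (fun a u => shuffle3 (f \o cons a) u u2 u3)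
  + onhead u2 (fun a u => shuffle3 (f \o cons a) u1 u u3)
  + onhead u3 (fun a u => shuffle3 (f \o cons a) u1 u2 u).
Proof.
rewrite /shuffle3.
under eq_bigr => x _ do rewrite sum_shuffle.
rewrite !big_split /= -!addrA; congr (_ + _).
  have oh0 u (h : tree -> word -> V) : (forall a w, h a w = 0) -> onhead u h = 0.
    by case: u => //= a u.
  rewrite sum_shuffle !oh0 ?addr0; try by move=> ? ?; rewrite big1 // => ? _; rewrite andbF.
  by rewrite /= andbT; case: (nilp u1); rewrite ?if_same.
congr (_ + _); first by case: u1 => [|a u] //=; rewrite big1_eq.
by rewrite sum_shuffle /= if_same add0r.
Qed.

(** Up to the order of the summands, the recursion on first letters is invariant under the exchange
    of [u1] and [u2], so an induction on the total length applies. *)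
Lemma shuffle3C f u1 u2 u3 : shuffle3 f u1 u2 u3 = shuffle3 f u2 u1 u3.
Proof.
have [n] := ubnP (size u1 + size u2 + size u3)%N.
elim: n f u1 u2 u3 => // n IH f u1 u2 u3 h.
rewrite !shuffle3E andbCA -!addrA; congr (_ + _); rewrite addrCA; congr (_ + (_ + _)).
- by case: u2 h => //= a u h; apply: IH; lia.
- by case: u1 h => //= a u h; apply: IH; lia.
- by case: u3 h => //= a u h; apply: IH; lia.
Qed.

Lemma eq_shuffle3 f g u1 u2 u3 : f =1 g -> shuffle3 f u1 u2 u3 = shuffle3 g u1 u2 u3.
Proof. by move=> fg; apply: eq_bigr => x _; apply: eq_bigr => w _. Qed.

Lemma sum_arb f p k B1 B2 B3 : \sum_(w <- arb (Tree p k B1 B2 B3)) f w =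
  \sum_(u1 <- arb_above B1) \sum_(u2 <- arb_above B2) \sum_(u3 <- arb_above B3)
    shuffle3 (fun w => f (rcons w (letter (Tree p k B1 B2 B3)))) u1 u2 u3.
Proof.
rewrite big_map -/arb_above /lshuffle big_flatten big_allpairs_dep.
apply: eq_bigr => u1 _; rewrite big_flatten big_allpairs_dep.
by apply: eq_bigr => u2 _; apply: eq_bigr => u3 _.
Qed.

End Shuffle.

(** This is the variable that a leaf must carry for the tree to be grafted there. *)
Definition rootv (T : tree) : var := let: Tree p k _ _ _ := T in (k, p).

(* The pairs (T0, C) such that T is T0 with the order-one tree C grafted on a leaf. *)
Fixpoint prunes (T : tree) : seq (tree * tree) :=
  let: Tree p k B1 B2 B3 := T in
  [seq (Tree p k x.1 B2 B3, x.2) | x <- prunes_above B1]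
  ++ [seq (Tree p k B1 x.1 B3, x.2) | x <- prunes_above B2]
  ++ [seq (Tree p k B1 B2 x.1, x.2) | x <- prunes_above B3]
with prunes_above (B : branch) : seq (branch * tree) :=
  if B is Carry p l T then
    (if three_leaves T then [:: (Leaf p l, T)] else [::])
    ++ [seq (Carry p l x.1, x.2) | x <- prunes T]
  else [::].

(** There is one entry for each leaf carrying the variable [rootv C], so the length records the
    exponent of that variable in the monomial of [T]. *)
Fixpoint grafts (C T : tree) : seq tree :=
  let: Tree p k B1 B2 B3 := T in
  [seq Tree p k B B2 B3 | B <- grafts_above C B1]
  ++ [seq Tree p k B1 B B3 | B <- grafts_above C B2]
  ++ [seq Tree p k B1 B2 B | B <- grafts_above C B3]
with grafts_above (C : tree) (B : branch) : seq branch :=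
  match B with
  | Leaf p l => if rootv C == (l, p) then [:: Carry p l C] else [::]
  | Carry p l T => [seq Carry p l T' | T' <- grafts C T]
  end.

Lemma letter_three_leaves T : three_leaves T -> letter T = T.
Proof. by case: T => p k [? ?|//] [? ?|//] [? ?|//]. Qed.

Lemma prunes_above_data B B0 C : (B0, C) \in prunes_above B ->
  btype B0 = btype B /\ bfreq B0 = bfreq B.
Proof.
case: B => //= p l T; rewrite mem_cat => /orP[|/mapP[[T0 C0] _ [-> _]] //].
by case: ifP => // _; rewrite inE => /eqP[-> _].
Qed.

(** A word of [arb T] can only start with a node that has no other node above it, that is, one
    carrying three leaves; removing this letter amounts to pruning the node. If [T] itself has three
    leaves, nothing can be pruned and the only word has one letter. The arbitrary [f] expresses an
    equality of lists of words up to order. *)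
Lemma sum_arb_prunes_mut (V : nmodType) :
  (forall T (f : word -> V), \sum_(w <- arb T) f w =
    (if three_leaves T then f [:: letter T] else 0)
    + \sum_(x <- prunes T) \sum_(w <- arb x.1) f (x.2 :: w)) /\
  (forall B (f : word -> V), \sum_(w <- arb_above B) f w =
    (if is_leaf B then f [::] else 0)
    + \sum_(x <- prunes_above B) \sum_(w <- arb_above x.1) f (x.2 :: w)).
Proof.
apply: tree_branch_ind.
- move=> p k B1 IH1 B2 IH2 B3 IH3 f.
  rewrite sum_arb; set L := letter _.
  under eq_bigr => u1 _ do under eq_bigr => u2 _ do under eq_bigr => u3 _ do rewrite shuffle3E.
  (* The induction hypothesis is applied to a function supported on the empty word: only a leaf
     branch contributes it. *)
  have H0 B (IH : forall f : word -> V, \sum_(w <- arb_above B) f w =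
      (if is_leaf B then f [::] else 0)
      + \sum_(x <- prunes_above B) \sum_(w <- arb_above x.1) f (x.2 :: w)) (v : V) :
      \sum_(u <- arb_above B) (if nilp u then v else 0) = if is_leaf B then v else 0.
    rewrite IH /= [X in _ + X]big1 ?addr0 // => x _; exact: big1.
  have HE B (IH : forall f : word -> V, \sum_(w <- arb_above B) f w =
      (if is_leaf B then f [::] else 0)
      + \sum_(x <- prunes_above B) \sum_(w <- arb_above x.1) f (x.2 :: w)) (h : tree -> word -> V) :
      \sum_(u <- arb_above B) onhead u h =
      \sum_(x <- prunes_above B) \sum_(w <- arb_above x.1) h x.2 w.
    by rewrite (IH (fun u => onhead u h)) /= if_same add0r.
  under eq_bigr => u1 _ do under eq_bigr => u2 _ do rewrite !big_split /=.
  under eq_bigr => u1 _ do rewrite !big_split /=.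
  rewrite !big_split /= -!addrA; congr (_ + _).
    under eq_bigr => u1 _.
      under eq_bigr => u2 _.
        rewrite (eq_bigr (fun u3 => if nilp u3 then (if nilp u1 && nilp u2 then f [:: L] else 0) else 0)); last first.
          by move=> u3 _; case: (nilp u1) (nilp u2) (nilp u3) => [] [] [].
        rewrite (H0 _ IH3).
        rewrite (_ : (if _ then _ else _) = if nilp u2 then (if nilp u1 && is_leaf B3 then f [:: L] else 0) else 0); last first.
          by case: (nilp u1) (nilp u2) (is_leaf B3) => [] [] [].
        over.
      rewrite (H0 _ IH2).
      rewrite (_ : (if _ then _ else _) = if nilp u1 then (if is_leaf B2 && is_leaf B3 then f [:: L] else 0) else 0); last first.
        by case: (nilp u1) (is_leaf B2) (is_leaf B3) => [] [] [].
      over.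
    rewrite (H0 _ IH1); by case: (is_leaf B1) (is_leaf B2) (is_leaf B3) => [] [] [].
  rewrite !big_cat /= !big_map /=; congr (_ + (_ + _)).
  + rewrite (eq_bigr (fun u1 => onhead u1 (fun a u => \sum_(u2 <- arb_above B2) \sum_(u3 <- arb_above B3)
       shuffle3 ((fun w => f (rcons w L)) \o cons a) u u2 u3))); last first.
      case=> [|a u] _ //=; by rewrite big1 // => ? _; rewrite big1.
    (* Pruning inside a branch keeps its type and frequency, so [L] is also the last letter for the
       pruned tree. *)
    rewrite (HE _ IH1); rewrite big_seq [RHS]big_seq; apply: eq_bigr => -[B0 C] /prunes_above_data[e1 e2].
    by rewrite sum_arb /L /= e1 e2.
  + rewrite exchange_big /=.
    rewrite (eq_bigr (fun u2 => onhead u2 (fun a u => \sum_(u1 <- arb_above B1) \sum_(u3 <- arb_above B3)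
       shuffle3 ((fun w => f (rcons w L)) \o cons a) u1 u u3))); last first.
      case=> [|a u] _ //=; by rewrite big1 // => ? _; rewrite big1.
    rewrite (HE _ IH2); rewrite big_seq [RHS]big_seq; apply: eq_bigr => -[B0 C] /prunes_above_data[e1 e2].
    by rewrite sum_arb /L /= e1 e2 exchange_big.
  + rewrite (eq_bigr (fun u1 => \sum_(u3 <- arb_above B3) onhead u3 (fun a u => \sum_(u2 <- arb_above B2)
       shuffle3 ((fun w => f (rcons w L)) \o cons a) u1 u2 u))); last first.
      move=> u1 _; rewrite exchange_big; apply: eq_bigr; case=> [|a u] _ //=; by rewrite big1.
    rewrite exchange_big /=.
    rewrite (eq_bigr (fun u3 => onhead u3 (fun a u => \sum_(u1 <- arb_above B1) \sum_(u2 <- arb_above B2)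
       shuffle3 ((fun w => f (rcons w L)) \o cons a) u1 u2 u))); last first.
      case=> [|a u] _ //=; by rewrite big1.
    rewrite (HE _ IH3); rewrite big_seq [RHS]big_seq; apply: eq_bigr => -[B0 C] /prunes_above_data[e1 e2].
    rewrite sum_arb /L /= e1 e2 exchange_big; apply: eq_bigr => u1 _; exact: exchange_big.
- by move=> p l f; rewrite big_seq1 big_nil addr0.
- move=> p l T IH f; rewrite /= IH add0r big_cat /= big_map; congr (_ + _).
  by case: ifP => [t3|_]; rewrite ?big_nil // big_seq1 /= big_seq1 letter_three_leaves.
Qed.

Definition sum_arb_prunes V := (sum_arb_prunes_mut V).1.

(** * Grafting and pruning *)

Lemma eq_Tree p k B1 B2 B3 q j A1 A2 A3 : (Tree p k B1 B2 B3 == Tree q j A1 A2 A3) =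
  [&& p == q, k == j, B1 == A1, B2 == A2 & B3 == A3].
Proof.
apply/eqP/and5P => [[-> -> -> -> ->]|]; first by split.
by case=> /eqP-> /eqP-> /eqP-> /eqP-> /eqP->.
Qed.

Lemma eq_Carry p k T q j A : (Carry p k T == Carry q j A) = [&& p == q, k == j & T == A].
Proof. by apply/eqP/and3P => [[-> -> ->]|]; [split | case=> /eqP-> /eqP-> /eqP->]. Qed.

Lemma eq_Leaf p k q j : (Leaf p k == Leaf q j) = (p == q) && (k == j).
Proof. by apply/eqP/andP => [[-> ->]|]; [split | case=> /eqP-> /eqP->]. Qed.

Lemma eq_Leaf_Carry p k q j A : (Leaf p k == Carry q j A) = false.
Proof. exact/eqP. Qed.

Lemma eq_Carry_Leaf p k q j A : (Carry p k A == Leaf q j) = false.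
Proof. exact/eqP. Qed.

Lemma count_mem_map (I J : eqType) (g : I -> J) (b : bool) z y s :
  (forall x, (g x == y) = b && (x == z)) ->
  count_mem y (map g s) = (b * count_mem z s)%N.
Proof.
move=> H; rewrite count_map (eq_count (a2 := fun x => b && (x == z))); last by move=> x; exact: H.
by case: b {H} => /=; rewrite ?mul1n // count_pred0.
Qed.

(** Both multiplicities count the positions at which [C] sits in [T] with [T0] left after its
    removal. Well-formedness of [T] ensures that the edge below [C] has the type and frequency of
    the root of [C], which is what grafting tests. *)
Lemma count_grafts_mut :
  (forall T p k, is_tree p k T -> forall T0 C, three_leaves C ->
     count_mem T (grafts C T0) = count_mem (T0, C) (prunes T)) /\
  (forall B p l, is_branch p l B -> forall B0 C, three_leaves C ->
     count_mem B (grafts_above C B0) = count_mem (B0, C) (prunes_above B)).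
Proof.
apply: tree_branch_ind.
- move=> p k B1 IH1 B2 IH2 B3 IH3 ? ? /is_treeE[_ _ [w1 w2 w3] _] [p0 k0 A1 A2 A3] C tC.
  rewrite /= -/prunes_above -/grafts_above !count_cat; congr (_ + (_ + _))%N.
  + rewrite (@count_mem_map _ _ _ [&& p0 == p, k0 == k, A2 == B2 & A3 == B3] B1); last first.
      by move=> x; rewrite eq_Tree; lia.
    rewrite (@count_mem_map _ _ _ [&& p0 == p, k0 == k, A2 == B2 & A3 == B3] (A1, C)); last first.
      move=> [x D]; rewrite !xpair_eqE eq_Tree /= (eq_sym p) (eq_sym k) (eq_sym B2) (eq_sym B3); lia.
    by rewrite (IH1 _ _ w1).
  + rewrite (@count_mem_map _ _ _ [&& p0 == p, k0 == k, A1 == B1 & A3 == B3] B2); last first.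
      by move=> x; rewrite eq_Tree; lia.
    rewrite (@count_mem_map _ _ _ [&& p0 == p, k0 == k, A1 == B1 & A3 == B3] (A2, C)); last first.
      move=> [x D]; rewrite !xpair_eqE eq_Tree /= (eq_sym p) (eq_sym k) (eq_sym B1) (eq_sym B3); lia.
    by rewrite (IH2 _ _ w2).
  + rewrite (@count_mem_map _ _ _ [&& p0 == p, k0 == k, A1 == B1 & A2 == B2] B3); last first.
      by move=> x; rewrite eq_Tree; lia.
    rewrite (@count_mem_map _ _ _ [&& p0 == p, k0 == k, A1 == B1 & A2 == B2] (A3, C)); last first.
      move=> [x D]; rewrite !xpair_eqE eq_Tree /= (eq_sym p) (eq_sym k) (eq_sym B1) (eq_sym B2); lia.
    by rewrite (IH3 _ _ w3).
- move=> p l ? ? _ [p0 l0|p0 l0 T0] C tC /=.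
    by case: ifP; rewrite //= eq_Carry_Leaf.
  by rewrite count_map (eq_count (a2 := pred0)) ?count_pred0 // => x; rewrite /= eq_Carry_Leaf.
- move=> p l T IH q j /is_branch_CarryE[-> -> wT] [p0 l0|p0 l0 T0] C tC; rewrite /= count_cat.
  + rewrite [X in (_ + X)%N]count_map [X in (_ + X)%N](eq_count (a2 := pred0)) ?count_pred0 ?addn0; last first.
      by move=> [x D] /=; rewrite xpair_eqE eq_Carry_Leaf.
    have rT : rootv T = (j, q) by case: (T) wT => ? ? ? ? ? /is_treeE[-> -> _ _].
    case: (C =P T) => [CT|/eqP CT].
      rewrite CT in tC *; rewrite tC rT /= !xpair_eqE eq_Leaf eqxx (eq_sym j) (eq_sym q).
      by case: (l0 =P j) => [->|]; case: (p0 =P q) => [->|]; rewrite //= eq_Carry !eqxx.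
    have TC : T == C = false by rewrite eq_sym (negbTE CT).
    by do 2![case: ifP => _]; rewrite //= ?eq_Carry ?xpair_eqE ?(negbTE CT) ?TC ?andbF.
  + rewrite (@count_mem_map _ _ _ ((p0 == q) && (l0 == j)) T); last by move=> x; rewrite eq_Carry; lia.
    rewrite (@count_mem_map _ _ _ ((p0 == q) && (l0 == j)) (T0, C)); last first.
      by move=> [x D]; rewrite !xpair_eqE eq_Carry /= (eq_sym q) (eq_sym j); lia.
    by rewrite -(IH _ _ wT) //; case: ifP => //= _; rewrite xpair_eqE eq_Leaf_Carry.
Qed.

Lemma size_grafts_mut C :
  (forall T, size (grafts C T) = count_mem (rootv C) (leaves T)) /\
  (forall B, size (grafts_above C B) = count_mem (rootv C) (leaves_above B)).
Proof.
apply: tree_branch_ind => [p k B1 IH1 B2 IH2 B3 IH3|p l|p l T IH] /=.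
- by rewrite !size_cat !size_map !count_cat IH1 IH2 IH3.
- by rewrite eq_sym; case: eqP.
- by rewrite size_map.
Qed.

Lemma grafts_above_data C B B0 : B \in grafts_above C B0 ->
  btype B = btype B0 /\ bfreq B = bfreq B0.
Proof.
case: B0 => [p l|p l T0] /=; last by case/mapP => T _ ->.
by case: ifP => // _; rewrite inE => /eqP ->.
Qed.

Lemma is_tree_grafts_mut C : is_tree (rootv C).2 (rootv C).1 C ->
  (forall T0 p k, is_tree p k T0 -> forall T, T \in grafts C T0 -> is_tree p k T) /\
  (forall B0 p l, is_branch p l B0 -> forall B, B \in grafts_above C B0 -> is_branch p l B).
Proof.
move=> wC; apply: tree_branch_ind.
- move=> p k B1 IH1 B2 IH2 B3 IH3 q j /is_treeE[-> -> [w1 w2 w3] e] T.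
  rewrite /= -/grafts_above !mem_cat => /or3P[] /mapP[B hB ->]; apply/is_treeE;
    have [eb ef] := grafts_above_data hB; split=> //; rewrite ?ef //; split=> //.
  + exact: IH1 w1 _ hB.
  + exact: IH2 w2 _ hB.
  + exact: IH3 w3 _ hB.
- move=> p l q j /is_branch_LeafE[-> ->] B /=; case: ifP => // /eqP e.
  by rewrite inE => /eqP ->; apply/is_branch_CarryE; rewrite e in wC.
- move=> p l T IH q j /is_branch_CarryE[-> -> wT] B /= /mapP[T' hT ->].
  by apply/is_branch_CarryE; split=> //; apply: IH hT.
Qed.

Lemma prunes_wf_mut :
  (forall T p k, is_tree p k T -> forall x, x \in prunes T ->
     [/\ is_tree p k x.1, is_tree (rootv x.2).2 (rootv x.2).1 x.2 & three_leaves x.2]) /\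
  (forall B p l, is_branch p l B -> forall x, x \in prunes_above B ->
     [/\ is_branch p l x.1, is_tree (rootv x.2).2 (rootv x.2).1 x.2 & three_leaves x.2]).
Proof.
apply: tree_branch_ind.
- move=> p k B1 IH1 B2 IH2 B3 IH3 q j /is_treeE[-> -> [w1 w2 w3] e] T.
  rewrite /= -/prunes_above !mem_cat => /or3P[] /mapP[[B C] hB ->] /=;
    have [eb ef] := prunes_above_data hB.
  + have [? ? ?] := IH1 _ _ w1 _ hB; split=> //; apply/is_treeE; split=> //; rewrite ef //.
  + have [? ? ?] := IH2 _ _ w2 _ hB; split=> //; apply/is_treeE; split=> //; rewrite ef //.
  + have [? ? ?] := IH3 _ _ w3 _ hB; split=> //; apply/is_treeE; split=> //; rewrite ef //.
- by [].
- move=> p l T IH q j /is_branch_CarryE[-> -> wT] x; rewrite /= mem_cat => /orP[].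
    case: ifP => // t3; rewrite inE => /eqP -> /=.
    case: (T) wT t3 => b i ? ? ? w; have /is_treeE[eb ei _ _] := w; subst b i => t3'; split=> //; exact: IsLeaf.
  by move=> /mapP[[T0 C] /(IH _ _ wT)[/= ? ? ?] -> /=]; split=> //; apply/is_branch_CarryE.
Qed.

Definition ntype (T : tree) : bool := let: Tree p _ _ _ _ := T in p.

(** The sign, the resonance condition and the multiplicity of a node depend only on its letter, and
    pruning another node leaves that letter unchanged. *)
Definition node_data (T : tree) : bool * bool * nat := (ntype T, resonant T, pairings T).

Lemma node_data_letter T : node_data (letter T) = node_data T.
Proof. by case: T. Qed.

Lemma prunes_nodes_mut :
  (forall T x, x \in prunes T ->
     perm_eq (map node_data (nodes T)) (node_data x.2 :: map node_data (nodes x.1))) /\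
  (forall B x, x \in prunes_above B ->
     perm_eq (map node_data (nodes_above B)) (node_data x.2 :: map node_data (nodes_above x.1))).
Proof.
apply: tree_branch_ind.
- move=> p k B1 IH1 B2 IH2 B3 IH3 T.
  rewrite /= -/prunes_above !mem_cat => /or3P[] /mapP[[B C] hB ->] /=;
    have [eb ef] := prunes_above_data hB; rewrite -[node_data (Tree _ _ _ _ _)]node_data_letter
      -[X in _ :: X :: _]node_data_letter [letter _]/= [X in _ :: node_data X :: _]/= eb ef;
    [have /seq.permP H := IH1 _ hB|have /seq.permP H := IH2 _ hB|have /seq.permP H := IH3 _ hB];
    apply/seq.permP => a; have := H a; rewrite /= !map_cat !count_cat /=; lia.
- by [].
- move=> p l T IH x; rewrite /= mem_cat => /orP[|/mapP[[T0 C] /IH H -> //]].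
  case: ifP => // t3; rewrite inE => /eqP -> /=.
  by case: T t3 {IH} => ? ? [? ?|//] [? ?|//] [? ?|//].
Qed.

Lemma prunes_mem_nodes_mut :
  (forall T x, x \in prunes T -> x.2 \in nodes T) /\
  (forall B x, x \in prunes_above B -> x.2 \in nodes_above B).
Proof.
apply: tree_branch_ind.
- move=> p k B1 IH1 B2 IH2 B3 IH3 T.
  by rewrite /= -/prunes_above !mem_cat => /or3P[] /mapP[[B C] hB ->] /=; rewrite in_cons !mem_cat;
    [rewrite (IH1 _ hB)|rewrite (IH2 _ hB)|rewrite (IH3 _ hB)]; rewrite ?orbT.
- by [].
- move=> p l T IH x; rewrite /= mem_cat => /orP[|/mapP[[T0 C] /IH H -> //]].
  case: ifP => // t3; rewrite inE => /eqP -> /=.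
  by case: (T) => ? ? ? ? ?; rewrite /= mem_head.
Qed.

(** Grafting trades one leaf with variable [rootv x.2] for the leaves of [x.2]; adding that leaf on
    the left avoids a subtraction of multisets. *)
Lemma prunes_leaves_mut :
  (forall T p k, is_tree p k T -> forall x, x \in prunes T ->
     perm_eq (rootv x.2 :: leaves T) (leaves x.1 ++ leaves x.2)) /\
  (forall B p l, is_branch p l B -> forall x, x \in prunes_above B ->
     perm_eq (rootv x.2 :: leaves_above B) (leaves_above x.1 ++ leaves x.2)).
Proof.
apply: tree_branch_ind.
- move=> p k B1 IH1 B2 IH2 B3 IH3 q j /is_treeE[-> -> [w1 w2 w3] e] T.
  rewrite /= -/prunes_above !mem_cat => /or3P[] /mapP[[B C] hB ->] /=;
    [have /seq.permP H := IH1 _ _ w1 _ hB|have /seq.permP H := IH2 _ _ w2 _ hB|have /seq.permP H := IH3 _ _ w3 _ hB];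
    apply/seq.permP => a; have := H a; rewrite /= !count_cat /=; lia.
- by [].
- move=> p l T IH q j /is_branch_CarryE[-> -> wT] x; rewrite /= mem_cat => /orP[|/mapP[[T0 C] /(IH _ _ wT) H -> //]].
  case: ifP => // t3; rewrite inE => /eqP -> /=.
  by case: (T) wT => ? ? ? ? ? /is_treeE[-> -> _ _]; rewrite perm_refl.
Qed.

(** * Orders, signs and phases read on nodes and words *)

Lemma t12F : (t1 == t2) = false. Proof. exact/eqP. Qed.

Lemma count_t2_edges_mut :
  (forall T a, count (fun e => (edec e).1 == t2) (edges_from a T) = size (nodes T)) /\
  (forall B a, count (fun e => (edec e).1 == t2) (edges_above a B) = size (nodes_above B)).
Proof.
apply: tree_branch_ind => [p k B1 IH1 B2 IH2 B3 IH3|p l|p l T IH] a /=.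
- by rewrite eqxx -/edges_above !count_cat IH1 IH2 IH3 !size_cat.
- by rewrite t12F.
- by rewrite t12F IH.
Qed.

Lemma torderE T : torder T = size (nodes T).
Proof. exact: count_t2_edges_mut.1. Qed.

Lemma count_conj_edges_mut :
  (forall T a, count (fun e => edec e == (t2, true)) (edges_from a T) = count ntype (nodes T)) /\
  (forall B a, count (fun e => edec e == (t2, true)) (edges_above a B) = count ntype (nodes_above B)).
Proof.
apply: tree_branch_ind => [p k B1 IH1 B2 IH2 B3 IH3|p l|p l T IH] a /=.
- by rewrite xpair_eqE eqxx -/edges_above !count_cat IH1 IH2 IH3 /= eqb_id.
- by rewrite xpair_eqE t12F.
- by rewrite xpair_eqE t12F IH.
Qed.

Lemma conj_signE T : conj_sign T = (-1) ^+ count ntype (nodes T).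
Proof. by rewrite /conj_sign count_conj_edges_mut.1. Qed.

Lemma scFw_shuffle u v w : w \in shuffle u v -> scFw w = scFw u + scFw v.
Proof.
rewrite /scFw; elim: u v w => [|a u IHu] v w.
  by rewrite shuffle_nill inE => /eqP ->; rewrite big_nil add0r.
elim: v w => [|b v IHv] w; first by rewrite inE => /eqP ->; rewrite big_nil addr0.
rewrite [shuffle _ _]/= mem_cat => /orP[] /mapP[w'].
  by move=> /IHu h ->; rewrite !big_cons h big_cons addrA.
by move=> /IHv h ->; rewrite !big_cons h big_cons addrCA.
Qed.

Lemma scFw_rcons w L : scFw (rcons w L) = scFw w + scF L.
Proof. by rewrite /scFw -cats1 big_cat /= big_seq1. Qed.

(** Every edge is counted by exactly one letter: a [t2] edge by the node just above it, a [t1] edge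
    by the node just below it. In the statement on branches the bottom edge is therefore added by
    hand, its letter lying outside the branch. *)
Lemma scFw_arb_mut :
  (forall T a w, w \in arb T -> scFw w = \sum_(e <- edges_from a T) P (edec e) (efreq e)) /\
  (forall B a w, w \in arb_above B ->
     P (t1, btype B) (bfreq B) + scFw w = \sum_(e <- edges_above a B) P (edec e) (efreq e)).
Proof.
apply: tree_branch_ind => [p k B1 IH1 B2 IH2 B3 IH3|p l|p l T IH] a w.
- move=> /mapP[w' + ->]; rewrite -/arb_above => /flattenP[s /allpairsP[[u1 x] /= [h1 h2 ->]] hw].
  have [s' /allpairsP[[u2 u3] /= [h3 h4 ->]] hx] := flattenP h2.
  rewrite /edges_from -/edges_above big_cons !big_cat /= -(IH1 _ _ h1) -(IH2 _ _ h3) -(IH3 _ _ h4).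
  rewrite scFw_rcons (scFw_shuffle hw) (scFw_shuffle hx).
  rewrite /scF /edges /= !big_cons big_nil /edec /efreq /=; lia.
- by rewrite inE => /eqP ->; rewrite /= big_seq1 /scFw big_nil addr0.
- by move=> h; rewrite /= big_cons -(IH (0%N :: a) _ h).
Qed.

Lemma scFw_arb T w : w \in arb T -> scFw w = scF T.
Proof. exact: scFw_arb_mut.1. Qed.

(** * Plane versions of a tree *)

(* The list, with repetitions, of the trees obtained from [T] by choosing at each node
   whether to exchange the two branches of equal type. *)
Fixpoint orb (T : tree) : seq tree :=
  let: Tree p k B1 B2 B3 := T in
  [seq Tree p k x.1 x.2 x3
     | x <- [seq (x1, x2) | x1 <- orb_above B1, x2 <- orb_above B2], x3 <- orb_above B3]
  ++ [seq Tree p k x.2 x.1 x3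
     | x <- [seq (x1, x2) | x1 <- orb_above B1, x2 <- orb_above B2], x3 <- orb_above B3]
with orb_above (B : branch) : seq branch :=
  match B with
  | Leaf p l => [:: Leaf p l]
  | Carry p l T => [seq Carry p l T' | T' <- orb T]
  end.

Lemma sum_orb (V : nmodType) (f : tree -> V) p k B1 B2 B3 :
  \sum_(T <- orb (Tree p k B1 B2 B3)) f T =
  \sum_(x1 <- orb_above B1) \sum_(x2 <- orb_above B2) \sum_(x3 <- orb_above B3)
     (f (Tree p k x1 x2 x3) + f (Tree p k x2 x1 x3)).
Proof.
rewrite big_cat /= !big_allpairs_dep -big_split /=.
apply: eq_bigr => x1 _; rewrite -big_split; apply: eq_bigr => x2 _.
by rewrite -big_split.
Qed.

Lemma mem_orb T' p k B1 B2 B3 : T' \in orb (Tree p k B1 B2 B3) ->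
  exists x1 x2 x3, [/\ x1 \in orb_above B1, x2 \in orb_above B2, x3 \in orb_above B3
    & T' = Tree p k x1 x2 x3 \/ T' = Tree p k x2 x1 x3].
Proof.
rewrite mem_cat => /orP[] /allpairsP[[[x1 x2] x3] /= [/allpairsP[[a b] /= [ha hb [-> ->]]] h3 ->]];
exists a, b, x3; split=> //; by [left|right].
Qed.

Lemma orb_above_data B B' : B' \in orb_above B ->
  [/\ btype B' = btype B, bfreq B' = bfreq B & is_leaf B' = is_leaf B].
Proof.
by case: B => [p l|p l T] /=; [rewrite inE => /eqP -> | case/mapP => T' _ ->].
Qed.

Lemma orb_wf_mut :
  (forall T p k, is_tree p k T -> forall T', T' \in orb T -> is_tree p k T') /\
  (forall B p l, is_branch p l B -> forall B', B' \in orb_above B -> is_branch p l B').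
Proof.
apply: tree_branch_ind.
- move=> p k B1 IH1 B2 IH2 B3 IH3 q j /is_treeE[-> -> [w1 w2 w3] e] T'.
  move=> /mem_orb[x1 [x2 [x3 [h1 h2 h3]]]].
  have [_ f1 _] := orb_above_data h1; have [_ f2 _] := orb_above_data h2.
  have [_ f3 _] := orb_above_data h3.
  have v1 := IH1 _ _ w1 _ h1; have v2 := IH2 _ _ w2 _ h2; have v3 := IH3 _ _ w3 _ h3.
  case=> ->; apply/is_treeE; rewrite f1 f2 f3; split=> //.
  by rewrite e [X in X + _]addrC.
- by move=> p l q j w B'; rewrite inE => /eqP ->.
- move=> p l T IH q j /is_branch_CarryE[-> -> wT] B' /mapP[T' h ->].
  by apply/is_branch_CarryE; split=> //; apply: IH h.
Qed.

Lemma orb_leaves_mut :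
  (forall T T', T' \in orb T -> perm_eq (leaves T') (leaves T)) /\
  (forall B B', B' \in orb_above B -> perm_eq (leaves_above B') (leaves_above B)).
Proof.
apply: tree_branch_ind.
- move=> p k B1 IH1 B2 IH2 B3 IH3 T' /mem_orb[x1 [x2 [x3 [h1 h2 h3]]]] h.
  have /seq.permP v1 := IH1 _ h1; have /seq.permP v2 := IH2 _ h2; have /seq.permP v3 := IH3 _ h3.
  by case: h => ->; apply/seq.permP => a; rewrite /= !count_cat v1 v2 v3 // addnCA.
- by move=> p l B'; rewrite inE => /eqP ->.
- by move=> p l T IH B' /mapP[T' h ->]; exact: IH.
Qed.

(** The flag [three_leaves] is kept out of [node_data] because pruning can make it true at the node
    below, whereas an exchange of branches preserves it. *)
Definition swap_data (T : tree) := (node_data T, three_leaves T).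

Lemma swap_dataC p k B1 B2 B3 : swap_data (Tree p k B2 B1 B3) = swap_data (Tree p k B1 B2 B3).
Proof.
by rewrite /swap_data /node_data /=; congr (_, _ + (_ + _) == 0, _, _);
  [exact: addrC | exact: addnC | exact: andbCA].
Qed.

Lemma eq_swap_data p k B1 B2 B3 A1 A2 A3 :
  [/\ btype A1 = btype B1, bfreq A1 = bfreq B1 & is_leaf A1 = is_leaf B1] ->
  [/\ btype A2 = btype B2, bfreq A2 = bfreq B2 & is_leaf A2 = is_leaf B2] ->
  [/\ btype A3 = btype B3, bfreq A3 = bfreq B3 & is_leaf A3 = is_leaf B3] ->
  swap_data (Tree p k A1 A2 A3) = swap_data (Tree p k B1 B2 B3).
Proof.
by rewrite /swap_data /node_data /= => -[-> -> ->] [-> -> ->] [-> -> ->].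
Qed.

Lemma orb_nodes_mut :
  (forall T T', T' \in orb T -> perm_eq (map swap_data (nodes T')) (map swap_data (nodes T))) /\
  (forall B B', B' \in orb_above B ->
     perm_eq (map swap_data (nodes_above B')) (map swap_data (nodes_above B))).
Proof.
apply: tree_branch_ind.
- move=> p k B1 IH1 B2 IH2 B3 IH3 T' /mem_orb[x1 [x2 [x3 [h1 h2 h3]]]] h.
  have e := eq_swap_data p k (orb_above_data h1) (orb_above_data h2) (orb_above_data h3).
  have /seq.permP v1 := IH1 _ h1; have /seq.permP v2 := IH2 _ h2; have /seq.permP v3 := IH3 _ h3.
  have [T'd T'n] : swap_data T' = swap_data (Tree p k B1 B2 B3) /\
      perm_eq (map swap_data (nodes T')) (swap_data T' :: map swap_data (nodes_above x1)
        ++ map swap_data (nodes_above x2) ++ map swap_data (nodes_above x3)).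
    case: h => ->; rewrite ?[swap_data (Tree p k x2 _ _)]swap_dataC -e; split=> //.
      by rewrite [nodes _]/= map_cons !map_cat.
    rewrite [nodes _]/= map_cons !map_cat swap_dataC perm_cons.
    by apply/seq.permP => a; rewrite !count_cat addnCA.
  rewrite (perm_trans T'n) // T'd [nodes _]/= map_cons !map_cat perm_cons.
  by apply/seq.permP => a; rewrite !count_cat v1 v2 v3.
- by move=> p l B'; rewrite inE => /eqP ->.
- by move=> p l T IH B' /mapP[T' h ->]; exact: IH.
Qed.

(* Exchanging branches in a tree changes its letters, but not their normalizations; all
   coefficients below depend on the normalizations only. *)
Definition norm_letter (T : tree) : tree :=
  let: Tree p k B1 B2 B3 := T in
  if (choice.pickle (btype B1, bfreq B1) <= choice.pickle (btype B2, bfreq B2))%N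
  then Tree p k B1 B2 B3 else Tree p k B2 B1 B3.

Lemma norm_letterC p k B1 B2 B3 :
  norm_letter (letter (Tree p k B2 B1 B3)) = norm_letter (letter (Tree p k B1 B2 B3)).
Proof.
rewrite /=; case: ltngtP => //= /(pcan_inj choice.pickleK)[-> ->] //.
Qed.

Lemma shuffle_cons a u b v : shuffle (a :: u) (b :: v) =
  map (cons a) (shuffle u (b :: v)) ++ map (cons b) (shuffle (a :: u) v).
Proof. by []. Qed.

Lemma map_shuffle (h : tree -> tree) u v :
  map (map h) (shuffle u v) = shuffle (map h u) (map h v).
Proof.
elim: u v => [|a u IHu] v; first by rewrite !shuffle_nill.
elim: v => [|b v IHv] //.
rewrite shuffle_cons map_cat -!map_comp shuffle_cons -/(map h (b :: v)) -/(map h (a :: u)).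
by rewrite -IHu -IHv -!map_comp.
Qed.

Section ArbOrb.
Variable V : nmodType.

Lemma shuffle3_map (f : word -> V) h u1 u2 u3 :
  shuffle3 (fun w => f (map h w)) u1 u2 u3 = shuffle3 f (map h u1) (map h u2) (map h u3).
Proof.
rewrite /shuffle3 -map_shuffle big_map; apply: eq_bigr => x _.
by rewrite -map_shuffle big_map.
Qed.

Lemma sum_arb_norm (f : word -> V) p k B1 B2 B3 :
  \sum_(w <- arb (Tree p k B1 B2 B3)) f (map norm_letter w) =
  \sum_(u1 <- arb_above B1) \sum_(u2 <- arb_above B2) \sum_(u3 <- arb_above B3)
    shuffle3 (fun w => f (rcons w (norm_letter (letter (Tree p k B1 B2 B3)))))
      (map norm_letter u1) (map norm_letter u2) (map norm_letter u3).
Proof.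
rewrite sum_arb; apply: eq_bigr => u1 _; apply: eq_bigr => u2 _; apply: eq_bigr => u3 _.
by rewrite -shuffle3_map; apply: eq_shuffle3 => w; rewrite map_rcons.
Qed.

(** An exchange at the root permutes two factors of a commutative shuffle, and alters the last
    letter only by an exchange that [norm_letter] does not see. *)
Lemma orb_arb_mut :
  (forall T T', T' \in orb T -> forall f : word -> V,
     \sum_(w <- arb T') f (map norm_letter w) = \sum_(w <- arb T) f (map norm_letter w)) /\
  (forall B B', B' \in orb_above B -> forall f : word -> V,
     \sum_(w <- arb_above B') f (map norm_letter w) =
     \sum_(w <- arb_above B) f (map norm_letter w)).
Proof.
apply: tree_branch_ind.
- move=> p k B1 IH1 B2 IH2 B3 IH3 T' /mem_orb[x1 [x2 [x3 [h1 h2 h3]]]] h f.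
  have [d1 d1' _] := orb_above_data h1; have [d2 d2' _] := orb_above_data h2.
  have [d3 d3' _] := orb_above_data h3.
  rewrite sum_arb_norm; set L := norm_letter _.
  transitivity (\sum_(u1 <- arb_above x1) \sum_(u2 <- arb_above x2) \sum_(u3 <- arb_above x3)
    shuffle3 (fun w => f (rcons w L))
      (map norm_letter u1) (map norm_letter u2) (map norm_letter u3)).
    have eL : L = norm_letter (letter (Tree p k x1 x2 x3)) by rewrite /L /= d1 d1' d2 d2' d3 d3'.
    case: h => ->; rewrite sum_arb_norm; first by rewrite eL.
    rewrite norm_letterC -eL exchange_big; apply: eq_bigr => u1 _; apply: eq_bigr => u2 _.
    by apply: eq_bigr => u3 _; rewrite shuffle3C.
  rewrite (IH1 _ h1 (fun u1 => \sum_(u2 <- arb_above x2) \sum_(u3 <- arb_above x3)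
    shuffle3 (fun w => f (rcons w L)) u1 (map norm_letter u2) (map norm_letter u3))).
  apply: eq_bigr => u1 _.
  rewrite (IH2 _ h2 (fun u2 => \sum_(u3 <- arb_above x3)
    shuffle3 (fun w => f (rcons w L)) (map norm_letter u1) u2 (map norm_letter u3))).
  apply: eq_bigr => u2 _.
  exact: (IH3 _ h3 (fun u3 =>
    shuffle3 (fun w => f (rcons w L)) (map norm_letter u1) (map norm_letter u2) u3)).
- by move=> p l B'; rewrite inE => /eqP ->.
- by move=> p l T IH B' /mapP[T' h ->]; exact: IH.
Qed.

End ArbOrb.

(** * Symmetry factors of non-planar shapes *)

Fixpoint canon_code (T : tree) : nat :=
  let: Tree _ _ B1 B2 B3 := T in
  (choice.pickle (minn (canon_code_above B1) (canon_code_above B2),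
                  maxn (canon_code_above B1) (canon_code_above B2), canon_code_above B3)).+1
with canon_code_above (B : branch) : nat :=
  if B is Carry _ _ T then canon_code T else 0%N.

(** A node contributes 2 exactly when its two branches of equal type have the same non-planar shape;
    shapes are compared by [canon_code], which sorts these two branches and so is defined on every
    plane tree. This number is obtained below both as a count of plane representatives in [orb T]
    and as the number of automorphisms. *)
Fixpoint sym_factor (T : tree) : nat :=
  let: Tree _ _ B1 B2 B3 := T in
  ((canon_code_above B1 == canon_code_above B2).+1
   * (sym_factor_above B1 * sym_factor_above B2 * sym_factor_above B3))%N
with sym_factor_above (B : branch) : nat :=
  if B is Carry _ _ T then sym_factor T else 1%N.

Lemma sym_factor_gt0_mut : (forall T, 0 < sym_factor T)%N /\ (forall B, 0 < sym_factor_above B)%N.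
Proof.
by apply: tree_branch_ind => //= p k B1 IH1 B2 IH2 B3 IH3; rewrite !muln_gt0 IH1 IH2 IH3.
Qed.

Lemma orb_canon_code_mut :
  (forall T T', T' \in orb T -> canon_code T' = canon_code T) /\
  (forall B B', B' \in orb_above B -> canon_code_above B' = canon_code_above B).
Proof.
apply: tree_branch_ind.
- move=> p k B1 IH1 B2 IH2 B3 IH3 T' /mem_orb[x1 [x2 [x3 [h1 h2 h3]]]].
  by case=> -> /=; rewrite (IH1 _ h1) (IH2 _ h2) (IH3 _ h3) // minnC maxnC.
- by move=> p l B'; rewrite inE => /eqP ->.
- by move=> p l T IH B' /mapP[T' h ->]; exact: IH.
Qed.

Lemma orb_sym_factor_mut :
  (forall T T', T' \in orb T -> sym_factor T' = sym_factor T) /\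
  (forall B B', B' \in orb_above B -> sym_factor_above B' = sym_factor_above B).
Proof.
apply: tree_branch_ind.
- move=> p k B1 IH1 B2 IH2 B3 IH3 T' /mem_orb[x1 [x2 [x3 [h1 h2 h3]]]].
  have [_ c] := orb_canon_code_mut.
  case=> -> /=; rewrite (IH1 _ h1) (IH2 _ h2) (IH3 _ h3) // (c _ _ h1) (c _ _ h2) //.
  by rewrite eq_sym [(sym_factor_above B2 * _)%N]mulnC.
- by move=> p l B'; rewrite inE => /eqP ->.
- by move=> p l T IH B' /mapP[T' h ->]; exact: IH.
Qed.

Definition node_ordered (T : tree) : bool :=
  let: Tree _ _ B1 B2 _ := T in (code_above B1 <= code_above B2)%N.

Definition plane_rep_above (B : branch) : bool := all node_ordered (nodes_above B).

Lemma plane_repE p k B1 B2 B3 : plane_rep (Tree p k B1 B2 B3) =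
  [&& (code_above B1 <= code_above B2)%N, plane_rep_above B1, plane_rep_above B2
    & plane_rep_above B3].
Proof. by rewrite /plane_rep /= !all_cat. Qed.

Lemma plane_rep_code_mut :
  (forall T, plane_rep T -> Defs.code T = canon_code T) /\
  (forall B, plane_rep_above B -> code_above B = canon_code_above B).
Proof.
apply: tree_branch_ind => //= p k B1 IH1 B2 IH2 B3 IH3.
rewrite plane_repE => /and4P[le12 /IH1 e1 /IH2 e2 /IH3 e3].
by rewrite e1 e2 e3 in le12 *; rewrite (minn_idPl le12) (maxn_idPr le12).
Qed.

Lemma sum_mul3 (I1 I2 I3 : Type) (r1 : seq I1) (r2 : seq I2) (r3 : seq I3)
    (a : I1 -> nat) (b : I2 -> nat) (c : I3 -> nat) :
  (\sum_(x1 <- r1) \sum_(x2 <- r2) \sum_(x3 <- r3) a x1 * b x2 * c x3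
   = (\sum_(x <- r1) a x) * (\sum_(x <- r2) b x) * (\sum_(x <- r3) c x))%N.
Proof.
rewrite -mulnA big_distrl; apply: eq_bigr => x1 _ /=.
rewrite big_distrl big_distrr; apply: eq_bigr => x2 _ /=.
by rewrite big_distrr big_distrr; apply: eq_bigr => x3 _ /=; rewrite mulnA.
Qed.

(** At each node [orb] lists both orders of the two branches: one of them is sorted when the shapes
    differ, both are when the shapes agree. On sorted branches [code] is [canon_code], which is
    constant along [orb]. *)
Lemma sum_plane_rep_orb_mut :
  (forall T, \sum_(x <- orb T) plane_rep x = sym_factor T)%N /\
  (forall B, \sum_(x <- orb_above B) plane_rep_above x = sym_factor_above B)%N.
Proof.
apply: tree_branch_ind.
- move=> p k B1 IH1 B2 IH2 B3 IH3; rewrite sum_orb /=.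
  rewrite -IH1 -IH2 -IH3 -sum_mul3 big_distrr big_seq [RHS]big_seq; apply: eq_bigr => x1 h1.
  rewrite big_distrr big_seq [RHS]big_seq; apply: eq_bigr => x2 h2.
  rewrite big_distrr; apply: eq_bigr => x3 _.
  rewrite !plane_repE.
  case e1: (plane_rep_above x1); case e2: (plane_rep_above x2); rewrite ?andbF /= ?mul0n ?muln0 ?addn0 //=.
  case e3: (plane_rep_above x3); rewrite ?andbF /= ?muln0 ?addn0 //.
  rewrite !plane_rep_code_mut.2 // !(orb_canon_code_mut.2 _ _ h1) !(orb_canon_code_mut.2 _ _ h2).
  (* For two codes this is [(c1 <= c2) + (c2 <= c1) = (c1 == c2).+1]. *)
  lia.
- by move=> p l; rewrite big_seq1.
- by move=> p l T IH; rewrite big_map.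
Qed.

Lemma count_memE (I : eqType) (y : I) s : count_mem y s = (\sum_(x <- s) (x == y))%N.
Proof. by rewrite -sum1_count big_mkcond; apply: eq_bigr => x _ /=; case: eqP. Qed.

Lemma count_orb p k B1 B2 B3 q j A1 A2 A3 :
  (count_mem (Tree q j A1 A2 A3) (orb (Tree p k B1 B2 B3)) =
  (p == q) && (k == j) * (count_mem A1 (orb_above B1) * count_mem A2 (orb_above B2)
     * count_mem A3 (orb_above B3)
   + count_mem A2 (orb_above B1) * count_mem A1 (orb_above B2)
     * count_mem A3 (orb_above B3)))%N.
Proof.
rewrite count_memE sum_orb !count_memE -!sum_mul3 -big_split big_distrr; apply: eq_bigr => x1 _ /=.
rewrite -big_split big_distrr; apply: eq_bigr => x2 _ /=.
rewrite -big_split big_distrr; apply: eq_bigr => x3 _ /=.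
rewrite !eq_Tree; do ![case: eqP => ? //=].
Qed.

(** An exchange is its own inverse, so the choices of exchanges leading from [T] to [T'] correspond
    to those leading back. *)
Lemma orb_sym_mut :
  (forall T T', count_mem T' (orb T) = count_mem T (orb T')) /\
  (forall B B', count_mem B' (orb_above B) = count_mem B (orb_above B')).
Proof.
apply: tree_branch_ind.
- move=> p k B1 IH1 B2 IH2 B3 IH3 [q j A1 A2 A3].
  rewrite !count_orb !IH1 !IH2 !IH3 (eq_sym p) (eq_sym k); congr (_ * (_ + _))%N.
  by rewrite [(count_mem B1 _ * _)%N]mulnC.
- move=> p l [q j|q j T] /=; first by rewrite eq_sym.
  rewrite eq_Leaf_Carry count_map (eq_count (a2 := pred0)) ?count_pred0 // => x.
  by rewrite /= eq_Carry_Leaf.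
- move=> p l T IH [q j|q j T'] /=.
    rewrite eq_Leaf_Carry count_map (eq_count (a2 := pred0)) ?count_pred0 // => x.
    by rewrite /= eq_Carry_Leaf.
  rewrite (@count_mem_map _ _ _ ((p == q) && (l == j)) T'); last by move=> x; rewrite eq_Carry; lia.
  rewrite (@count_mem_map _ _ _ ((p == q) && (l == j)) T) ?IH // => x.
  by rewrite eq_Carry (eq_sym q) (eq_sym j); lia.
Qed.

Lemma size_orb_mut :
  (forall T, size (orb T) = 2 ^ size (nodes T))%N /\
  (forall B, size (orb_above B) = 2 ^ size (nodes_above B))%N.
Proof.
apply: tree_branch_ind => //= [p k B1 IH1 B2 IH2 B3 IH3|p l T IH].
- by rewrite !size_cat !size_allpairs IH1 IH2 IH3 expnS !expnD; lia.
- by rewrite size_map.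
Qed.

(** The power of two is the length of [orb T], so the left side runs over all exchanged versions of
    the plane representatives. Read backwards by [double_count], each tree [T] collects the
    [sym_factor T] representatives found in its own list, which cancels the denominator. *)
Lemma sum_plane_rep (F : numFieldType) (L : seq tree) (c : tree -> F) :
  uniq L -> {in L, forall T, {subset orb T <= L}} ->
  {in L, forall T, {in orb T, forall T', c T' = c T}} ->
  \sum_(T <- L | plane_rep T) c T * (2 ^+ size (nodes T) / (sym_factor T)%:R) = \sum_(T <- L) c T.
Proof.
move=> uL sL cL.
transitivity (\sum_(T <- L) \sum_(T' <- orb T) (plane_rep T)%:R * (c T / (sym_factor T)%:R)).
  rewrite big_mkcond; apply: eq_bigr => T _; rewrite big_const_seq count_predT size_orb_mut.1.
  rewrite iter_addr_0; case: plane_rep; last by rewrite mul0r mul0rn.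
  by rewrite mul1r -[RHS]mulr_natr natrX; field; rewrite pnatr_eq0 -lt0n sym_factor_gt0_mut.1.
rewrite (double_count (r' := orb) _ uL uL sL sL); last by move=> T T' _ _; exact: orb_sym_mut.1.
rewrite big_seq [RHS]big_seq; apply: eq_bigr => T TL.
transitivity (\sum_(T' <- orb T) (plane_rep T')%:R * (c T / (sym_factor T)%:R)).
  rewrite big_seq [RHS]big_seq; apply: eq_bigr => T' hT'.
  by rewrite (cL _ TL _ hT') (orb_sym_factor_mut.1 _ _ hT').
rewrite -big_distrl /= -natr_sum sum_plane_rep_orb_mut.1; field.
by rewrite pnatr_eq0 -lt0n sym_factor_gt0_mut.1.
Qed.

(** * Automorphisms *)

Definition root_edge (a : seq nat) (T : tree) : edge :=
  let: Tree p k _ _ _ := T in (a, (t2, p), k).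

Definition branch_edge (a : seq nat) (B : branch) : edge := (a, (t1, btype B), bfreq B).

(** Addresses grow on the left, so the edges above a given one have its address as a suffix. The
    second claim makes the bottom edge the only one of minimal height; it is later used to recognize
    an edge from the length of its address. *)
Lemma edges_suffix_mut :
  (forall T a e, e \in edges_from a T ->
     seq.suffix a (addr e) /\ ((size (addr e) <= size a)%N -> e = root_edge a T)) /\
  (forall B a e, e \in edges_above a B ->
     seq.suffix a (addr e) /\ ((size (addr e) <= size a)%N -> e = branch_edge a B)).
Proof.
have up a i (x : edge) : seq.suffix (i :: a) (addr x) ->
    seq.suffix a (addr x) /\ (size a < size (addr x))%N.
  move=> h; split; last exact: size_suffix h.
  by apply: suffix_trans h; rewrite -cat1s suffix_suffix.
apply: tree_branch_ind => [p k B1 IH1 B2 IH2 B3 IH3|p l|p l T IH] a e.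
- rewrite inE -/edges_above !mem_cat => /orP[/eqP -> //|]; first by rewrite suffix_refl.
  move=> h; have [s lt] : seq.suffix a (addr e) /\ (size a < size (addr e))%N.
    by case/or3P: h => [/IH1|/IH2|/IH3] [/up].
  by split=> // le; rewrite ltnNge le in lt.
- by rewrite inE => /eqP ->; rewrite suffix_refl.
- rewrite inE -/edges_from => /orP[/eqP -> //|]; first by rewrite suffix_refl.
  by case/IH => /up[s lt] _; split=> // le; rewrite ltnNge le in lt.
Qed.

Lemma edges_from_cons a T : exists E, edges_from a T = root_edge a T :: E.
Proof. by case: T => p k B1 B2 B3; eexists. Qed.

Lemma edges_above_cons a B : exists E, edges_above a B = branch_edge a B :: E.
Proof. by case: B => [p l|p l T]; eexists. Qed.

Lemma suffix_cons_inj (a : seq nat) i j s : seq.suffix (i :: a) s -> seq.suffix (j :: a) s -> i = j.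
Proof.
rewrite !suffixE /= => /eqP h1 /eqP h2.
by have := etrans (esym h1) h2 => -[].
Qed.

Lemma edges_uniq_mut :
  (forall T a, uniq (edges_from a T)) /\ (forall B a, uniq (edges_above a B)).
Proof.
have [sT sB] := edges_suffix_mut.
have notin B i a p : (a, p.1, p.2) \notin edges_above (i :: a) B.
  by apply/negP => /sB[/size_suffix /=]; rewrite ltnn.
have dis B B' i j a : i != j -> ~~ has (mem (edges_above (i :: a) B)) (edges_above (j :: a) B').
  move=> ij; apply/hasPn => x /sB[h _]; apply/negP => /sB[h' _].
  by case/eqP: ij; apply: suffix_cons_inj h' h.
apply: tree_branch_ind => [p k B1 IH1 B2 IH2 B3 IH3|p l|p l T IH] a //=.
- rewrite !mem_cat !(negbTE (notin _ _ _ (_, _))) !cat_uniq IH1 IH2 IH3 has_cat.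
  by rewrite !(negbTE (dis _ _ _ _ _ _)).
- by rewrite IH andbT; apply/negP => /sT[/size_suffix /=]; rewrite ltnn.
Qed.

Lemma parent_edge_mut :
  (forall T a e, e \in edges_from a T -> e <> root_edge a T ->
     exists2 f, f \in edges_from a T & child f e) /\
  (forall B a e, e \in edges_above a B -> e <> branch_edge a B ->
     exists2 f, f \in edges_above a B & child f e).
Proof.
apply: tree_branch_ind => [p k B1 IH1 B2 IH2 B3 IH3|p l|p l T IH] a e.
- have H i B (IH : forall a e, e \in edges_above a B -> e <> branch_edge a B ->
     exists2 f, f \in edges_above a B & child f e) : e \in edges_above (i :: a) B ->
     {subset edges_above (i :: a) B <= edges_from a (Tree p k B1 B2 B3)} ->
     exists2 f, f \in edges_from a (Tree p k B1 B2 B3) & child f e.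
    move=> eB sB; case: (e =P branch_edge (i :: a) B) => [->|/(IH _ _ eB)[f /sB hf c]]; last by exists f.
    by exists (root_edge a (Tree p k B1 B2 B3)); rewrite ?mem_head // /child /= eqxx.
  rewrite {1}/edges_from -/edges_above in_cons !mem_cat => /orP[/eqP -> //|/or3P[] h _].
  + by apply: H IH1 h _ => f hf; rewrite /= in_cons !mem_cat hf !orbT.
  + by apply: H IH2 h _ => f hf; rewrite /= in_cons !mem_cat hf !orbT.
  + by apply: H IH3 h _ => f hf; rewrite /= in_cons !mem_cat hf !orbT.
- by rewrite inE => /eqP.
- rewrite in_cons -/edges_from => /orP[/eqP -> //|h _].
  case: (e =P root_edge (0%N :: a) T) => [->|/(IH _ _ h)[f hf c]].
    exists (branch_edge a (Carry p l T)); first by rewrite mem_head.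
    by rewrite /child; case: (T) => *; rewrite /= eqxx.
  by exists f => //; rewrite in_cons -/edges_from hf orbT.
Qed.

Definition cat3 (L1 L2 L3 : seq (seq edge)) : seq (seq edge) :=
  [seq x1 ++ x | x1 <- L1, x <- [seq x2 ++ x3 | x2 <- L2, x3 <- L3]].

(* An isomorphism from [T] onto [T'] is encoded by the list of the images of the
   edges of [T]; [a] is the address of the root edge of [T']. *)
Fixpoint isos (a : seq nat) (T T' : tree) {struct T} : seq (seq edge) :=
  let: Tree p k B1 B2 B3 := T in
  let: Tree q j A1 A2 A3 := T' in
  if p == q then
    [seq root_edge a T' :: y
      | y <- cat3 (isos_above (0%N :: a) B1 A1) (isos_above (1%N :: a) B2 A2)
                  (isos_above (2%N :: a) B3 A3)
             ++ cat3 (isos_above (1%N :: a) B1 A2) (isos_above (0%N :: a) B2 A1)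
                  (isos_above (2%N :: a) B3 A3)]
  else [::]
with isos_above (a : seq nat) (B A : branch) {struct B} : seq (seq edge) :=
  match B, A with
  | Leaf p l, Leaf q j => if p == q then [:: [:: branch_edge a A]] else [::]
  | Carry p l T, Carry q j T' =>
      if p == q then [seq branch_edge a A :: y | y <- isos (0%N :: a) T T'] else [::]
  | _, _ => [::]
  end.

Lemma size_cat3 L1 L2 L3 : size (cat3 L1 L2 L3) = (size L1 * (size L2 * size L3))%N.
Proof. by rewrite !size_allpairs. Qed.

Lemma mem_cat3 y L1 L2 L3 : reflect
  (exists y1 y2 y3, [/\ y1 \in L1, y2 \in L2, y3 \in L3 & y = y1 ++ y2 ++ y3])
  (y \in cat3 L1 L2 L3).
Proof.
apply: (iffP allpairsP) => [[[y1 x] /= [h1 /allpairsP[[y2 y3] /= [h2 h3 ->]] ->]]|].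
  by exists y1, y2, y3.
move=> [y1 [y2 [y3 [h1 h2 h3 ->]]]]; exists (y1, y2 ++ y3); split=> //=.
by apply/allpairsP; exists (y2, y3).
Qed.

Lemma is_branch_type p l B : is_branch p l B -> btype B = p.
Proof. by case/is_branchE. Qed.

(** An isomorphism either keeps or crosses the two branches of equal type. Each possibility yields
    the product of the factors of the branches when the shapes match, and both occur exactly when
    the two branches have the same shape, whence the factor 2. *)
Lemma size_isos_mut :
  (forall T p k, is_tree p k T -> forall q j T' a, is_tree q j T' ->
     size (isos a T T') = if (p == q) && (canon_code T == canon_code T') then sym_factor T else 0%N) /\
  (forall B p l, is_branch p l B -> forall q j A a, is_branch q j A ->
     size (isos_above a B A) =
     if (p == q) && (canon_code_above B == canon_code_above A) then sym_factor_above B else 0%N).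
Proof.
apply: tree_branch_ind.
- move=> p k B1 IH1 B2 IH2 B3 IH3 p' k' /is_treeE[-> -> [w1 w2 w3] _] q j [? ? A1 A2 A3] a.
  move=> /is_treeE[-> -> [v1 v2 v3] _] /=; case: (p' =P q) => [pq|] //=.
  rewrite size_map size_cat !size_cat3.
  rewrite (IH1 _ _ w1 _ _ _ _ v1) (IH1 _ _ w1 _ _ _ _ v2) (IH2 _ _ w2 _ _ _ _ v1).
  rewrite (IH2 _ _ w2 _ _ _ _ v2) !(IH3 _ _ w3 _ _ _ _ v3) pq !eqxx /=.
  set b1 := canon_code_above B1; set b2 := canon_code_above B2; set b3 := canon_code_above B3.
  set c1 := canon_code_above A1; set c2 := canon_code_above A2; set c3 := canon_code_above A3.
  rewrite eqSS (inj_eq (pcan_inj choice.pickleK)) !xpair_eqE.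
  (* Two sorted pairs agree exactly when the unordered pairs do. *)
  have -> : [&& minn b1 b2 == minn c1 c2 & maxn b1 b2 == maxn c1 c2] =
    ((b1 == c1) && (b2 == c2)) || ((b1 == c2) && (b2 == c1)) by lia.
  by do ![case: eqP => ? //=]; lia.
- move=> p l p' l' /is_branch_LeafE[-> ->] q j [? ?|? ? T'] a.
    by move=> /is_branch_LeafE[-> ->] /=; case: eqP.
  by move=> /is_branch_CarryE[_ _ _] /=; case: T' => *; rewrite /= andbF.
- move=> p l T IH p' l' /is_branch_CarryE[-> -> wT] q j [? ?|? ? T'] a.
    by move=> _ /=; case: (T) => *; rewrite /= andbF.
  move=> /is_branch_CarryE[-> -> wT'] /=.
  by have := IH _ _ wT _ _ _ (0%N :: a) wT'; case: eqP => //= _ <-; rewrite size_map.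
Qed.

(** The graph of the map is [zip E y]. Only one implication is asked of [child]: for a permutation
    of the edges the converse follows by finiteness, in [mem_automorphisms]. *)
Definition edge_map (E y : seq edge) : Prop :=
  [/\ size E = size y, {in zip E y, forall u, edec u.1 = edec u.2}
    & {in zip E y &, forall u v, child u.1 v.1 -> child u.2 v.2}].

Lemma edge_map_cat E1 E2 y : edge_map (E1 ++ E2) y ->
  exists y1 y2, [/\ y = y1 ++ y2, edge_map E1 y1 & edge_map E2 y2].
Proof.
case=> sz hd hc; exists (take (size E1) y), (drop (size E1) y).
have s1 : size E1 = size (take (size E1) y).
  by rewrite size_takel // -sz size_cat leq_addr.
have s2 : size E2 = size (drop (size E1) y) by rewrite size_drop -sz size_cat addKn.
have z : zip (E1 ++ E2) y = zip E1 (take (size E1) y) ++ zip E2 (drop (size E1) y).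
  by rewrite -zip_cat // cat_take_drop.
rewrite {}z in hd hc; split; rewrite ?cat_take_drop //; split=> //.
- by move=> u hu; apply: hd; rewrite mem_cat hu.
- by move=> u v hu hv; apply: hc; rewrite mem_cat ?hu ?hv.
- by move=> u hu; apply: hd; rewrite mem_cat hu orbT.
- by move=> u v hu hv; apply: hc; rewrite mem_cat ?hu ?hv orbT.
Qed.

Lemma edge_map_cons e E y : edge_map (e :: E) y ->
  exists x y', [/\ y = x :: y', edec e = edec x, edge_map E y'
    & {in zip E y', forall u, child e u.1 -> child x u.2}].
Proof.
case: y => [|x y]; first by case.
case=> -[sz] hd hc; exists x, y; split=> //.
- by apply: (hd (e, x)); rewrite mem_head.
- split=> //; first by move=> u hu; apply: hd; rewrite in_cons hu orbT.
  by move=> u v hu hv; apply: hc; rewrite in_cons ?hu ?hv orbT.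
- by move=> u hu; apply: (hc (e, x)); rewrite in_cons ?eqxx ?hu ?orbT.
Qed.

Lemma mem_zip (e x : edge) E y : (e, x) \in zip E y -> e \in E /\ x \in y.
Proof.
elim: E y => [|e' E IH] [|x' y] //=; rewrite !in_cons => /orP[/eqP[-> ->]|/IH[-> ->]].
  by rewrite !eqxx.
by rewrite !orbT.
Qed.

Lemma mk_edge_map_cat E1 E2 y1 y2 : edge_map E1 y1 -> edge_map E2 y2 ->
  {in E1 & E2, forall e f, ~~ child e f /\ ~~ child f e} ->
  edge_map (E1 ++ E2) (y1 ++ y2).
Proof.
move=> [s1 d1 c1] [s2 d2 c2] h; split; rewrite ?size_cat ?s1 ?s2 // zip_cat //.
  by move=> u; rewrite mem_cat => /orP[/d1|/d2].
move=> [e x] [f z]; rewrite !mem_cat => /orP[]h1 /orP[]h2 /=.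
- exact: (c1 (e, x) (f, z)).
- have [he _] := mem_zip h1; have [hf _] := mem_zip h2.
  by have [/negbTE -> _] := h _ _ he hf.
- have [he _] := mem_zip h1; have [hf _] := mem_zip h2.
  by have [_ /negbTE ->] := h _ _ hf he.
- exact: (c2 (e, x) (f, z)).
Qed.

Lemma childE e f : child e f -> size (addr f) = (size (addr e)).+1.
Proof. by case/andP; case: (addr f) => //= ? ? _ /eqP <-. Qed.

Lemma mk_edge_map_cons e x E y : edec e = edec x -> edge_map E y ->
  {in E, forall f, ~~ child f e} ->
  {in zip E y, forall u, child e u.1 -> child x u.2} ->
  edge_map (e :: E) (x :: y).
Proof.
move=> ed [s d c] h1 h2; have ee : ~~ child e e by apply/negP => /childE; lia.
split=> [|u|[f z] [g w]]; rewrite /= ?s //.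
  by rewrite in_cons => /orP[/eqP ->|/d].
rewrite !in_cons => /orP[/eqP[-> ->]|hu] /orP[/eqP[-> ->]|hv] /=.
- by rewrite (negbTE ee).
- exact: (h2 (g, w)).
- by have [/h1/negbTE -> _] := mem_zip hu.
- exact: (c (f, z) (g, w)).
Qed.

Lemma child_suffix a i e f : seq.suffix (i :: a) (addr e) -> child e f ->
  seq.suffix (i :: a) (addr f).
Proof.
move=> /suffixP[s hs] /andP[]; case: (addr f) => //= n g _ /eqP ->.
by rewrite hs -cat_cons suffix_suffix.
Qed.

Lemma branches_no_child i j a B B' : i != j ->
  {in edges_above (i :: a) B & edges_above (j :: a) B', forall e f, ~~ child e f /\ ~~ child f e}.
Proof.
move=> ij e f /(edges_suffix_mut.2)[he _] /(edges_suffix_mut.2)[hf _].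
split; apply/negP.
  by move/(child_suffix he) => h; case/eqP: ij; apply: suffix_cons_inj h hf.
by move/(child_suffix hf) => h; case/eqP: ij; apply: suffix_cons_inj he h.
Qed.

Lemma branch_no_parent i a B (e : edge) : addr e = a ->
  {in edges_above (i :: a) B, forall f, ~~ child f e}.
Proof.
move=> <- f /(edges_suffix_mut.2)[/size_suffix /= lt _].
by apply/negP => /childE; lia.
Qed.

(** Only the bottom edge of a branch is a child of the edge below it, the addresses of the others
    being too long; the parent relation thus needs to be checked on the image [z] of the bottom edge
    alone. *)
Lemma zip_branch_child i a B (e : edge) x z E y f g :
  addr e = a -> edges_above (i :: a) B = f :: E -> child x z ->
  (g.1, g.2) \in zip (edges_above (i :: a) B) (z :: y) -> child e g.1 -> child x g.2.
Proof.
move=> ae hE cx; rewrite hE /= in_cons => /orP[/eqP[_ ->]//|/mem_zip[h _] /childE s].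
have u := edges_uniq_mut.2 B (i :: a).
have [E' hE'] := edges_above_cons (i :: a) B.
have /(edges_suffix_mut.2)[_ h'] : g.1 \in edges_above (i :: a) B by rewrite hE in_cons h orbT.
move: u; rewrite hE /= => /andP[/negP[]]; move: hE; rewrite hE' => -[<- _].
by rewrite -h' // s ae.
Qed.

(** The last clause, which locates the image of the bottom edge, is what lets the induction check
    the parent relation between the root edge and the branches above it. *)
Lemma isos_sound_mut :
  (forall T p k, is_tree p k T -> forall q j T' a b, is_tree q j T' ->
     {in isos b T T', forall y, [/\ edge_map (edges_from a T) y,
       perm_eq y (edges_from b T') & exists y', y = root_edge b T' :: y']}) /\
  (forall B p l, is_branch p l B -> forall q j A a b, is_branch q j A ->
     {in isos_above b B A, forall y, [/\ edge_map (edges_above a B) y,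
       perm_eq y (edges_above b A) & exists y', y = branch_edge b A :: y']}).
Proof.
apply: tree_branch_ind.
- move=> p k B1 IH1 B2 IH2 B3 IH3 p' k' /is_treeE[-> -> [w1 w2 w3] _] q j [? ? A1 A2 A3] a b.
  move=> /is_treeE[-> -> [v1 v2 v3] _] y /=; case: (p' =P q) => [pq|] //=.
  set r := (a, _, _); set r' := (b, _, _).
  have key i1 i2 A A' y' : is_branch q (bfreq A) A -> is_branch q (bfreq A') A' ->
    y' \in cat3 (isos_above (i1 :: b) B1 A) (isos_above (i2 :: b) B2 A') (isos_above (2%N :: b) B3 A3) ->
    edge_map (r :: edges_above (0%N :: a) B1 ++ edges_above (1%N :: a) B2 ++ edges_above (2%N :: a) B3) (r' :: y')
    /\ perm_eq y' (edges_above (i1 :: b) A ++ edges_above (i2 :: b) A' ++ edges_above (2%N :: b) A3).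
    move=> u1 u2 /mem_cat3[y1 [y2 [y3 [h1 h2 h3 ->]]]].
    have [m1 p1 [z1 e1]] := IH1 _ _ w1 _ _ _ (0%N :: a) _ u1 _ h1.
    have [m2 p2 [z2 e2]] := IH2 _ _ w2 _ _ _ (1%N :: a) _ u2 _ h2.
    have [m3 p3 [z3 e3]] := IH3 _ _ w3 _ _ _ (2%N :: a) _ v3 _ h3.
    have [E1 g1] := edges_above_cons (0%N :: a) B1; have [E2 g2] := edges_above_cons (1%N :: a) B2.
    have [E3 g3] := edges_above_cons (2%N :: a) B3.
    split; last by apply: perm_cat => //; apply: perm_cat.
    apply: mk_edge_map_cons.
    + by rewrite /edec /= pq.
    + apply: mk_edge_map_cat => //; first apply: mk_edge_map_cat => //.
        exact: branches_no_child.
      by move=> e f he; rewrite mem_cat => /orP[] hf; apply: branches_no_child he hf.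
    + by move=> f; rewrite !mem_cat => /or3P[]; apply: branch_no_parent.
    + have cr i A0 : child r' (branch_edge (i :: b) A0) by rewrite /child /= eqxx.
      have [s1 _ _] := m1; have [s2 _ _] := m2; have [s3 _ _] := m3.
      move=> [f z]; rewrite !zip_cat // !mem_cat => /or3P[]; rewrite ?e1 ?e2 ?e3 => h.
      * exact: (zip_branch_child (e := r) (g := (f, z)) erefl g1 (cr _ _) h).
      * exact: (zip_branch_child (e := r) (g := (f, z)) erefl g2 (cr _ _) h).
      * exact: (zip_branch_child (e := r) (g := (f, z)) erefl g3 (cr _ _) h).
  move=> /mapP[y' + ->]; rewrite mem_cat => /orP[/(key _ _ _ _ _ v1 v2)|/(key _ _ _ _ _ v2 v1)] [m pm].
    by split=> //; [rewrite perm_cons | exists y'].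
  split=> //; last by exists y'.
  by rewrite perm_cons (perm_trans pm) // perm_catCA.
- move=> p l p' l' /is_branch_LeafE[-> ->] q j [? ?|? ? T'] a b //=.
  move=> /is_branch_LeafE[-> ->] y /=; case: eqP => // pq; rewrite inE => /eqP ->.
  split=> //; last by eexists.
  split=> // [u|u v]; rewrite !inE => /eqP ->; first by rewrite /edec /= pq.
  by move=> /eqP -> /childE /=; lia.
- move=> p l T IH p' l' /is_branch_CarryE[-> -> wT] q j [? ?|? ? T'] a b //=.
  move=> /is_branch_CarryE[-> -> wT'] y /=; case: eqP => //= pq /mapP[y' h ->].
  have [m pm [z e]] := IH _ _ wT _ _ _ (0%N :: a) _ wT' _ h.
  split; [|by rewrite perm_cons|by eexists].
  have [E g] := edges_from_cons (0%N :: a) T.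
  apply: mk_edge_map_cons => //.
  + by rewrite /edec /= pq.
  + move=> f /(edges_suffix_mut.1)[/size_suffix /= lt _].
    by apply/negP => /childE; rewrite /addr /= in lt *; lia.
  + move=> [f x]; rewrite e g /= in_cons => /orP[/eqP[_ ->] _|].
      by rewrite /child; case: (T') => * /=; rewrite eqxx.
    move=> /mem_zip[hf _] /childE /= s.
    have /(edges_suffix_mut.1)[_ h'] : f \in edges_from (0%N :: a) T by rewrite g in_cons hf orbT.
    by have := edges_uniq_mut.1 T (0%N :: a); rewrite g /= -h' ?hf // s.
Qed.

(** Every edge is reached from the bottom one by steps to a child, and the map preserves such steps;
    hence all images lie above the image of the bottom edge. *)
Lemma edge_map_suffix_mut :
  (forall T a y x c y', edge_map (edges_from a T) y -> y = x :: y' -> addr x = c ->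
     all (fun z => seq.suffix c (addr z)) y) /\
  (forall B a y x c y', edge_map (edges_above a B) y -> y = x :: y' -> addr x = c ->
     all (fun z => seq.suffix c (addr z)) y).
Proof.
have up n c z : seq.suffix (n :: c) (addr z) -> seq.suffix c (addr z).
  by move=> h; apply: suffix_trans h; rewrite -cat1s suffix_suffix.
have step B i a e x y1 : addr e = a ->
    (forall a y x c y', edge_map (edges_above a B) y -> y = x :: y' -> addr x = c ->
     all (fun z => seq.suffix c (addr z)) y) ->
    edge_map (edges_above (i :: a) B) y1 ->
    {in zip (edges_above (i :: a) B) y1, forall u, child e u.1 -> child x u.2} ->
    all (fun z => seq.suffix (addr x) (addr z)) y1.
  move=> ae IH m cx; have [E' hE] := edges_above_cons (i :: a) B.
  have [sz _ _] := m; case: y1 m cx sz => [|z y1] m cx sz //.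
  have /andP[] : child x z.
    apply: (cx (branch_edge (i :: a) B, z)); first by rewrite hE /= mem_head.
    by rewrite /child /= ae eqxx.
  case ez: (addr z) => [|n c] //= _ /eqP ec.
  have := IH _ _ _ (n :: c) _ m erefl ez.
  by rewrite -ec; apply: sub_all => w; apply: up.
apply: tree_branch_ind => [p k B1 IH1 B2 IH2 B3 IH3|p l|p l T IH] a y x c y'.
- move=> /edge_map_cons[x' [y0 [-> _ m cx]]] [<- _] <- /=; rewrite suffix_refl /=.
  have [y1 [y23 [e1 m1 m23]]] := edge_map_cat m.
  have [y2 [y3 [e2 m2 m3]]] := edge_map_cat m23.
  have [s1 _ _] := m1; have [s2 _ _] := m2; have [s3 _ _] := m3.
  rewrite e1 e2 !all_cat; apply/and3P; split.
  + apply: (step _ _ _ (a, (t2, p), k) _ _ (erefl _) IH1 m1) => u hu; apply: cx.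
    by rewrite e1 zip_cat // mem_cat hu.
  + apply: (step _ _ _ (a, (t2, p), k) _ _ (erefl _) IH2 m2) => u hu; apply: cx.
    by rewrite e1 e2 !zip_cat // !mem_cat hu orbT.
  + apply: (step _ _ _ (a, (t2, p), k) _ _ (erefl _) IH3 m3) => u hu; apply: cx.
    by rewrite e1 e2 !zip_cat // !mem_cat hu !orbT.
- move=> /edge_map_cons[x' [y0 [-> _ [sz _ _] _]]] [<- _] <- /=; rewrite suffix_refl.
  by case: y0 sz.
- move=> /(@edge_map_cons _ (edges_from (0%N :: a) T))[x' [y0 [-> _ m cx]]] [<- _] <- /=; rewrite suffix_refl /=.
  have [E' hE] := edges_from_cons (0%N :: a) T.
  have [sz _ _] := m; case: y0 m cx sz => [|z y0] m cx sz //.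
  have /andP[] : child x' z.
    apply: (cx (root_edge (0%N :: a) T, z)); first by rewrite hE /= mem_head.
    by rewrite /child; case: (T) => *; rewrite /= eqxx.
  case ez: (addr z) => [|n d] //= _ /eqP ec.
  have := IH _ _ _ (n :: d) _ m erefl ez.
  by rewrite -ec; apply: sub_all => w; apply: up.
Qed.

(** Edges of different branches are told apart by the suffixes of their addresses, so filtering by
    each suffix splits the permutation into three. *)
Lemma perm_cat3_parts (b : seq nat) (c1 c2 c3 : nat) (y1 y2 y3 E1 E2 E3 : seq edge) :
  uniq [:: c1; c2; c3] ->
  (forall i y, (i, y) \in [:: (c1, y1); (c2, y2); (c3, y3); (c1, E1); (c2, E2); (c3, E3)] ->
     all (fun z => seq.suffix (i :: b) (addr z)) y) ->
  perm_eq (y1 ++ y2 ++ y3) (E1 ++ E2 ++ E3) ->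
  [/\ perm_eq y1 E1, perm_eq y2 E2 & perm_eq y3 E3].
Proof.
move=> u H pe; pose U i (z : edge) := seq.suffix (i :: b) (addr z).
have H0 i j y : j != i -> all (U j) y -> seq.filter (U i) y = [::].
  move=> ij /allP h; apply/eqP; rewrite -(negbK (_ == _)) -has_filter.
  by apply/hasPn => z /h uj; apply/negP => ui; case/eqP: ij; apply: suffix_cons_inj uj ui.
have H1 i y : all (U i) y -> seq.filter (U i) y = y by move=> /all_filterP.
have a1 : all (U c1) y1 by apply: H; rewrite !inE eqxx ?orbT.
have a2 : all (U c2) y2 by apply: H; rewrite !inE eqxx ?orbT.
have a3 : all (U c3) y3 by apply: H; rewrite !inE eqxx ?orbT.
have b1 : all (U c1) E1 by apply: H; rewrite !inE eqxx ?orbT.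
have b2 : all (U c2) E2 by apply: H; rewrite !inE eqxx ?orbT.
have b3 : all (U c3) E3 by apply: H; rewrite !inE eqxx ?orbT.
have [n12 n13 n23] : [/\ c1 != c2, c1 != c3 & c2 != c3].
  by move: u; rewrite /= !inE negb_or andbT => /andP[/andP[-> ->] ->].
have [n21 n31 n32] : [/\ c2 != c1, c3 != c1 & c3 != c2] by split; rewrite eq_sym.
split.
- have := perm_filter (U c1) pe; rewrite !filter_cat.
  by rewrite (H0 _ _ _ n21 a2) (H0 _ _ _ n21 b2) (H0 _ _ _ n31 a3) (H0 _ _ _ n31 b3) (H1 _ _ a1) (H1 _ _ b1) !cats0.
- have := perm_filter (U c2) pe; rewrite !filter_cat.
  by rewrite (H0 _ _ _ n12 a1) (H0 _ _ _ n12 b1) (H0 _ _ _ n32 a3) (H0 _ _ _ n32 b3) (H1 _ _ a2) (H1 _ _ b2) !cats0.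
- have := perm_filter (U c3) pe; rewrite !filter_cat.
  by rewrite (H0 _ _ _ n13 a1) (H0 _ _ _ n13 b1) (H0 _ _ _ n23 a2) (H0 _ _ _ n23 b2) (H1 _ _ a3) (H1 _ _ b3).
Qed.

Lemma child_root_branch i b A (e z : edge) : addr e = b -> z \in edges_above (i :: b) A ->
  child e z -> z = branch_edge (i :: b) A.
Proof.
by move=> ae /(edges_suffix_mut.2)[_ h] /childE s; apply: h; rewrite s ae.
Qed.

(** The three edges just above the root go to the three edges just above the image of the root.
    Decorations leave only the kept and the crossed position, and each branch must then be sent onto
    the branch whose bottom edge is the image of its own. *)
Lemma isos_complete_mut :
  (forall T p k, is_tree p k T -> forall q j T' a b y y', is_tree q j T' ->
     edge_map (edges_from a T) y -> perm_eq y (edges_from b T') ->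
     y = root_edge b T' :: y' -> y \in isos b T T') /\
  (forall B p l, is_branch p l B -> forall q j A a b y y', is_branch q j A ->
     edge_map (edges_above a B) y -> perm_eq y (edges_above b A) ->
     y = branch_edge b A :: y' -> y \in isos_above b B A).
Proof.
apply: tree_branch_ind.
- move=> p k B1 IH1 B2 IH2 B3 IH3 p' k' /is_treeE[-> -> [w1 w2 w3] _] q j [? ? A1 A2 A3] a b y y'.
  move=> /is_treeE[-> -> [v1 v2 v3] _].
  move=> /(@edge_map_cons _ (edges_above (0%N :: a) B1 ++ edges_above (1%N :: a) B2
    ++ edges_above (2%N :: a) B3))[x [y0 [-> dx m cx]]] pe [xr _].
  rewrite {}xr in dx pe cx *; set r := (b, _, _) in dx pe cx *.
  have pq : p' = q by move: dx => -[].
  rewrite [isos _ _ _]/= pq eqxx; apply/map_f.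
  move: pe; rewrite [edges_from _ _]/= perm_cons => pe.
  have uy : uniq y0.
    rewrite (perm_uniq pe).
    by have /= /andP[_] := edges_uniq_mut.1 (Tree q j A1 A2 A3) b.
  have [y1 [y23 [e1 m1 m23]]] := edge_map_cat m.
  have [y2 [y3 [e2 m2 m3]]] := edge_map_cat m23; subst y0 y23.
  have [s1 _ _] := m1; have [s2 _ _] := m2; have [s3 _ _] := m3.
  have [E1 g1] := edges_above_cons (0%N :: a) B1; have [E2 g2] := edges_above_cons (1%N :: a) B2.
  have [E3 g3] := edges_above_cons (2%N :: a) B3.
  case: y1 m1 s1 pe uy m cx => [|z1 y1] m1 s1 pe uy m cx; first by rewrite g1 in s1.
  case: y2 m2 s2 pe uy m m23 cx => [|z2 y2] m2 s2 pe uy m m23 cx; first by rewrite g2 in s2.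
  case: y3 m3 s3 pe uy m m23 cx => [|z3 y3] m3 s3 pe uy m m23 cx; first by rewrite g3 in s3.
  rewrite !zip_cat // in cx.
  have c1 : child r z1.
    apply: (cx (branch_edge (0%N :: a) B1, z1)); first by rewrite g1 /= mem_head.
    by rewrite /child /= eqxx.
  have c2 : child r z2.
    apply: (cx (branch_edge (1%N :: a) B2, z2)); first by rewrite g2 !mem_cat /= mem_head !orbT.
    by rewrite /child /= eqxx.
  have c3 : child r z3.
    apply: (cx (branch_edge (2%N :: a) B3, z3)); first by rewrite g3 !mem_cat /= mem_head !orbT.
    by rewrite /child /= eqxx.
  have d1 : edec z1 = (t1, q).
    have [_ h _] := m1; rewrite -pq -(is_branch_type w1); symmetry.
    by apply: (h (branch_edge (0%N :: a) B1, z1)); rewrite g1 /= mem_head.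
  have d2 : edec z2 = (t1, q).
    have [_ h _] := m2; rewrite -pq -(is_branch_type w2); symmetry.
    by apply: (h (branch_edge (1%N :: a) B2, z2)); rewrite g2 /= mem_head.
  have d3 : edec z3 = (t1, ~~ q).
    have [_ h _] := m3; rewrite -pq -(is_branch_type w3); symmetry.
    by apply: (h (branch_edge (2%N :: a) B3, z3)); rewrite g3 /= mem_head.
  have H z : z \in (z1 :: y1) ++ (z2 :: y2) ++ (z3 :: y3) -> child r z ->
     [\/ z = branch_edge (0%N :: b) A1, z = branch_edge (1%N :: b) A2
       | z = branch_edge (2%N :: b) A3].
    rewrite (perm_mem pe) !mem_cat => /or3P[] h c.
    - by constructor 1; apply: child_root_branch h c.
    - by constructor 2; apply: child_root_branch h c.
    - by constructor 3; apply: child_root_branch h c.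
  have H1 := H z1 (ltac:(by rewrite mem_cat mem_head)) c1.
  have H2 := H z2 (ltac:(by rewrite !mem_cat mem_head !orbT)) c2.
  have H3 := H z3 (ltac:(by rewrite !mem_cat mem_head !orbT)) c3.
  have t1A := is_branch_type v1; have t2A := is_branch_type v2; have t3A := is_branch_type v3.
  (* The third branch is the only one of the opposite type, so its position is forced. *)
  have {H3} e3 : z3 = branch_edge (2%N :: b) A3.
    by case: H3 d3 => // ->; rewrite /edec /= ?t1A ?t2A => -[]; case: (q).
  have {}H1 : z1 = branch_edge (0%N :: b) A1 \/ z1 = branch_edge (1%N :: b) A2.
    by case: H1 d1 => [->|->|->]; [left|right|]; rewrite // /edec /= t3A => -[]; case: (q).
  have {}H2 : z2 = branch_edge (0%N :: b) A1 \/ z2 = branch_edge (1%N :: b) A2.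
    by case: H2 d2 => [->|->|->]; [left|right|]; rewrite // /edec /= t3A => -[]; case: (q).
  have n12 : z1 <> z2.
    by move=> e12; move: uy; rewrite e12 /= mem_cat mem_head orbT.
  have su := edge_map_suffix_mut.2.
  have sE i A : all (fun z => seq.suffix (i :: b) (addr z)) (edges_above (i :: b) A).
    by apply/allP => z /(edges_suffix_mut.2)[].
  rewrite mem_cat; apply/orP.
  case: H1 H2 n12 => e1 [] e2 n12; rewrite ?e1 ?e2 // in n12 *.
  + left; apply/mem_cat3; rewrite -e1 -e2 e3.
    have HU i Y : (i, Y) \in [:: (0%N, z1 :: y1); (1%N, z2 :: y2); (2%N, z3 :: y3);
        (0%N, edges_above (0%N :: b) A1); (1%N, edges_above (1%N :: b) A2); (2%N, edges_above (2%N :: b) A3)] ->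
        all (fun z => seq.suffix (i :: b) (addr z)) Y.
      rewrite !inE => /orP[/eqP[-> ->]|/orP[/eqP[-> ->]|/orP[/eqP[-> ->]|/orP[/eqP[-> ->]|/orP[/eqP[-> ->]|/eqP[-> ->]]]]]] //.
      - by apply: su m1 erefl _; rewrite e1.
      - by apply: su m2 erefl _; rewrite e2.
      - by apply: su m3 erefl _; rewrite e3.
    have [p1 p2 p3] := @perm_cat3_parts b 0%N 1%N 2%N _ _ _ _ _ _ isT HU pe.
    exists (z1 :: y1), (z2 :: y2), (z3 :: y3); split; rewrite -?e3 //.
    * by apply: IH1 w1 _ _ _ _ _ _ _ v1 m1 p1 _; rewrite e1.
    * by apply: IH2 w2 _ _ _ _ _ _ _ v2 m2 p2 _; rewrite e2.
    * by apply: IH3 w3 _ _ _ _ _ _ _ v3 m3 p3 _; rewrite e3.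
  + right; apply/mem_cat3; rewrite -e1 -e2 e3.
    have pe' : perm_eq ((z1 :: y1) ++ (z2 :: y2) ++ z3 :: y3)
      (edges_above (1%N :: b) A2 ++ edges_above (0%N :: b) A1 ++ edges_above (2%N :: b) A3).
      by rewrite (perm_trans pe) // perm_catCA.
    have HU i Y : (i, Y) \in [:: (1%N, z1 :: y1); (0%N, z2 :: y2); (2%N, z3 :: y3);
        (1%N, edges_above (1%N :: b) A2); (0%N, edges_above (0%N :: b) A1); (2%N, edges_above (2%N :: b) A3)] ->
        all (fun z => seq.suffix (i :: b) (addr z)) Y.
      rewrite !inE => /orP[/eqP[-> ->]|/orP[/eqP[-> ->]|/orP[/eqP[-> ->]|/orP[/eqP[-> ->]|/orP[/eqP[-> ->]|/eqP[-> ->]]]]]] //.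
      - by apply: su m1 erefl _; rewrite e1.
      - by apply: su m2 erefl _; rewrite e2.
      - by apply: su m3 erefl _; rewrite e3.
    have [p1 p2 p3] := @perm_cat3_parts b 1%N 0%N 2%N _ _ _ _ _ _ isT HU pe'.
    exists (z1 :: y1), (z2 :: y2), (z3 :: y3); split; rewrite -?e3 //.
    * by apply: IH1 w1 _ _ _ _ _ _ _ v2 m1 p1 _; rewrite e1.
    * by apply: IH2 w2 _ _ _ _ _ _ _ v1 m2 p2 _; rewrite e2.
    * by apply: IH3 w3 _ _ _ _ _ _ _ v3 m3 p3 _; rewrite e3.
- move=> p l p' l' /is_branch_LeafE[-> ->] q j A a b y y' vA [sz d _] pe yE.
  case: y yE pe sz d => [|x [|? ?]] // [-> _] /perm_size.
  case: A vA => [? ?|? ? [? ? ? ? ?]] // /is_branch_LeafE[-> ->] _ _ d.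
  have := d (a, (t1, p'), l', branch_edge b (Leaf q j)); rewrite inE eqxx => /(_ isT)[/= ->].
  by rewrite eqxx inE.
- move=> p l T IH p' l' /is_branch_CarryE[-> -> wT] q j A a b y y' vA.
  move=> /(@edge_map_cons _ (edges_from (0%N :: a) T))[x [y0 [-> dx m cx]]] pe [xr _].
  have [E hE] := edges_from_cons (0%N :: a) T.
  rewrite {}xr in dx pe cx *.
  have [sz _ _] := m; rewrite hE in sz.
  case: A vA pe dx cx => [? ?|? ? T'].
    by move=> _ /perm_size /= -[s0]; rewrite -sz in s0.
  move=> /is_branch_CarryE[-> -> vT] pe dx cx.
  move: pe; rewrite [edges_above _ _]/= perm_cons => pe.
  have pq : p' = q by move: dx => -[].
  rewrite [isos_above _ _ _]/= pq eqxx; apply/map_f.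
  case: y0 m sz pe cx => [|z y0] m sz pe cx //.
  have cz : child (branch_edge b (Carry q j T')) z.
    apply: (cx (root_edge (0%N :: a) T, z)); first by rewrite hE /= mem_head.
    by rewrite /child; case: (T) => *; rewrite /= eqxx.
  apply: (IH _ _ wT _ _ _ _ _ _ y0 vT m pe); congr (_ :: _).
  have /(edges_suffix_mut.1)[_ h] : z \in edges_from (0%N :: b) T' by rewrite -(perm_mem pe) mem_head.
  by apply: h; rewrite (childE cz).
Qed.

Lemma uniq_cat_pairs (L1 L2 : seq (seq edge)) n :
  uniq L1 -> uniq L2 -> {in L1, forall y, size y = n} ->
  uniq [seq x1 ++ x2 | x1 <- L1, x2 <- L2].
Proof.
move=> u1 u2 sz; apply: allpairs_uniq => // -[x1 x2] [y1 y2].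
move=> /allpairsP[[a1 a2] /= [h1 _ [-> ->]]] /allpairsP[[b1 b2] /= [g1 _ [-> ->]]] e.
have : (a1 == b1) && (a2 == b2) by rewrite -eqseq_cat ?sz // e.
by case/andP => /eqP -> /eqP ->.
Qed.

Lemma uniq_cat3 L1 L2 L3 n1 n2 : uniq L1 -> uniq L2 -> uniq L3 ->
  {in L1, forall y, size y = n1} -> {in L2, forall y, size y = n2} -> uniq (cat3 L1 L2 L3).
Proof. by move=> u1 u2 u3 s1 s2; apply: (@uniq_cat_pairs _ _ n1) => //; apply: (@uniq_cat_pairs _ _ n2). Qed.

Lemma uniq_isos_mut :
  (forall T p k, is_tree p k T -> forall q j T' b, is_tree q j T' -> uniq (isos b T T')) /\
  (forall B p l, is_branch p l B -> forall q j A b, is_branch q j A -> uniq (isos_above b B A)).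
Proof.
apply: tree_branch_ind.
- move=> p k B1 IH1 B2 IH2 B3 IH3 p' k' /is_treeE[-> -> [w1 w2 w3] _] q j [? ? A1 A2 A3] b.
  move=> /is_treeE[-> -> [v1 v2 v3] _] /=; case: eqP => // _.
  rewrite map_inj_uniq; last by move=> ? ? [].
  have S B c A l p0 l0 q0 : is_branch p0 l0 B -> is_branch q0 l A ->
      {in isos_above c B A, forall y, size y = size (edges_above [::] B)}.
    by move=> w v y h; have [[<- _ _] _ _] := isos_sound_mut.2 _ _ _ w _ _ _ [::] _ v _ h.
  rewrite cat_uniq; apply/and3P; split.
  + by apply: uniq_cat3 (S _ _ _ _ _ _ _ w1 v1) (S _ _ _ _ _ _ _ w2 v2);
      [apply: IH1 w1 _ _ _ _ v1|apply: IH2 w2 _ _ _ _ v2|apply: IH3 w3 _ _ _ _ v3].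
  (* The kept and the crossed families are disjoint: the bottom edge of [B1] has its image at the
     address [0 :: b] in one and [1 :: b] in the other. *)
  + apply/hasPn => y /mem_cat3[y1 [y2 [y3 [h1 _ _ ->]]]]; apply/negP.
    move=> /mem_cat3[z1 [z2 [z3 [g1 _ _ e]]]].
    have [_ _ [y1' e1]] := isos_sound_mut.2 _ _ _ w1 _ _ _ [::] _ v2 _ h1.
    have [_ _ [z1' e2]] := isos_sound_mut.2 _ _ _ w1 _ _ _ [::] _ v1 _ g1.
    by move: e; rewrite e1 e2.
  + by apply: uniq_cat3 (S _ _ _ _ _ _ _ w1 v2) (S _ _ _ _ _ _ _ w2 v1);
      [apply: IH1 w1 _ _ _ _ v2|apply: IH2 w2 _ _ _ _ v1|apply: IH3 w3 _ _ _ _ v3].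
- move=> p l ? ? _ q j [? ?|? ? T'] b _ //=; by case: eqP.
- move=> p l T IH ? ? /is_branch_CarryE[-> -> wT] q j [? ?|? ? T'] b //.
  move=> /is_branch_CarryE[-> -> wT'] /=; case: eqP => // _.
  by rewrite map_inj_uniq; [apply: IH wT _ _ _ _ wT'|move=> ? ? []].
Qed.

(** * Automorphisms as permutations of edges *)

Lemma nth_edge_inj T : injective (@nth_edge T).
Proof.
move=> i j; rewrite /nth_edge => /eqP.
rewrite !(tnth_nth (nth_edge i)) /= nth_uniq ?edges_uniq_mut.1 //.
by move/eqP/val_inj.
Qed.

Lemma edgesE T : edges T = [seq nth_edge i | i <- enum 'I_(size (edges T))].
Proof. by rewrite /nth_edge map_tnth_enum. Qed.

Definition image_edges T (s : 'S_(size (edges T))) : seq edge :=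
  [seq nth_edge (s i) | i <- enum 'I_(size (edges T))].

Lemma zip_image_edges T (s : 'S_(size (edges T))) :
  zip (edges T) (image_edges s) =
  [seq (nth_edge i, nth_edge (s i)) | i <- enum 'I_(size (edges T))].
Proof. by rewrite {1}edgesE /image_edges zip_map -zip_map. Qed.

Lemma edge_map_imageP T (s : 'S_(size (edges T))) :
  edge_map (edges T) (image_edges s) <->
  (forall i, edec (nth_edge i) = edec (nth_edge (s i))) /\
  (forall i j, child (nth_edge i) (nth_edge j) -> child (nth_edge (s i)) (nth_edge (s j))).
Proof.
have m i : (nth_edge i, nth_edge (s i)) \in zip (edges T) (image_edges s).
  by rewrite zip_image_edges map_f // mem_enum.
split=> [[_ d c]|[d c]].
  by split=> [i|i j]; [exact: d (m i)|exact: c (m i) (m j)].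
split; first by rewrite size_map size_enum_ord.
- by move=> u; rewrite zip_image_edges => /mapP[i _ ->]; apply: d.
- by move=> u v; rewrite zip_image_edges => /mapP[i _ ->] /mapP[j _ ->]; apply: c.
Qed.

Lemma image_edges_perm T (s : 'S_(size (edges T))) : perm_eq (image_edges s) (edges T).
Proof.
rewrite [X in perm_eq _ X]edgesE /image_edges -[X in perm_eq X _]/(map (@nth_edge T \o s) _) map_comp.
apply: perm_map; apply: uniq_perm; rewrite ?enum_uniq //.
  rewrite map_inj_uniq ?enum_uniq //; exact: perm_inj.
move=> i; rewrite mem_enum; apply/mapP; exists (s^-1%g i); rewrite ?mem_enum //.
by rewrite permKV.
Qed.

Lemma perm_image_edges T y : perm_eq y (edges T) -> exists s : 'S_(size (edges T)), y = image_edges s.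
Proof.
move=> pe; have /tuple_permP[s ->] : perm_eq y (in_tuple (edges T)) := pe; exists s.
by apply: eq_map => i; rewrite /nth_edge.
Qed.

Lemma mem_automorphisms T (s : 'S_(size (edges T))) :
  s \in automorphisms T <-> edge_map (edges T) (image_edges s).
Proof.
rewrite edge_map_imageP inE; split.
  move=> /andP[/forallP d /forallP c]; split=> [i|i j h]; first exact/esym/eqP/d.
  by move: (c i) => /forallP/(_ j)/eqP ->.
move=> [d c]; apply/andP; split; apply/forallP => i; first exact/eqP/esym/d.
apply/forallP => j; apply/eqP; apply/idP/idP; last exact: c.
(* The permutation sends the finite set of parent-child pairs injectively into itself, hence onto
   itself; this is the converse implication. *)
pose D : {set 'I_(size (edges T)) * 'I_(size (edges T))} :=
  [set u | child (nth_edge u.1) (nth_edge u.2)]%SET.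
pose g (u : 'I_(size (edges T)) * 'I_(size (edges T))) := (s u.1, s u.2).
have gi : injective g by move=> [a b] [a' b'] [/perm_inj -> /perm_inj ->].
have sD : (g @: D)%SET = D.
  apply/eqP; rewrite eqEcard card_imset // leqnn andbT.
  by apply/fintype.subsetP => _ /imsetP[u + ->]; rewrite !inE; apply: c.
move=> h; have : g (i, j) \in D by rewrite inE.
by rewrite -sD mem_imset // inE.
Qed.

(** An automorphism, written as the list of the images of the edges, is a member of [isos [::] T T],
    and conversely. The point to settle is that an automorphism fixes the root edge, since [isos]
    only lists such maps. *)
Lemma Saut_sym_factor p k T : is_tree p k T -> Saut T = sym_factor T.
Proof.
move=> wT; have := size_isos_mut.1 _ _ _ wT _ _ _ [::] wT; rewrite !eqxx /= => <-.
rewrite /Saut cardE -(size_map (@image_edges T)).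
apply/perm_size/uniq_perm.
- rewrite map_inj_uniq ?enum_uniq // => s s' e; apply/permP => i.
  have /eq_in_map/(_ i) := e; rewrite mem_enum => /(_ isT).
  exact: nth_edge_inj.
- exact: (uniq_isos_mut.1 _ _ _ wT _ _ _ _ wT).
move=> y; apply/mapP/idP => [[s]|hy].
  rewrite mem_enum => /mem_automorphisms m ->.
  have [_ _ c] := m.
  have [E hE] := edges_from_cons [::] T.
  have pe := image_edges_perm s.
  case ey : (image_edges s) => [|z y'].
    by have := perm_size pe; rewrite ey /edges hE.
  rewrite -ey; apply: (isos_complete_mut.1 _ _ _ wT _ _ _ _ _ _ y' wT m pe).
  rewrite ey; congr (_ :: _).
  have zE : z \in edges_from [::] T by rewrite -(perm_mem pe) ey mem_head.
  apply: contrapT => zr.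
  (* If the edge sent to the root edge were another edge, it would have a parent, and the image of
     this parent would be a parent of the root edge, whose address is empty. *)
  have rI : root_edge [::] T \in image_edges s by rewrite (perm_mem pe) /edges hE mem_head.
  have /mapP[i _ ri] := rI.
  have ir : nth_edge i <> root_edge [::] T.
    move=> e; apply: zr; move: ey.
    have : image_edges s = [seq nth_edge (s i) | i <- enum 'I_(size (edges T))] by [].
    have e0 : ohead [seq nth_edge i | i <- enum 'I_(size (edges T))] = Some (root_edge [::] T).
      by rewrite -edgesE /edges hE.
    case: (enum _) e0 => //= i0 I [e0] -> [<- _].
    by rewrite ri; congr (nth_edge (s _)); apply: nth_edge_inj; rewrite e0 e.
  have iE : nth_edge i \in edges_from [::] T by rewrite -/(edges T) edgesE map_f // mem_enum.
  have [f + cf] := parent_edge_mut.1 _ _ _ iE ir.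
  rewrite -/(edges T) edgesE => /mapP[j _ fj]; rewrite fj in cf.
  have [_ h] := (edge_map_imageP s).1 m.
  have := h _ _ cf; rewrite -ri => /childE.
  have ar T0 : addr (root_edge [::] T0) = [::] by case: T0.
  by rewrite ar.
have [m pe _] := isos_sound_mut.1 _ _ _ wT _ _ _ [::] _ wT _ hy.
have [s es] := perm_image_edges pe; exists s => //.
by rewrite mem_enum; apply/mem_automorphisms; rewrite -es.
Qed.

Local Open Scope classical_set_scope.

(** * Words *)

Lemma sum_edges_addr_mut (f : etype * bool -> int -> int) :
  (forall T a b, \sum_(e <- edges_from a T) f (edec e) (efreq e) =
     \sum_(e <- edges_from b T) f (edec e) (efreq e)) /\
  (forall B a b, \sum_(e <- edges_above a B) f (edec e) (efreq e) =
     \sum_(e <- edges_above b B) f (edec e) (efreq e)).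
Proof.
apply: tree_branch_ind => [p k B1 IH1 B2 IH2 B3 IH3|p l|p l T IH] a b.
- rewrite [edges_from a _]/= [edges_from b _]/= !big_cons !big_cat /=.
  by rewrite (IH1 _ (0%N :: b)) (IH2 _ (1%N :: b)) (IH3 _ (2%N :: b)).
- by rewrite !big_seq1.
- by rewrite [edges_above a _]/= [edges_above b _]/= !big_cons /= (IH _ (0%N :: b)).
Qed.

Lemma scF_Tree p k B1 B2 B3 : scF (Tree p k B1 B2 B3) = P (t2, p) k +
  (\sum_(e <- edges_above [::] B1) P (edec e) (efreq e)
   + (\sum_(e <- edges_above [::] B2) P (edec e) (efreq e)
      + \sum_(e <- edges_above [::] B3) P (edec e) (efreq e))).
Proof.
rewrite /scF /edges [edges_from _ _]/= big_cons !big_cat /=.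
by congr (_ + (_ + (_ + _))); exact: (sum_edges_addr_mut P).2.
Qed.

Lemma scF_norm_letter T : scF (norm_letter T) = scF T.
Proof.
case: T => p k B1 B2 B3; rewrite /norm_letter; case: ifP => // _.
by rewrite !scF_Tree [X in _ + X]addrCA.
Qed.

Lemma scF_orb_mut :
  (forall T T', T' \in orb T -> scF T' = scF T) /\
  (forall B B', B' \in orb_above B -> \sum_(e <- edges_above [::] B') P (edec e) (efreq e) =
     \sum_(e <- edges_above [::] B) P (edec e) (efreq e)).
Proof.
apply: tree_branch_ind.
- move=> p k B1 IH1 B2 IH2 B3 IH3 T' /mem_orb[x1 [x2 [x3 [h1 h2 h3]]]].
  by case=> ->; rewrite !scF_Tree (IH1 _ h1) (IH2 _ h2) (IH3 _ h3) // [X in _ + X]addrCA.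
- by move=> p l B'; rewrite inE => /eqP ->.
- move=> p l T IH B' /mapP[T' /IH e ->]; rewrite /= !big_cons; congr (_ + _).
  have [h _] := sum_edges_addr_mut P.
  by rewrite (h _ _ [::]) [RHS](h _ _ [::]).
Qed.

Lemma resonant_norm_letter T : resonant (norm_letter T) = resonant T.
Proof.
case: T => p k B1 B2 B3; rewrite /norm_letter; case: ifP => // _.
exact: (congr1 (fun d => d.1.1.2) (swap_dataC p k B1 B2 B3)).
Qed.

Lemma scFw_cons L w : scFw (L :: w) = scF L + scFw w.
Proof. exact: big_cons. Qed.

Lemma scFw_nil : scFw [::] = 0.
Proof. exact: big_nil. Qed.

Lemma arb_neq_nil T w : w \in arb T -> w != [::].
Proof. by case: T => p k B1 B2 B3 /mapP[u _ ->]; case: u. Qed.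

Section Words.
Variable R : realType.
Local Notation C := R[i].
Implicit Types (N t : R) (w : word).

Lemma scFw_norm w : scFw (map norm_letter w) = scFw w.
Proof. by elim: w => //= L w IH; rewrite !scFw_cons IH scF_norm_letter. Qed.

Lemma condA_norm N w : condA N (map norm_letter w) = condA N w.
Proof. by rewrite /condA scFw_norm. Qed.

Lemma fexpD a b t : fexp (a + b) t = fexp a t * fexp b t :> C.
Proof.
rewrite /fexp /cexp intrD mulrDl cosD sinD; apply/eqP; rewrite eq_complex /=.
by rewrite [sin _ * cos _]mulrC [X in _ && (_ == X)]addrC !eqxx.
Qed.

Lemma fexp0 t : fexp 0 t = 1 :> C.
Proof. by rewrite /fexp /cexp mul0r cos0 sin0. Qed.

Lemma forall_ord_iota n (a : pred nat) : [forall q : 'I_n, a q] = all a (iota 0 n).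
Proof.
apply/forallP/allP => [h q|h q]; last by apply: h; rewrite mem_iota /=.
by rewrite mem_iota /= add0n => qn; exact: h (Ordinal qn).
Qed.

Lemma suffix_cons_word L w q : (q <= size w)%N -> Defs.suffix q (L :: w) = Defs.suffix q w.
Proof. by move=> qw; rewrite /Defs.suffix /= subSn. Qed.

Lemma suffix_full w : Defs.suffix (size w) w = w.
Proof. by rewrite /Defs.suffix subnn drop0. Qed.

(** Among the suffixes of [L :: w] only the whole word is new: it contributes one condition, one
    exponential and one denominator. *)
Lemma Psi_cons N L w t : Psi N (L :: w) t =
  if condA N (L :: w) then 0
  else fexp (scF L) t * Psi N w t / (scFw (L :: w))%:~R.
Proof.
rewrite /Psi !(forall_ord_iota _ (fun q => ~~ condA N (Defs.suffix q.+1 _))) [size _]/=.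
rewrite -addn1 iotaD all_cat /= andbT add0n -[(size w).+1]/(size (L :: w)) suffix_full.
have -> : all (fun q => ~~ condA N (Defs.suffix q.+1 (L :: w))) (iota 0 (size w)) =
   all (fun q => ~~ condA N (Defs.suffix q.+1 w)) (iota 0 (size w)).
  by apply: eq_in_all => q; rewrite mem_iota /= add0n => qw; rewrite suffix_cons_word.
case: (condA N (L :: w)); rewrite ?andbF // andbT.
case: ifP => _; last by rewrite mulr0 mul0r.
rewrite addn1 big_nat_recr //= -[(size w).+1]/(size (L :: w)) suffix_full.
rewrite (eq_big_nat _ _ (F2 := fun q => (scFw (Defs.suffix q w))%:~R)); last first.
  by move=> q /andP[_ qw]; rewrite suffix_cons_word.
by rewrite scFw_cons fexpD invfM !mulrA.
Qed.

Lemma Psi_norm N w t : Psi N (map norm_letter w) t = Psi N w t.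
Proof.
elim: w => //= L w IH; rewrite !Psi_cons -map_cons condA_norm scFw_norm.
by rewrite scF_norm_letter IH.
Qed.

Lemma hatPsi_num_norm N w t : hatPsi_num N (map norm_letter w) t = hatPsi_num N w t.
Proof. by case: w => //= L w; rewrite scF_norm_letter Psi_norm. Qed.

Lemma res_first_norm w : res_first (map norm_letter w) = res_first w.
Proof. by case: w => //= L w; exact: resonant_norm_letter. Qed.

(** Since [scFw w] is [scF T], the prefactor cancels the denominator; when both vanish, the
    cancellation is part of the definition of [scF_hatPsi]. *)
Lemma scF_hatPsi_arb N T w t : w \in arb T -> scF_hatPsi N T w t = hatPsi_num N w t.
Proof.
move=> /scFw_arb e; rewrite /scF_hatPsi e andbb; case: ifP => // /negbT nz.
by rewrite /hatPsi e mulrC mulfVK // intr_eq0.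
Qed.

(** With [0 <= N] a vanishing phase sum satisfies A, so outside A the denominator does not
    vanish. *)
Lemma condA0 N w : 0 <= N -> ~~ condA N w -> scFw w != 0.
Proof. by move=> N0; apply: contraNneq => e; rewrite /condA e normr0. Qed.

Lemma scF_hatPsi_Psi N T w t : 0 <= N -> w \in arb T -> ~~ condA N w ->
  scF_hatPsi N T w t = (scF T)%:~R * Psi N w t.
Proof.
move=> N0 wT nA; have nz := condA0 N0 nA; rewrite scF_hatPsi_arb // -(scFw_arb wT).
case: w wT nA nz => [/arb_neq_nil//|L w] _ nA nz.
by rewrite Psi_cons (negbTE nA) [RHS]mulrC mulfVK // intr_eq0.
Qed.

Lemma Psi_condA N w t : w != [::] -> condA N w -> Psi N w t = 0.
Proof. by case: w => // L w _ A; rewrite Psi_cons A. Qed.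

(** Outside A the coefficients [hatPsi] and [Psi] agree; inside A the coefficient [Psi] is zero,
    because the whole word is one of the suffixes that it tests. *)
Lemma sum_arb_condA N T t : 0 <= N ->
  \sum_(w <- arb T) 'i * scF_hatPsi N T w t =
  \sum_(w <- arb T | condA N w) 'i * scF_hatPsi N T w t
  + 'i * (scF T)%:~R * \sum_(w <- arb T) Psi N w t.
Proof.
move=> N0; rewrite (bigID (condA N)) /=; congr (_ + _).
rewrite [in RHS](bigID (condA N)) /= [X in _ * (X + _)]big1_seq ?add0r; last first.
  by move=> w /andP[A /arb_neq_nil nn]; rewrite Psi_condA.
rewrite big_distrr big_seq_cond [RHS]big_seq_cond; apply: eq_bigr => w /andP[wT nA].
by rewrite scF_hatPsi_Psi // mulrA.
Qed.

(** * Time derivatives of the coefficients *)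

Definition has_cderiv (f : R -> C) t (d : C) : Prop :=
  is_derive t (1 : R) (fun s => complex.Re (f s)) (complex.Re d) /\
  is_derive t (1 : R) (fun s => complex.Im (f s)) (complex.Im d).

Lemma has_cderivE f t d : has_cderiv f t d -> cderiv f t = d.
Proof.
by move=> [[_ h1] [_ h2]]; rewrite /cderiv !derive1E h1 h2; case: (d).
Qed.

Lemma has_cderivD f g t d e : has_cderiv f t d -> has_cderiv g t e ->
  has_cderiv (fun s => f s + g s) t (d + e).
Proof.
move=> [f1 f2] [g1 g2]; split.
  have -> : (fun s => complex.Re (f s + g s)) = (fun s => complex.Re (f s)) + (fun s => complex.Re (g s)).
    by apply/funext => s; rewrite raddfD.
  rewrite raddfD; exact: is_deriveD.
have -> : (fun s => complex.Im (f s + g s)) = (fun s => complex.Im (f s)) + (fun s => complex.Im (g s)).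
  by apply/funext => s; rewrite raddfD.
rewrite raddfD; exact: is_deriveD.
Qed.

Lemma has_cderiv0 t : has_cderiv (fun=> 0) t 0.
Proof. by split; exact: is_derive_cst. Qed.

Lemma has_cderiv_sum (I : Type) (r : seq I) (f : I -> R -> C) t (d : I -> C) :
  (forall i, has_cderiv (f i) t (d i)) ->
  has_cderiv (fun s => \sum_(i <- r) f i s) t (\sum_(i <- r) d i).
Proof.
move=> h; elim: r => [|i r IH].
  by rewrite big_nil; under eq_fun do rewrite big_nil; exact: has_cderiv0.
by rewrite big_cons; under eq_fun do rewrite big_cons; exact: has_cderivD.
Qed.

Lemma has_cderiv_fexp (c : C) a t :
  has_cderiv (fun s => c * fexp a s) t (c * ('i * a%:~R * fexp a t)).
Proof.
have aC : (a%:~R : C) = ((a%:~R : R) +i* 0)%C by rewrite -(rmorph_int (real_complex R)).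
have dl : is_derive t (1 : R) (fun s => a%:~R * s) (a%:~R : R).
  have := is_deriveZ (a%:~R : R) (is_derive_id t (1 : R)).
  by rewrite /GRing.scale /= mulr1.
have dc : is_derive t (1 : R) (fun s => cos (a%:~R * s)) (- sin (a%:~R * t) * a%:~R).
  exact: (is_derive1_comp (is_derive_cos _) dl).
have ds : is_derive t (1 : R) (fun s => sin (a%:~R * s)) (cos (a%:~R * t) * a%:~R).
  exact: (is_derive1_comp (is_derive_sin _) dl).
rewrite aC; case: c => u v; rewrite /fexp /cexp; split => /=.
  have h := is_deriveB (is_deriveZ u dc) (is_deriveZ v ds).
  apply: (is_derive_eq h).
  by rewrite /GRing.scale /=; ring.
have h := is_deriveD (is_deriveZ u ds) (is_deriveZ v dc).
apply: (is_derive_eq h).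
by rewrite /GRing.scale /=; ring.
Qed.

(** The indicator and the denominators are constant in time, so only the exponential is
    differentiated. *)
Lemma PsiE N w : exists c : C, forall t, Psi N w t = c * fexp (scFw w) t.
Proof.
case e : [forall q : 'I_(size w), ~~ condA N (Defs.suffix q.+1 w)].
  by exists (\prod_(1 <= q < (size w).+1) (scFw (Defs.suffix q w))%:~R)^-1 => t; rewrite /Psi e mulrC.
by exists 0 => t; rewrite /Psi e mul0r.
Qed.

Lemma has_cderiv_Psi N w (c : C) t :
  has_cderiv (fun s => c * Psi N w s) t (c * ('i * (scFw w)%:~R * Psi N w t)).
Proof.
have [d hd] := PsiE N w.
have -> : (fun s => c * Psi N w s) = (fun s => (c * d) * fexp (scFw w) s).
  by apply/funext => s; rewrite hd mulrA.
rewrite hd [X in has_cderiv _ _ (c * X)]mulrCA [X in has_cderiv _ _ X]mulrA; exact: has_cderiv_fexp.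
Qed.

End Words.

(** * Sums over plane trees *)

(** At a fixed monomial the formal sums over trees become sums over this list. As [fset_set] is
    empty on infinite sets, [finite_trees] is what gives the list its members. *)
Definition mtrees p k (m : mono) : seq tree :=
  fset_set [set T | is_tree p k T /\ seq_mset (leaves T) = m].

Lemma mem_mtrees p k m T :
  reflect (is_tree p k T /\ seq_mset (leaves T) = m) (T \in mtrees p k m).
Proof.
have e : (T \in mtrees p k m) = (T \in [set T | is_tree p k T /\ seq_mset (leaves T) = m]).
  by rewrite -in_fset_set //; exact: finite_trees.
by rewrite e; apply: (iffP idP) => [/set_mem|h]; [|apply/mem_set].
Qed.

Lemma mtrees_uniq p k m : uniq (mtrees p k m).
Proof. exact: fset_uniq. Qed.

Section FiniteSupport.
Variables (V : nmodType) (I : choiceType).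

Lemma fsbig_seq_sub (A : set I) (s : seq I) (F : I -> V) : uniq s ->
  (forall i, i \in s -> A i) -> (forall i, A i -> i \notin s -> F i = 0) ->
  \sum_(i \in A) F i = \sum_(i <- s) F i.
Proof.
move=> us sA F0; rewrite [RHS]fsbig_seq //; symmetry; apply: fsbig_widen => [i /sA //|i [Ai /negP ni]].
exact: F0.
Qed.

(** Only the finitely many values of [f] on [s] have a nonempty fibre. This sorts pairs of trees by
    the variable that is differentiated, and then by the factorization of the monomial. *)
Lemma fsbig_partition (J : eqType) (s : seq J) (f : J -> I) (D : set I) (F : J -> V) :
  (forall j, j \in s -> D (f j)) ->
  \sum_(i \in D) \sum_(j <- s | f j == i) F j = \sum_(j <- s) F j.
Proof.
move=> sD; rewrite (@fsbig_seq_sub _ (undup (map f s))) ?undup_uniq //; first last.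
- move=> i _; rewrite mem_undup => /negP ni; rewrite big1_seq // => j /andP[/eqP fj js].
  by case: ni; rewrite -fj map_f.
- by move=> i; rewrite mem_undup => /mapP[j /sD h ->].
under eq_bigr => i _ do rewrite big_mkcond.
rewrite exchange_big big_seq [RHS]big_seq; apply: eq_bigr => j js /=.
rewrite (bigD1_seq (f j)) ?undup_uniq ?mem_undup ?map_f //= eqxx big1 ?addr0 // => i.
by rewrite eq_sym => /negbTE ->.
Qed.

End FiniteSupport.

Definition nonres_order n (T : tree) : bool :=
  (size (nodes T) == n) && all (fun T' => ~~ resonant T') (nodes T).

Definition res_order n (T : tree) : bool :=
  [&& size (nodes T) == n, count resonant (nodes T) == 1%N
    & all (fun T' => resonant T' ==> three_leaves T') (nodes T)].

Lemma hatTE n k T : hatT n k T <-> is_tree false k T /\ plane_rep T && nonres_order n T.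
Proof.
rewrite /nonres_order -torderE; split=> [[? -> -> ->]|[? /and3P[? /eqP ? ?]]]; first by rewrite eqxx.
by split.
Qed.

Lemma hatTresE n k T : hatTres n k T <-> is_tree false k T /\ plane_rep T && res_order n T.
Proof.
rewrite /res_order -torderE; split=> [[? -> -> -> ->]|[? /and4P[? /eqP ? /eqP ? ?]]]; first by rewrite !eqxx.
by split.
Qed.

Section OrbInvariants.
Variables (T T' : tree) (orbT : T' \in orb T).

Let orbn : perm_eq (map swap_data (nodes T')) (map swap_data (nodes T)).
Proof. exact: orb_nodes_mut.1. Qed.

Lemma orb_size_nodes : size (nodes T') = size (nodes T).
Proof. by have := perm_size orbn; rewrite !size_map. Qed.

Lemma orb_count (a : pred (bool * bool * nat * bool)) :
  count (a \o swap_data) (nodes T') = count (a \o swap_data) (nodes T).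
Proof. by have /seq.permP/(_ a) := orbn; rewrite !count_map. Qed.

Lemma orb_all (a : pred (bool * bool * nat * bool)) :
  all (a \o swap_data) (nodes T') = all (a \o swap_data) (nodes T).
Proof. by have := perm_all a orbn; rewrite !all_map. Qed.

Lemma orb_nonres_order n : nonres_order n T' = nonres_order n T.
Proof. by rewrite /nonres_order orb_size_nodes (orb_all (fun d => ~~ d.1.1.2)). Qed.

Lemma orb_res_order n : res_order n T' = res_order n T.
Proof.
by rewrite /res_order orb_size_nodes (orb_count (fun d => d.1.1.2)) (orb_all (fun d => d.1.1.2 ==> d.2)).
Qed.

Lemma orb_conj_sign : conj_sign T' = conj_sign T.
Proof. by rewrite !conj_signE (orb_count (fun d => d.1.1.1)). Qed.

Lemma orb_res_mult : res_mult T' = res_mult T.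
Proof.
have E S : res_mult S = (\prod_(d <- map swap_data (nodes S) | d.1.1.2) d.1.2)%N.
  by rewrite big_map.
by rewrite !E; exact: perm_big.
Qed.

End OrbInvariants.

Section Series.
Variable R : realType.
Local Notation C := R[i].

Lemma tree_sum_list (A : set tree) (Q : pred tree) k (c : tree -> R -> C) m t :
  (forall T, A T <-> is_tree false k T /\ Q T) ->
  tree_sum A c m t = \sum_(T <- mtrees false k m | Q T)
    (conj_sign T)%:~R * c T t * (2 ^+ size (nodes T) / (Saut T)%:R).
Proof.
move=> AQ; rewrite /tree_sum /ssum (@fsbig_seq_sub _ _ _ [seq T <- mtrees false k m | Q T]).
- rewrite big_filter big_seq_cond [RHS]big_seq_cond; apply: eq_bigr => T.
  move=> /andP[/mem_mtrees[_ <-] _]; rewrite /Upsilon /scale /vmono eqxx mulr1 torderE.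
  by rewrite -!mulrA [_^-1 * _]mulrC.
- by rewrite filter_uniq // mtrees_uniq.
- by move=> T; rewrite mem_filter => /andP[QT /mem_mtrees[wT _]]; apply/AQ.
- move=> T /AQ[wT QT]; rewrite mem_filter QT /= => /mem_mtrees nT.
  rewrite /scale /Upsilon /scale /vmono; case: eqP => [e|_]; last by rewrite !mulr0.
  by case: nT.
Qed.

(** The factor of [Upsilon] divided by [Saut] is the weight absorbed by [sum_plane_rep]; this asks
    for a list of trees closed under exchanges and for a coefficient invariant under them. *)
Lemma tree_sum_sym (A : set tree) (Q : pred tree) k (c : tree -> R -> C) m t :
  (forall T, A T <-> is_tree false k T /\ plane_rep T && Q T) ->
  (forall T T', T' \in orb T -> Q T' = Q T) ->
  (forall T T', T' \in orb T -> c T' t = c T t) ->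
  tree_sum A c m t = \sum_(T <- mtrees false k m | Q T) (conj_sign T)%:~R * c T t.
Proof.
move=> AQ Qo co; rewrite (tree_sum_list _ _ _ AQ) -[RHS]big_filter.
rewrite -(@sum_plane_rep _ [seq T <- mtrees false k m | Q T] (fun T => (conj_sign T)%:~R * c T t)).
- rewrite big_filter_cond /= big_seq_cond [RHS]big_seq_cond.
  apply: eq_big => [T|T /andP[/mem_mtrees[wT _] _]]; first by rewrite (andbC (Q T)).
  by rewrite (Saut_sym_factor wT).
- by rewrite filter_uniq // mtrees_uniq.
- move=> T; rewrite mem_filter => /andP[QT /mem_mtrees[wT lT]] T' oT.
  rewrite mem_filter (Qo _ _ oT) QT; apply/mem_mtrees; split; first exact: orb_wf_mut.1 oT.
  by rewrite -lT; apply/eq_seq_msetP/(orb_leaves_mut.1).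
- by move=> T _ T' oT; rewrite (orb_conj_sign oT) (co _ _ oT).
Qed.

Lemma orb_sum_arb (f : word -> C) T T' : T' \in orb T -> (forall w, f (map norm_letter w) = f w) ->
  \sum_(w <- arb T') f w = \sum_(w <- arb T) f w.
Proof.
move=> oT fn; under eq_bigr => w _ do rewrite -fn.
by have [h _] := orb_arb_mut C; rewrite (h _ _ oT); apply: eq_bigr => w _; rewrite fn.
Qed.

Lemma three_leaves_nodes T : three_leaves T = (size (nodes T) == 1%N).
Proof.
case: T => p k [? ?|? ? [? ? ? ? ?]] [? ?|? ? [? ? ? ? ?]] [? ?|? ? [? ? ? ? ?]] //=;
by rewrite ?size_cat //= ?addnS.
Qed.

Lemma nodes_three_leaves T : three_leaves T -> nodes T = [:: T].
Proof. by case: T => p k [? ?|//] [? ?|//] [? ?|//]. Qed.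

(** This is the time factor of an order-one tree in the equation. A resonant one has zero phase and
    carries instead the number of pairings that make it resonant. *)
Definition osc (T : tree) (t : R) : C :=
  if resonant T then (pairings T)%:R else fexp (scF T) t.

Lemma nls_list k b t : nls (R:=R) k b t =
  \sum_(T <- mtrees false k b | three_leaves T) - 'i * (conj_sign T)%:~R * osc T t.
Proof.
rewrite nls_tree_form /sadd (@tree_sum_sym _ (nonres_order 1) k); first last.
- by move=> T T' /(scF_orb_mut.1) ->.
- by move=> T T' oT; exact: orb_nonres_order.
- by move=> T; exact: hatTE.
rewrite (@tree_sum_sym _ (res_order 1) k); first last.
- by move=> T T' /orb_res_mult ->.
- by move=> T T' oT; exact: orb_res_order.
- by move=> T; exact: hatTresE.
rewrite big_mkcond [X in _ + X]big_mkcond [RHS]big_mkcond -big_split; apply: eq_bigr => T _ /=.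
rewrite /nonres_order /res_order -three_leaves_nodes /osc.
case h3: (three_leaves T); last by rewrite addr0.
rewrite /res_mult (nodes_three_leaves h3) /= big_cons big_nil !andbT h3.
case r: (resonant T); first by rewrite /= add0r muln1 mulrCA mulrA.
by rewrite /= addr0 mulrCA mulrA.
Qed.

End Series.

(** * The chain rule *)

Definition cvar (x : var) : var := (x.1, ~~ x.2).

Lemma cvarK : involutive cvar.
Proof. by case=> k p; rewrite /cvar /= negbK. Qed.

(* This is complex conjugation only for trees of order one. *)
Definition ctree (T : tree) : tree :=
  let: Tree p k B1 B2 B3 := T in
  Tree (~~ p) k (Leaf (~~ btype B1) (bfreq B1)) (Leaf (~~ btype B2) (bfreq B2))
    (Leaf (~~ btype B3) (bfreq B3)).

Lemma ctreeK T : three_leaves T -> ctree (ctree T) = T.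
Proof. by case: T => p k [? ?|//] [? ?|//] [? ?|//] _ /=; rewrite !negbK. Qed.

Lemma three_leaves_ctree T : three_leaves (ctree T).
Proof. by case: T. Qed.

Lemma leaves_ctree T : three_leaves T -> leaves (ctree T) = map cvar (leaves T).
Proof. by case: T => p k [? ?|//] [? ?|//] [? ?|//]. Qed.

Lemma is_tree_ctree p k T : is_tree p k T -> three_leaves T -> is_tree (~~ p) k (ctree T).
Proof.
case: T => q j [q1 l1|//] [q2 l2|//] [q3 l3|//].
move=> /is_treeE[-> -> [/is_branch_LeafE[-> _] /is_branch_LeafE[-> _] /is_branch_LeafE[-> _]] e] _.
apply/is_treeE; split=> //=; first by split; apply/is_branch_LeafE.
move: e => /=; case: p => /=; rewrite ?expr0 ?expr1; lia.
Qed.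

Lemma P_negb d p l : P (d, ~~ p) l = - P (d, p) l.
Proof. by case: p; case: d; rewrite /P /= ?expr0 ?expr1; lia. Qed.

Lemma scF_ctree T : three_leaves T -> scF (ctree T) = - scF T.
Proof.
case: T => p k [? ?|//] [? ?|//] [? ?|//] _.
by rewrite /scF /edges /= !big_cons big_nil /edec /efreq /= !P_negb; lia.
Qed.

Lemma resonant_ctree T : resonant (ctree T) = resonant T.
Proof.
case: T => p k B1 B2 B3; rewrite /= !P_negb -!opprD oppr_eq0 //.
Qed.

Lemma pairings_ctree T : pairings (ctree T) = pairings T.
Proof. by case: T. Qed.

Lemma conj_sign_ctree T : three_leaves T -> conj_sign (ctree T) = - conj_sign T.
Proof.
rewrite !conj_signE; case: T => p k [? ?|//] [? ?|//] [? ?|//] _ /=.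
by case: p.
Qed.

Lemma ctree_mem p k (b : mono) T : three_leaves T ->
  T \in mtrees p k (seq_mset (map cvar (enum_mset b))) -> ctree T \in mtrees (~~ p) k b.
Proof.
move=> h3 /mem_mtrees[wT /eq_seq_msetP lT]; apply/mem_mtrees; split; first exact: is_tree_ctree.
rewrite -[b]seq_mset_id leaves_ctree //; apply/eq_seq_msetP.
by rewrite -[X in perm_eq _ X](mapK cvarK); exact: perm_map.
Qed.

Lemma conj_imaginary_mul (F : numClosedFieldType) (z : int) (a : F) :
  (- 'i * z%:~R * a)^* = 'i * z%:~R * a^*.
Proof. by rewrite !rmorphM rmorphN /= conjCi opprK rmorph_int. Qed.

Section Conj.
Variable R : realType.
Local Notation C := R[i].

Lemma fexpN a t : fexp (- a) t = (fexp a t)^* :> C.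
Proof. by rewrite /fexp /cexp mulrNz mulNr cosN sinN. Qed.

Lemma osc_ctree T t : three_leaves T -> osc (R:=R) (ctree T) t = (osc T t)^*.
Proof.
move=> h3; rewrite /osc resonant_ctree pairings_ctree scF_ctree // fexpN.
by case: ifP => // _; rewrite conjC_nat.
Qed.

(** The map [ctree] matches the order-one trees of the two types and conjugates their oscillation,
    while the change of [-i] into [i] is the sign recorded by [conj_sign]. *)
Lemma dt_var_list x b t : dt_var (R:=R) x b t =
  \sum_(T <- mtrees x.2 x.1 b | three_leaves T) - 'i * (conj_sign T)%:~R * osc T t.
Proof.
case: x => k p; rewrite /dt_var /=; case: p; last exact: nls_list.
rewrite /sconj nls_list rmorph_sum -[LHS]big_filter -[RHS]big_filter.
transitivity (\sum_(T <- map ctree [seq T <- mtrees false k (seq_mset (map cvar (enum_mset b))) | three_leaves T])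
   (- 'i * (conj_sign T)%:~R * osc (R:=R) T t)).
  rewrite big_map [LHS]big_seq [RHS]big_seq; apply: eq_bigr => T; rewrite mem_filter => /andP[h3 _].
  rewrite -[LHS]/((- 'i * (conj_sign T)%:~R * osc T t)^*) conj_imaginary_mul.
  by rewrite conj_sign_ctree // osc_ctree // mulrNz mulrNN.
apply: perm_big; apply: uniq_perm; last 1 first.
- move=> T; apply/mapP/idP => [[S]|].
    rewrite mem_filter => /andP[h3 hS] ->.
    by rewrite mem_filter three_leaves_ctree (ctree_mem h3 hS).
  rewrite mem_filter => /andP[h3 hT]; exists (ctree T); last by rewrite ctreeK.
  rewrite mem_filter three_leaves_ctree; apply: (@ctree_mem true) => //.
  suff -> : seq_mset (map cvar (enum_mset (seq_mset (map cvar (enum_mset b))))) = b by [].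
  rewrite -[RHS]seq_mset_id; apply/eq_seq_msetP.
  by rewrite -[X in perm_eq _ X](mapK cvarK); apply: perm_map; exact: perm_eq_seq_mset.
- rewrite map_inj_in_uniq ?filter_uniq ?mtrees_uniq // => S T.
  by rewrite !mem_filter => /andP[hS _] /andP[hT _] e; rewrite -(ctreeK hS) e ctreeK.
- by rewrite filter_uniq // mtrees_uniq.
Qed.

End Conj.

Lemma seq_mset_cat (s1 s2 : seq var) : seq_mset (s1 ++ s2) = msetD (seq_mset s1) (seq_mset s2).
Proof. by apply/msetP => x; rewrite msetE2 !mset_seqE count_cat. Qed.

Lemma seq_mset_cons x (s : seq var) : seq_mset (x :: s) = msetD (msetn 1 x) (seq_mset s).
Proof. by apply/msetP => y; rewrite msetE2 !mset_seqE msetnE /= eq_sym; case: eqP. Qed.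

Lemma msetD_injl (A B D : mono) : msetD A B = msetD A D -> B = D.
Proof. by move=> e; rewrite -(msetDKB A B) e msetDKB. Qed.

Lemma grafts_prunes p k x T : is_tree p k x.1 -> is_tree (rootv x.2).2 (rootv x.2).1 x.2 ->
  three_leaves x.2 -> T \in grafts x.2 x.1 -> is_tree p k T /\ x \in prunes T.
Proof.
move=> w1 w2 h3 hT; have wT := (is_tree_grafts_mut w2).1 _ _ _ w1 _ hT; split=> //.
rewrite [x]surjective_pairing -has_pred1 has_count -(count_grafts_mut.1 _ _ _ wT) //.
by rewrite -has_count has_pred1.
Qed.

(** * Products of monomials and grafting *)

Section ChainRule.
Variables (n : nat) (k : int) (m : mono).

Definition prune_pairs : seq (tree * tree) :=
  undup (flatten [seq [seq x <- prunes T | nonres_order n x.1] | T <- mtrees false k m]).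

(** Membership is described without the grafted tree: as soon as [rootv x.2] is the variable of a
    leaf of [x.1], some grafting exists, and the last equation says that its monomial is [m]. *)
Lemma mem_prune_pairs x : x \in prune_pairs <->
  [/\ is_tree false k x.1 /\ nonres_order n x.1,
      is_tree (rootv x.2).2 (rootv x.2).1 x.2 /\ three_leaves x.2,
      rootv x.2 \in leaves x.1 &
      msetD (seq_mset (leaves x.1)) (seq_mset (leaves x.2)) = msetD (msetn 1 (rootv x.2)) m].
Proof.
rewrite mem_undup; split.
  move=> /flattenP[s /mapP[T /mem_mtrees[wT lT] ->]]; rewrite mem_filter => /andP[nx xT].
  have [w1 w2 h3] := prunes_wf_mut.1 _ _ _ wT _ xT.
  split=> //.
    rewrite -has_pred1 has_count -(size_grafts_mut _).1 -has_predT.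
    apply/hasP; exists T => //; rewrite -has_pred1 has_count (count_grafts_mut.1 _ _ _ wT) //.
    by rewrite -has_count has_pred1 -surjective_pairing.
  rewrite -seq_mset_cat -lT -seq_mset_cons; apply/esym/eq_seq_msetP.
  exact: prunes_leaves_mut.1 wT _ xT.
move=> [[w1 nx] [w2 h3] rx lx].
have : (0 < size (grafts x.2 x.1))%N by rewrite (size_grafts_mut _).1 -has_count has_pred1.
rewrite -has_predT => /hasP[T hT _].
have [wT xT] := grafts_prunes w1 w2 h3 hT.
apply/flattenP; exists [seq x <- prunes T | nonres_order n x.1]; last by rewrite mem_filter nx.
apply: map_f; apply/mem_mtrees; split=> //.
apply: (@msetD_injl (msetn 1 (rootv x.2))).
rewrite -lx -seq_mset_cat -seq_mset_cons; apply/eq_seq_msetP.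
exact: prunes_leaves_mut.1 wT _ xT.
Qed.

(** A pair admits one grafting per leaf of [x.1] with variable [rootv x.2]; this number is the
    exponent that a partial derivative brings down. *)
Lemma sum_prunes (V : nmodType) (F : tree * tree -> V) :
  \sum_(T <- mtrees false k m) \sum_(x <- prunes T | nonres_order n x.1) F x =
  \sum_(x <- prune_pairs) F x *+ count_mem (rootv x.2) (leaves x.1).
Proof.
transitivity (\sum_(T <- mtrees false k m)
    \sum_(x <- [seq x <- prunes T | nonres_order n x.1]) F x).
  by apply: eq_bigr => T _; rewrite big_filter.
rewrite -(double_count (A := prune_pairs) (r := fun x => grafts x.2 x.1)).
- apply: eq_bigr => x _; rewrite big_const_seq count_predT (size_grafts_mut _).1.
  exact: iter_addr_0.
- exact: undup_uniq.
- exact: mtrees_uniq.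
- move=> x /mem_prune_pairs[[w1 nx] [w2 h3] rx lx] T hT.
  have [wT xT] := grafts_prunes w1 w2 h3 hT.
  apply/mem_mtrees; split=> //; apply: (@msetD_injl (msetn 1 (rootv x.2))).
  rewrite -lx -seq_mset_cat -seq_mset_cons; apply/eq_seq_msetP.
  exact: prunes_leaves_mut.1 wT _ xT.
- move=> T hT x hx; rewrite mem_undup; apply/flattenP.
  by exists [seq x <- prunes T | nonres_order n x.1] => //; apply: map_f.
- move=> x T /mem_prune_pairs[[w1 nx] [w2 h3] rx lx] /mem_mtrees[wT _].
  rewrite (count_grafts_mut.1 _ _ _ wT) // count_filter; apply: eq_count => y /=.
  by rewrite -surjective_pairing; case: eqP => //= ->; rewrite nx.
Qed.

Variables (R : realType).
Local Notation C := R[i].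

Lemma chain_rule (g h : tree -> C) t (f : Defs.series R) :
  (forall b, f b t = \sum_(T <- mtrees false k b | nonres_order n T) g T) ->
  (forall x b, dt_var x b t = \sum_(T <- mtrees x.2 x.1 b | three_leaves T) h T) ->
  \sum_(x \in [set: var]) smul (pder x f) (dt_var x) m t =
  \sum_(T <- mtrees false k m) \sum_(x <- prunes T | nonres_order n x.1) g x.1 * h x.2.
Proof.
move=> fE dE; rewrite (sum_prunes (fun x => g x.1 * h x.2)).
pose F (y : tree * tree) := (g y.1 * h y.2) *+ count_mem (rootv y.2) (leaves y.1).
rewrite -(@fsbig_partition _ _ _ prune_pairs (fun y => rootv y.2) [set: var] F) //.
apply: eq_fsbigr => x _; rewrite /smul -[RHS]big_filter.
set s := [seq y <- prune_pairs | rootv y.2 == x].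
(* The monomial [m] of the grafted tree is factored into the part left by the other leaves of [y.1]
   and the monomial of [y.2]. *)
pose phi (y : tree * tree) : mono * mono := (msetB m (seq_mset (leaves y.2)), seq_mset (leaves y.2)).
rewrite -(@fsbig_partition _ _ _ s phi [set q : mono * mono | msetD q.1 q.2 = m] F).
  apply: eq_fsbigr => -[a b] /set_mem /= e; rewrite /pder fE dE.
  rewrite -[RHS]big_filter.
  pose L1 := [seq T <- mtrees false k (msetD (msetn 1 x) a) | nonres_order n T].
  pose L2 := [seq T <- mtrees x.2 x.1 b | three_leaves T].
  transitivity ((a x).+1%:R * (\sum_(T <- L1) g T) * \sum_(T <- L2) h T).
    by rewrite !big_filter.
  have mem1 T : T \in L1 <-> [/\ nonres_order n T, is_tree false k T & seq_mset (leaves T) = msetD (msetn 1 x) a].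
    rewrite mem_filter; split; first by move=> /andP[-> /mem_mtrees[]].
    by move=> [-> ? ?]; apply/mem_mtrees.
  have mem2 T : T \in L2 <-> [/\ three_leaves T, is_tree x.2 x.1 T & seq_mset (leaves T) = b].
    rewrite mem_filter; split; first by move=> /andP[-> /mem_mtrees[]].
    by move=> [-> ? ?]; apply/mem_mtrees.
  have root2 T : T \in L2 -> rootv T = x.
    by move=> /mem2[_ + _]; case: (T) => ? ? ? ? ? /is_treeE[-> -> _ _]; case: (x).
  transitivity (\sum_(y <- [seq (T1, T2) | T1 <- L1, T2 <- L2]) F y).
    rewrite big_allpairs_dep -mulrA big_distrl big_distrr /= [LHS]big_seq [RHS]big_seq; apply: eq_bigr => T1 h1.
    rewrite !big_distrr /= big_seq [RHS]big_seq; apply: eq_bigr => T2 h2.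
    (* The monomial of [T1] is [x] times [a], so [x] occurs [(a x).+1] times among its leaves, which
       is the coefficient in [pder]. *)
    rewrite /F /= (root2 _ h2) -mset_seqE; have [_ _ ->] := (mem1 _).1 h1.
    by rewrite msetE2 msetnxx add1n -[RHS]mulr_natl.
  apply: perm_big; apply: uniq_perm.
  - apply: allpairs_uniq; rewrite ?filter_uniq ?mtrees_uniq //.
    by move=> [? ?] [? ?] _ _.
  - by rewrite /s !filter_uniq // undup_uniq.
  move=> y; apply/allpairsP/idP => [[[T1 T2] /= [h1 h2 ->]]|].
    have [n1 w1 l1] := (mem1 _).1 h1; have [n2 w2 l2] := (mem2 _).1 h2.
    have r2 := root2 _ h2.
    rewrite /s !mem_filter /= r2 eqxx /=; apply/andP; split.
      by rewrite /phi l2 -e msetDC msetDKB.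
    apply/mem_prune_pairs; rewrite /= r2; split=> //.
      by rewrite -has_pred1 has_count -mset_seqE l1 msetE2 msetnxx.
    by rewrite l1 l2 -e msetDA.
  rewrite /s !mem_filter => /andP[/eqP[e1 e2] /andP[/eqP rx /mem_prune_pairs[[w1 n1] [w2 n2] x1 l1]]].
  rewrite rx in w2 l1 x1.
  exists y; case: y rx e1 e2 w1 n1 w2 n2 x1 l1 => y1 y2 /= rx e1 e2 w1 n1 w2 n2 x1 l1; split=> //.
    apply/mem1; split=> //; apply: (@msetD_injl b).
    by rewrite msetDC -{1}e2 l1 -e msetDA msetDC.
  by apply/mem2.
(* The replaced variable occurs in [y.1], so the monomial of [y.2] divides [m] and the truncated
   difference in [phi] is a true quotient. *)
move=> y; rewrite mem_filter => /andP[_ /mem_prune_pairs[_ _ x1 /msetP l1]].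
have {}x1 : (0 < seq_mset (leaves y.1) (rootv y.2))%N.
  by rewrite mset_seqE -has_count has_pred1.
apply/msetP => z; move: x1 (l1 z); rewrite /phi /= !msetE2 msetnE.
move: (seq_mset (leaves y.1)) (seq_mset (leaves y.2)) (rootv y.2) => A B r.
by case: (z =P r) => [->|_]; move: (A _) (B _) (m _); lia.
Qed.

End ChainRule.

(** * The normal form identities *)

Lemma arb_three_leaves T : three_leaves T -> arb T = [:: [:: T]].
Proof. by case: T => p k [? ?|//] [? ?|//] [? ?|//]. Qed.

Lemma resonant_three_leaves T : three_leaves T -> resonant T = (scF T == 0).
Proof.
case: T => p k [? ?|//] [? ?|//] [? ?|//] _.
by rewrite /scF /edges /= !big_cons big_nil addr0 /edec /efreq /= !addrA.
Qed.

Lemma count1_all (I : eqType) (a b : pred I) (s : seq I) y :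
  count a s = 1%N -> y \in s -> a y -> b y -> all (fun x => a x ==> b x) s.
Proof.
move=> c1 ys ay yb; have /seq.permP/(_ a) := perm_to_rem ys.
rewrite c1 /= ay add1n => -[/esym/eqP]; rewrite -leqn0 leqNgt -has_count => /hasPn h.
apply/allP => x; rewrite (perm_mem (perm_to_rem ys)) in_cons => /orP[/eqP ->|/h/negbTE -> //].
by rewrite yb implybT.
Qed.

Lemma count0_all (I : eqType) (a : pred I) (s : seq I) :
  all (fun x => ~~ a x) s = (count a s == 0%N).
Proof. by rewrite all_predC has_count eqn0Ngt. Qed.

Section Prunes.
Variables (T : tree) (x : tree * tree) (xT : x \in prunes T).

Let prunesn : perm_eq (map node_data (nodes T)) (node_data x.2 :: map node_data (nodes x.1)).
Proof. exact: prunes_nodes_mut.1. Qed.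

Lemma prunes_size_nodes : size (nodes T) = (size (nodes x.1)).+1.
Proof. by have := perm_size prunesn; rewrite /= !size_map. Qed.

Lemma prunes_count (a : pred (bool * bool * nat)) :
  count (a \o node_data) (nodes T) = (a (node_data x.2) + count (a \o node_data) (nodes x.1))%N.
Proof. by have /seq.permP/(_ a) := prunesn; rewrite /= !count_map. Qed.

Lemma prunes_conj_sign : three_leaves x.2 -> conj_sign T = conj_sign x.1 * conj_sign x.2.
Proof.
move=> h3; rewrite !conj_signE (prunes_count (fun d => d.1.1)) (nodes_three_leaves h3) /=.
by rewrite addn0 exprD mulrC.
Qed.

Lemma prunes_res_mult : all (fun T' => ~~ resonant T') (nodes x.1) -> resonant x.2 ->
  res_mult T = pairings x.2.
Proof.
move=> /allP nr r; have -> : res_mult T = (\prod_(d <- map node_data (nodes T) | d.1.2) d.2)%N.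
  by rewrite big_map.
rewrite (perm_big _ prunesn) big_cons /node_data /= r big_map /= big1_seq ?muln1 //.
by move=> T' /andP[/= rT' /nr]; rewrite rT'.
Qed.

Lemma prunes_nonres_order n : nonres_order n x.1 =
  (size (nodes T) == n.+1) && (count resonant (nodes T) == resonant x.2).
Proof.
rewrite /nonres_order prunes_size_nodes eqSS count0_all (prunes_count (fun d => d.1.2)) /=.
by congr (_ && _); case: (resonant x.2); rewrite ?add1n ?eqSS.
Qed.

(** The pruned node, which carries three leaves, accounts for the only resonant node of [T] as soon
    as the count is one; the condition on three leaves then holds at every resonant node. *)
Lemma prunes_res_order n : resonant x.2 -> three_leaves x.2 ->
  res_order n.+1 T = nonres_order n x.1.
Proof.
move=> r h3; rewrite prunes_nonres_order r /res_order; case: eqP => //= _.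
case: eqP => //= c1; apply: (count1_all c1 _ r h3); exact: prunes_mem_nodes_mut.1 xT.
Qed.

Lemma prunes_nonresonant_order n : ~~ resonant x.2 -> nonres_order n.+1 T = nonres_order n x.1.
Proof. by move=> /negbTE r; rewrite prunes_nonres_order r /nonres_order count0_all. Qed.

Lemma prunes_resonant_order n : resonant x.2 -> nonres_order n T = false.
Proof.
move=> r; rewrite /nonres_order count0_all (prunes_count (fun d => d.1.2)) /= r.
by rewrite andbF.
Qed.

End Prunes.

Section Identities.
Variables (R : realType) (N : R).
Local Notation C := R[i].

(** The cancellation takes place for each tree [T] and each way of pruning it separately: a given
    pruned letter contributes to the first sum if it is non-resonant and to the second if it is
    resonant. *)
Lemma prunes_balance n p k T (t : R) : (0 < n)%N -> is_tree p k T ->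
  (if nonres_order n.+1 T then
     (conj_sign T)%:~R * \sum_(w <- arb T) 'i * hatPsi_num N w t else 0)
  + (if res_order n.+1 T then
     (conj_sign T)%:~R * ((res_mult T)%:R * \sum_(w <- arb T | res_first w) 'i * hatPsi_num N w t)
     else 0)
  = - \sum_(x <- prunes T | nonres_order n x.1)
      ((conj_sign x.1)%:~R * \sum_(w <- arb x.1) Psi N w t)
      * (- 'i * (conj_sign x.2)%:~R * osc x.2 t) :> C.
Proof.
move=> n0 wT; case sz : (size (nodes T) == n.+1); last first.
  have [-> ->] : nonres_order n.+1 T = false /\ res_order n.+1 T = false.
    by rewrite /nonres_order /res_order sz.
  rewrite addr0 big1_seq ?oppr0 // => x /andP[+ xT].
  by rewrite (prunes_nonres_order xT) sz.
(* With [n] positive, [T] has at least two nodes, so no word of [arb T] consists of a single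
   letter. *)
have h3 : three_leaves T = false by rewrite three_leaves_nodes (eqP sz); case: (n) n0.
have sumT (f : word -> C) : \sum_(w <- arb T) f w =
    \sum_(x <- prunes T) \sum_(w <- arb x.1) f (x.2 :: w).
  by rewrite sum_arb_prunes h3 add0r.
rewrite [\sum_(w <- arb T | res_first w) _]big_mkcond !sumT.
have out (b : bool) (z : C) (f : tree * tree -> C) :
    (if b then z * \sum_(x <- prunes T) f x else 0) = \sum_(x <- prunes T) (if b then z * f x else 0).
  by case: b; rewrite ?big1_eq // big_distrr.
rewrite mulrA !out /=.
rewrite -big_split -sumrN [RHS]big_mkcond /= big_seq [RHS]big_seq; apply: eq_bigr => x xT.
have [_ _ x3] := prunes_wf_mut.1 _ _ _ wT _ xT.
case r: (resonant x.2).
  rewrite (prunes_resonant_order xT) // add0r (prunes_res_order xT) //=.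
  case: ifP => // nx; have /andP[_ na] := nx.
  rewrite (prunes_res_mult xT) // (prunes_conj_sign xT) // /osc r.
  (* A resonant letter has zero phase: its exponential is 1 and only the multiplicity [pairings]
     remains. *)
  have /eqP s0 : scF x.2 == 0 by rewrite -resonant_three_leaves.
  under [in LHS]eq_bigr => w _ do rewrite s0 fexp0 mul1r.
  rewrite -big_distrr /= intrM; ring.
(* A non-resonant first letter fails [res_first], so it contributes no word to the second sum. *)
rewrite (prunes_nonresonant_order xT) ?r // [X in _ + X](_ : _ = 0) ?addr0; last first.
  by rewrite big1_eq mulr0 if_same.
case: ifP => // nx; rewrite (prunes_conj_sign xT) // /osc r.
rewrite -!big_distrr /= intrM; ring.
Qed.

Lemma N0_list n k b t : N0 N n k b t =
  \sum_(T <- mtrees false k b | nonres_order n T) (conj_sign T)%:~R * \sum_(w <- arb T) Psi N w t.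
Proof.
apply: tree_sum_sym => [T|T T' oT|T T' oT]; first exact: hatTE.
- exact: orb_nonres_order.
- by apply: orb_sum_arb => // w; exact: Psi_norm.
Qed.

Lemma Nn_list n k b t : Nn N n k b t =
  \sum_(T <- mtrees false k b | nonres_order n T)
    (conj_sign T)%:~R * \sum_(w <- arb T) 'i * hatPsi_num N w t.
Proof.
have E T : \sum_(w <- arb T) 'i * scF_hatPsi N T w t = \sum_(w <- arb T) 'i * hatPsi_num N w t.
  by rewrite big_seq [RHS]big_seq; apply: eq_bigr => w wT; rewrite scF_hatPsi_arb.
rewrite /Nn (@tree_sum_sym _ _ (nonres_order n) k).
- by apply: eq_bigr => T _; rewrite E.
- by move=> T; exact: hatTE.
- by move=> T T' oT; exact: orb_nonres_order.
- by move=> T T' oT; rewrite !E; apply: orb_sum_arb => // w; rewrite hatPsi_num_norm.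
Qed.

Lemma Rn_list n k b t : Rn N n k b t =
  \sum_(T <- mtrees false k b | res_order n T) (conj_sign T)%:~R *
    ((res_mult T)%:R * \sum_(w <- arb T | res_first w) 'i * hatPsi_num N w t).
Proof.
have E T : \sum_(w <- arb T | res_first w) 'i * scF_hatPsi N T w t =
   \sum_(w <- arb T | res_first w) 'i * hatPsi_num N w t.
  by rewrite big_seq_cond [RHS]big_seq_cond; apply: eq_bigr => w /andP[wT _]; rewrite scF_hatPsi_arb.
rewrite /Rn (@tree_sum_sym _ _ (res_order n) k).
- by apply: eq_bigr => T _; rewrite E.
- by move=> T; exact: hatTresE.
- by move=> T T' oT; exact: orb_res_order.
- move=> T T' oT; rewrite !E (orb_res_mult oT) big_mkcond [in RHS]big_mkcond; congr (_ * _).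
  by apply: orb_sum_arb => // w; rewrite res_first_norm hatPsi_num_norm.
Qed.

Lemma cderiv_N0 n k m t : cderiv (N0 N n k m) t = N2 N n k m t.
Proof.
pose c T : C := (conj_sign T)%:~R * (2 ^+ size (nodes T) / (Saut T)%:R).
pose L := [seq T <- mtrees false k m | plane_rep T && nonres_order n T].
have -> : N0 N n k m = fun s => \sum_(T <- L) \sum_(w <- arb T) c T * Psi N w s.
  apply/funext => s; rewrite /N0 (tree_sum_list _ _ _ (@hatTE n k)) big_filter.
  by apply: eq_bigr => T _; rewrite -big_distrr mulrAC.
rewrite (has_cderivE (has_cderiv_sum L (fun T => has_cderiv_sum (arb T) (fun w => has_cderiv_Psi N w (c T) t)))).
rewrite /N2 (tree_sum_list _ _ _ (@hatTE n k)) -[RHS]big_filter; apply: eq_bigr => T _.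
rewrite big_seq (eq_bigr (fun w => c T * ('i * (scF T)%:~R) * Psi N w t)); last first.
  by move=> w wT; rewrite (scFw_arb wT) mulrA.
by rewrite -big_seq -big_distrr /c /=; ring.
Qed.

Lemma normal_form_step n k : (0 < n)%N ->
  N2 N n k = sadd (dt (N0 N n k)) (sadd (Nn N n.+1 k) (Rn N n.+1 k)).
Proof.
move=> n0; apply/funext => m; apply/funext => t; rewrite /sadd /dt cderiv_N0 -addrA.
rewrite (@chain_rule n k m R (fun T => (conj_sign T)%:~R * \sum_(w <- arb T) Psi N w t)
  (fun T => - 'i * (conj_sign T)%:~R * osc T t)); first last.
- by move=> x b; exact: dt_var_list.
- by move=> b; exact: N0_list.
rewrite Nn_list Rn_list [\sum_(T <- _ | nonres_order n.+1 T) _]big_mkcond.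
rewrite [\sum_(T <- _ | res_order n.+1 T) _]big_mkcond -!big_split /=.
rewrite big1_seq ?addr0 // => T /andP[_ /mem_mtrees[wT _]].
by rewrite (prunes_balance _ n0 wT) addrN.
Qed.

Lemma Nn_split n k : 0 <= N -> Nn N n k = sadd (N1 N n k) (N2 N n k).
Proof.
move=> N0; apply/funext => m; apply/funext => t.
rewrite /sadd /Nn /N1 /N2 !(tree_sum_list _ _ _ (@hatTE n k)) -big_split /=.
by apply: eq_bigr => T _; rewrite sum_arb_condA // mulrDr mulrDl.
Qed.

(** A tree of order one has a single word, and being non-resonant it has nonzero phase, so
    [scF_hatPsi] is the plain product of [scF T] and [hatPsi]. *)
Lemma N1_order1 k : N1 N 1 k = tree_sum (hatT 1 k `&` [set T | condA N [:: T]])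
  (fun T t => 'i * (scF T)%:~R * hatPsi N [:: T] t).
Proof.
apply/funext => m; apply/funext => t; rewrite /N1 (tree_sum_list _ _ _ (@hatTE 1 k)).
rewrite (@tree_sum_list _ _ (fun T => plane_rep T && nonres_order 1 T && condA N [:: T]) k); last first.
  move=> T; split=> [[/hatTE[wT h] cT]|[wT /andP[h cT]]]; first by rewrite h.
  by split=> //; apply/hatTE.
rewrite [RHS]big_mkcondr /=; apply: eq_bigr => T /andP[_ /andP[]].
rewrite -three_leaves_nodes => h3; rewrite (nodes_three_leaves h3) /= andbT => r.
rewrite (arb_three_leaves h3) big_cons big_nil addr0; case: ifP => _; last by rewrite mulr0 mul0r.
rewrite scF_hatPsiE ?mulrA // scFw_cons scFw_nil addr0.
by rewrite -resonant_three_leaves.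
Qed.

End Identities.

Theorem theorem4p2 (R : realType) (N : R) (hN : 0 <= N) :
  (forall (n : nat) (k : int), (1 <= n)%N ->
     N2 N n k = sadd (dt (N0 N n k)) (sadd (Nn N n.+1 k) (Rn N n.+1 k))) /\
  (forall (n : nat) (k : int), (1 <= n)%N ->
     Nn N n k = sadd (N1 N n k) (N2 N n k)) /\
  (forall k : int,
     N1 N 1 k = tree_sum (hatT 1 k `&` [set T | condA N [:: T]])
                  (fun T t => 'i * (scF T)%:~R * hatPsi N [:: T] t)).
Proof.
split; last split=> [n k _|k]; first by move=> n k; exact: normal_form_step.
- exact: Nn_split.
- exact: N1_order1.
Qed.
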